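(* Let $n\ge 2$ and let $L$ and $L'$ be oriented $n$-component virtual links. Then the following are equivalent. (i) $L$ and $L'$ are $v\Delta$-equivalent. (ii) $L$ and $L'$ are $v\Delta^\wedge$-equivalent. (iii) $L$ and $L'$ are $v\sharp$-equivalent. (iv) $p_i(L)=p_i(L')$ holds for any $i=1,\dots,n$.
   Context: Virtual links. An oriented $n$-component virtual link diagram is a generic immersion of $n$ oriented circles, ordered as $1,\dots,n$, into the plane, each double point of which is either a real crossing (with over/under information) or a virtual crossing. The generalized Reidemeister moves are: the Reidemeister moves I, II, III for real crossings; their analogues in which all crossings are virtual; and the mixed move in which a strand having two virtual crossings is passed across a real crossing. An oriented virtual link is an equivalence class of diagrams under generalized Reidemeister moves (and planar isotopy). Virtualized $\Delta$-moves. Consider a disk meeting the diagram in three oriented strands, any two of which cross exactly once, so that the three crossings are the vertices of a triangle. A $v\Delta$-move replaces three real crossings, where each of the three strands passes over at one of its two crossings and under at the other, by three virtual crossings, or is the inverse of this replacement. It is a $v\Delta^\circ$-move if the three sides of the triangle, with the orientations of the strands, form a coherently oriented cycle (equivalently, the three real crossings have the same sign); otherwise it is a $v\Delta^\wedge$-move. Virtualized $\sharp$-moves. Consider a disk meeting the diagram in a pair of parallel, disjoint strands oriented in the same direction and another pair of parallel, disjoint strands oriented in the same direction, where each strand of the first pair crosses each strand of the second pair exactly once. A $v\sharp$-move replaces four real crossings at which both strands of the first pair pass over both strands of the second pair by four virtual crossings, or is the inverse of this replacement. For a local move $X$, two oriented virtual links are $X$-equivalent if their diagrams are related by a finite sequence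 of $X$-moves and generalized Reidemeister moves. Parity. For an oriented $n$-component virtual link $L=\bigcup_{i=1}^n K_i$ with a diagram $D$, the linking number ${\rm Lk}(K_i,K_j)$ ($i\neq j$) is the sum of the signs of the real crossings of $D$ at which $K_i$ passes over $K_j$. The $i$th parity $p_i(L)\in\mathbb{Z}/2\mathbb{Z}$ is $\sum_{j\ne i}\bigl({\rm Lk}(K_i,K_j)+{\rm Lk}(K_j,K_i)\bigr)$ modulo $2$, i.e. the number modulo $2$ of real crossings of $D$ between $K_i$ and the other components. It is an invariant of $L$. *)

(* Defs.v *)
From HB Require Import structures.
From Stdlib Require Import Relation_Operators.
From mathcomp Require Import all_boot all_order all_algebra generic_quotient.
From mathcomp Require Import boolp.

Set Implicit Arguments.
Unset Strict Implicit.
Unset Printing Implicit Defensive.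

Import GRing.Theory.

(* Plane link diagrams are encoded in Morse position: a horizontal line sweeps
   the plane upwards, and a diagram is the list of the events it meets (a local
   minimum, a local maximum, a real or a virtual crossing), each at some
   horizontal position.  Planar isotopy of generic immersed curves then becomes
   the congruence generated by the codimension-one degenerations of the height
   function, see [isotopy] below. *)

(* A strand cut by the sweeping line: the index of its component, and whether
   it is oriented upwards. *)
Definition strand (n : nat) : Type := ('I_n * bool)%type.

(* The strands met by the sweeping line, from left to right. *)
Definition slice (n : nat) : Type := seq (strand n).

Definition opp_strand n (x : strand n) : strand n := (x.1, ~~ x.2).

(* OverNE (resp. OverNW) is the real crossing whose over-strand runs from bottom
   left to top right (resp. from bottom right to top left), as a non-oriented
   picture. *)
Inductive crossing := OverNE | OverNW | Virtual.

(* In [Cup x], the left branch of the local minimum is x and the right branch is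
   [opp_strand x]. *)
Inductive event (n : nat) :=
  | Cup of strand n
  | Cap
  | Cross of crossing.
Arguments Cap {n}.
Arguments Cross {n} _.

(* An event together with the number of strands on its left. *)
Definition layer (n : nat) : Type := (event n * nat)%type.
Definition word (n : nat) : Type := seq (layer n).

Definition crossing_code (k : crossing) : option bool :=
  match k with OverNE => Some true | OverNW => Some false | Virtual => None end.
Definition crossing_decode (c : option bool) : crossing :=
  match c with Some true => OverNE | Some false => OverNW | None => Virtual end.
Lemma crossing_codeK : cancel crossing_code crossing_decode.
Proof. by case. Qed.
HB.instance Definition _ := Choice.copy crossing (can_type crossing_codeK).

Definition event_code n (g : event n) : ('I_n * bool) + option crossing :=
  match g with
  | Cup x => inl x
  | Cap => inr None
  | Cross k => inr (Some k)
  end.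
Definition event_decode n (c : ('I_n * bool) + option crossing) : event n :=
  match c with
  | inl x => Cup x
  | inr None => Cap
  | inr (Some k) => Cross k
  end.
Lemma event_codeK n : cancel (@event_code n) (@event_decode n).
Proof. by case. Qed.
HB.instance Definition _ n := Choice.copy (event n) (can_type (@event_codeK n)).

Definition arity_in n (g : event n) : nat := if g is Cup _ then 0 else 2.
Definition arity_out n (g : event n) : nat := if g is Cap then 0 else 2.

(* The slice just above a layer, or None if the layer does not fit on the slice
   just below it. *)
Definition step n (s : slice n) (l : layer n) : option (slice n) :=
  let: (g, p) := l in
  match g, drop p s with
  | Cup x, t =>
      if p <= size s then Some (take p s ++ [:: x, opp_strand x & t]) else None
  | Cap, [:: x, y & t] =>
      if y == opp_strand x then Some (take p s ++ t) else None
  | Cross _, [:: x, y & t] => Some (take p s ++ [:: y, x & t])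
  | _, _ => None
  end.

Fixpoint run n (s : slice n) (w : word n) : option (slice n) :=
  if w is l :: w' then obind (fun s' => run s' w') (step s l) else Some s.

(* The slice at height h, i.e. just below the layer number h. *)
Definition slice_at n (w : word n) (h : nat) : slice n :=
  odflt [::] (run [::] (take h w)).

(* The point (h, j) is the strand number j of the slice at height h.
   [joined w] relates the points that are the two ends of an arc of one layer. *)
Inductive joined n (w : word n) : nat * nat -> nat * nat -> Prop :=
  | joined_left h g p j :
      onth w h = Some (g, p) -> j < p -> joined w (h, j) (h.+1, j)
  | joined_right h g p j :
      onth w h = Some (g, p) ->
      joined w (h, p + arity_in g + j) (h.+1, p + arity_out g + j)
  | joined_cup h x p :
      onth w h = Some (Cup x, p) -> joined w (h.+1, p) (h.+1, p.+1)
  | joined_cap h p :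
      onth w h = Some (Cap, p) -> joined w (h, p) (h, p.+1)
  | joined_NE h k p :
      onth w h = Some (Cross k, p) -> joined w (h, p) (h.+1, p.+1)
  | joined_NW h k p :
      onth w h = Some (Cross k, p) -> joined w (h, p.+1) (h.+1, p).

Definition on_component n (w : word n) (i : 'I_n) (a : nat * nat) : Prop :=
  exists o, onth (slice_at w a.1) a.2 = Some (i, o).

(* The word is a closed diagram, and for each i the strands labelled i form
   exactly one circle. *)
Definition is_diagram n (w : word n) : Prop :=
  run [::] w = Some [::] /\
  forall i : 'I_n,
    (exists a, on_component w i a) /\
    (forall a b, on_component w i a -> on_component w i b ->
       clos_refl_sym_trans _ (joined w) a b).

(* Oriented n-component virtual link diagrams, with ordered components. *)
Definition diagram (n : nat) : Type := {w : word n | `[< is_diagram w >]}.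
HB.instance Definition _ n := Choice.on (diagram n).

(* A local rule: [R s u v] allows to replace the factor u of a word by v when the
   slice just below that factor is s. *)
Definition rule (n : nat) : Type := slice n -> word n -> word n -> Prop.

Definition rule_union n (R1 R2 : rule n) : rule n :=
  fun s u v => R1 s u v \/ R2 s u v.

Definition local_move n (R : rule n) (D E : diagram n) : Prop :=
  exists w1 u v w2 s,
    [/\ sval D = w1 ++ u ++ w2, sval E = w1 ++ v ++ w2,
        run [::] w1 = Some s & R s u v].

(* Finite sequences of moves of R and of their inverses. *)
Definition equiv_by n (R : rule n) : diagram n -> diagram n -> Prop :=
  clos_refl_sym_trans _ (local_move R).

(* The crossing obtained when the NE and NW strands exchange their directions
   while each of them keeps being the over- or the under-strand. *)
Definition flip (k : crossing) : crossing :=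
  match k with OverNE => OverNW | OverNW => OverNE | Virtual => Virtual end.

Definition real (k : crossing) : bool := k != Virtual.

(* Planar isotopy: two events at the same height, birth or death of a pair of
   critical points, and a strand becoming horizontal at a crossing. *)
Inductive isotopy n : rule n :=
  | iso_exchange s g h p r :
      isotopy s [:: (g, p); (h, p + arity_out g + r)]
                [:: (h, p + arity_in g + r); (g, p)]
  | iso_zigzag_left s x p : isotopy s [:: (Cup x, p.+1); (Cap, p)] [::]
  | iso_zigzag_right s x p : isotopy s [:: (Cup x, p); (Cap, p.+1)] [::]
  | iso_cap s k p :
      isotopy s [:: (Cross k, p); (Cap, p.+1)]
                [:: (Cross (flip k), p.+1); (Cap, p)]
  | iso_cup s x k p :
      isotopy s [:: (Cup x, p); (Cross k, p.+1)]
                [:: (Cup x, p.+1); (Cross (flip k), p)].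

(* Three strands A, B, C, from left to right at the bottom and from right to left
   at the top, any two of which cross once; kAB, kAC, kBC are the three crossings.
   The crossing of A and B is the lowest one for e = false, and the highest one
   for e = true.  In each crossing the strand that comes first in the order
   A, B, C is the one directed NE. *)
Definition triangle n (e : bool) (kAB kAC kBC : crossing) (p : nat) : word n :=
  if e then [:: (Cross kBC, p.+1); (Cross kAC, p); (Cross kAB, p.+1)]
  else [:: (Cross kAB, p); (Cross kAC, p.+1); (Cross kBC, p)].

(* Each of A, B, C passes over at exactly one of its two crossings. *)
Definition alternating (kAB kAC kBC : crossing) : bool :=
  [&& real kAB, real kAC, real kBC,
      (kAB == OverNE) (+) (kAC == OverNE),
      (kAB == OverNW) (+) (kBC == OverNE) &
      (kAC == OverNW) (+) (kBC == OverNW)].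

(* Three real crossings whose strands are stacked at three levels, or three
   virtual crossings, or one real crossing and a strand with two virtual ones. *)
Definition slidable (kAB kAC kBC : crossing) : bool :=
  match count real [:: kAB; kAC; kBC] with
  | 3 => ~~ alternating kAB kAC kBC
  | 2 => false
  | _ => true
  end.

(* The generalized Reidemeister moves. *)
Inductive reidemeister n : rule n :=
  | reid1 s k p : reidemeister s [:: (Cross k, p); (Cap, p)] [:: (Cap, p)]
  | reid2 s k p :
      reidemeister s [:: (Cross k, p); (Cross (flip k), p)] [::]
  | reid3 s kAB kAC kBC p : slidable kAB kAC kBC ->
      reidemeister s (triangle n false kAB kAC kBC p)
                     (triangle n true kAB kAC kBC p).

Definition link_rule n : rule n := rule_union (@isotopy n) (@reidemeister n).

Definition vequiv n : rel (diagram n) :=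
  fun D E => `[< equiv_by (@link_rule n) D E >].

Lemma vequiv_refl n : reflexive (@vequiv n).
Proof. by move=> D; apply/asboolP; apply: rst_refl. Qed.
Lemma vequiv_sym n : symmetric (@vequiv n).
Proof. by move=> D E; apply/asboolP/asboolP; apply: rst_sym. Qed.
Lemma vequiv_trans n : transitive (@vequiv n).
Proof.
by move=> E D F /asboolP DE /asboolP EF; apply/asboolP; apply: rst_trans DE EF.
Qed.
Canonical vequiv_equiv n :=
  EquivRel (@vequiv n) (@vequiv_refl n) (@vequiv_sym n) (@vequiv_trans n).

(* Oriented n-component virtual links. *)
Definition vlink (n : nat) : Type := {eq_quot (@vequiv_equiv n)}%qT.

Definition is_diagram_of n (L : vlink n) (D : diagram n) : Prop :=
  (\pi_(vlink n) D)%qT = L.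

Definition link_equiv_by n (X : rule n) (L L' : vlink n) : Prop :=
  exists D D', [/\ is_diagram_of L D, is_diagram_of L' D' &
    equiv_by (rule_union X (@link_rule n)) D D'].

(* The orientation of the strand at position p: upwards or not. *)
Definition up_at n (s : slice n) (p : nat) : option bool :=
  omap snd (onth s p).

(* The sides of the triangle on A, B, C go, upwards, from AB to AC, from AB to
   BC and from AC to BC (for e = true: in the three opposite directions), so that
   they form an oriented cycle iff A and C have the same vertical direction and B
   has the other one. *)
Definition coherent n (s : slice n) (p : nat) : bool :=
  (up_at s p == up_at s p.+2) && (up_at s p != up_at s p.+1).

Definition vDelta n : rule n := fun s u v =>
  exists e kAB kAC kBC p,
    [/\ alternating kAB kAC kBC,
        u = triangle n e kAB kAC kBC p &
        v = triangle n e Virtual Virtual Virtual p].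

Definition vDelta_wedge n : rule n := fun s u v =>
  exists e kAB kAC kBC p,
    [/\ alternating kAB kAC kBC, ~~ coherent s p,
        u = triangle n e kAB kAC kBC p &
        v = triangle n e Virtual Virtual Virtual p].

(* The parallel strands at positions p, p+1 (directed NE) cross the parallel
   strands at positions p+2, p+3 (directed NW). *)
Definition grid n (k : crossing) (p : nat) : word n :=
  [:: (Cross k, p.+1); (Cross k, p); (Cross k, p.+2); (Cross k, p.+1)].

Definition vSharp n : rule n := fun s u v =>
  exists k p,
    [/\ real k, up_at s p == up_at s p.+1, up_at s p.+2 == up_at s p.+3,
        u = grid n k p & v = grid n Virtual p].

Local Open Scope ring_scope.

(* At a crossing of strands x (directed NE) and y (directed NW), OverNE is positive
   iff x and y are both oriented upwards or both downwards. *)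
Definition crossing_sign n (k : crossing) (x y : strand n) : int :=
  match k with
  | OverNE => if x.2 == y.2 then 1 else -1
  | OverNW => if x.2 == y.2 then -1 else 1
  | Virtual => 0
  end.

(* The sign of the crossing l if component i passes over component j there, and 0
   otherwise; s is the slice just below l. *)
Definition over_sign n (i j : 'I_n) (s : slice n) (l : layer n) : int :=
  match l.1, drop l.2 s with
  | Cross OverNE, [:: x, y & _] =>
      if (x.1 == i) && (y.1 == j) then crossing_sign OverNE x y else 0
  | Cross OverNW, [:: x, y & _] =>
      if (y.1 == i) && (x.1 == j) then crossing_sign OverNW x y else 0
  | _, _ => 0
  end.

Fixpoint lk_from n (i j : 'I_n) (s : slice n) (w : word n) : int :=
  if w is l :: w' then
    over_sign i j s l + lk_from i j (odflt [::] (step s l)) w'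
  else 0.

Definition lk n (D : diagram n) (i j : 'I_n) : int :=
  lk_from i j [::] (sval D).

Definition diagram_parity n (D : diagram n) (i : 'I_n) : 'F_2 :=
  (\sum_(j < n | j != i) (lk D i j + lk D j i))%:~R.

(* The parity of a diagram is invariant under the generalized Reidemeister moves,
   so that the choice of a diagram of L is immaterial. *)
Definition parity n (L : vlink n) (i : 'I_n) : 'F_2 :=
  diagram_parity (repr L) i.

(* Main.v *)
(* Modulo each of the three moves, a crossing between parallel strands can be
   changed (close up one strand of the triangle, or of the grid, and remove the
   kink), and a triangle of real crossings can be made virtual.  Rotating crossings
   extends both facts to all orientations.  A real crossing then becomes a virtual
   crossing times an involution d_ab attached to its two strands, and these
   commute and satisfy d_ab d_bc = d_ac, so that all that remains of the real
   crossings is the number modulo 2 of their ends on each strand.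

   Every diagram is equivalent to a plat: minima at the bottom, maxima at the top,
   crossings in between, and the crossings may be replaced by any others with the
   same permutation and the same marks modulo 2.  If two minima lie on the same
   component, some maximum joins two minima, and it cancels one of them; at the end
   there is one minimum for each component, and the only invariant left is the sum
   of the marks on each component, that is, the parity. *)

From HB Require Import structures.
From Stdlib Require Import Relation_Operators.
From mathcomp Require Import all_boot all_algebra generic_quotient.
From mathcomp Require Import boolp zify.
Require Import Defs.

Set Implicit Arguments.
Unset Strict Implicit.
Unset Printing Implicit Defensive.

(** * Equivalence of words *)

(** The three moves enter only through five properties of a rule [X]: it survives the addition of
    strands on the left, it allows crossing changes between parallel strands, it makes a triangle on
    three parallel strands virtual, it lifts along relabellings, and it preserves the parity count.
    Everything else is proved once for such an [X]. The obstacle is that every stage of a sequence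
    of moves must be a diagram, and that having one circle for each component is a global condition
    on paths. The calculus therefore runs on arbitrary words above an arbitrary slice ([weq]), where
    local arguments can be cut out and pasted. Connectedness is restored only at the end: it amounts
    to a statement about lifting the labels to two copies of the label set, and every move lifts.
    Rotation never makes coherently directed strands parallel. There the triangle becomes virtual
    only once real and virtual crossings are known to commute, which itself costs an auxiliary third
    strand. *)

Definition sh n k (w : word n) : word n := [seq (l.1, k + l.2) | l <- w].

Lemma sh0 n (w : word n) : sh 0 w = w.
Proof. by rewrite /sh map_id_in // => -[g p]. Qed.

Lemma sh_cat n k (u v : word n) : sh k (u ++ v) = sh k u ++ sh k v.
Proof. exact: map_cat. Qed.

Lemma run_cat n (s : slice n) u v :
  run s (u ++ v) = obind (fun s' => run s' v) (run s u).
Proof. by elim: u s => //= l u IH s; case: (step s l). Qed.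

Arguments step : simpl never.

Lemma run_cons n (s : slice n) l w :
  run s (l :: w) = obind (fun s' => run s' w) (step s l).
Proof. by []. Qed.

Lemma step_sh n (s1 s : slice n) l :
  step (s1 ++ s) (l.1, size s1 + l.2) = omap (cat s1) (step s l).
Proof.
case: l => g p; rewrite /step /=.
have dE : drop (size s1 + p) (s1 ++ s) = drop p s.
  by rewrite drop_cat ltnNge leq_addr /= addKn.
have tE : take (size s1 + p) (s1 ++ s) = s1 ++ take p s.
  by rewrite take_cat ltnNge leq_addr /= addKn.
case: g => [x||k]; rewrite dE tE.
- by rewrite size_cat leq_add2l; case: ifP => //= _; rewrite catA.
- by case: (drop p s) => [|x [|y t]] //; case: ifP => //= _; rewrite catA.
- by case: (drop p s) => [|x [|y t]] //=; rewrite catA.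
Qed.

Lemma run_sh n (s1 s : slice n) w :
  run (s1 ++ s) (sh (size s1) w) = omap (cat s1) (run s w).
Proof.
elim: w s => // l w IH s; rewrite /sh map_cons !run_cons step_sh.
by case: (step s l) => [s'|] //=; rewrite -/(sh _ _) IH.
Qed.

(** Locality of a layer: only the block [m] of strands that it touches changes. Commutation,
    lifting, painting and parity arguments all start from this decomposition. *)
Lemma stepP n (s : slice n) g p s' : step s (g, p) = Some s' ->
  exists s1 m m' s2, [/\ s = s1 ++ m ++ s2, s' = s1 ++ m' ++ s2, size s1 = p,
    size m = arity_in g & size m' = arity_out g] /\ step m (g, 0) = Some m'.
Proof.
have dE := cat_take_drop p s; rewrite /step /=.
have tS (x : strand n) t : drop p s = x :: t -> size (take p s) = p.
  move=> E; rewrite size_take; case: ltnP => // le_sp.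
  by rewrite drop_oversize in E.
case: g => [x||k].
- case: leqP => // le_ps [<-].
  exists (take p s), [::], [:: x; opp_strand x], (drop p s); split=> //.
  by rewrite dE size_takel.
- case E: (drop p s) => [|x [|y t]] //; case: eqP => // yE [<-].
  exists (take p s), [:: x; y], [::], t; rewrite (tS _ _ E) /= -{1}E dE yE /step /= eqxx.
  by split.
- case E: (drop p s) => [|x [|y t]] // [<-].
  exists (take p s), [:: x; y], [:: y; x], t.
  by rewrite (tS _ _ E) /= -{1}E dE; split.
Qed.

Lemma step_left n (s1 s2 : slice n) l s1' :
  step s1 l = Some s1' -> step (s1 ++ s2) l = Some (s1' ++ s2).
Proof.
case: l => g p /stepP[t [m [m' [t' [[-> -> <- em _] E]]]]].
have sE (r : slice n) : step (t ++ m ++ r) (g, size t) = Some (t ++ m' ++ r).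
  rewrite -[size t]addn0 (step_sh t (m ++ r) (g, 0)).
  suff -> : step (m ++ r) (g, 0) = Some (m' ++ r) by [].
  case: g E em => [x||k]; rewrite /step /=.
  - by case: m => //= -[<-] _; rewrite take0 drop0.
  - by case: m => [|x [|y m]] //=; case: ifP => //= _ [<-]; case: m => //= _; rewrite take0 ?drop0.
  - by case: m => [|x [|y m]] //= [<-]; case: m => //= _; rewrite ?take0.
by rewrite -!catA sE.
Qed.

Lemma run_left n (s1 s2 : slice n) w s1' :
  run s1 w = Some s1' -> run (s1 ++ s2) w = Some (s1' ++ s2).
Proof.
elim: w s1 => /= [|l w IH] s1; first by case=> ->.
by case E: (step s1 l) => [t|] //= /IH <-; rewrite (step_left _ E).
Qed.

(** A rule may read the directions of strands in the slice, so that translating it to the right has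
    to be a property of the rule. *)
Definition shift_closed n (X : rule n) : Prop := forall s1 s u v, X s u v ->
  X (s1 ++ s) (sh (size s1) u) (sh (size s1) v).

Section WordEquivalence.
Variables (n : nat) (X : rule n).

(** The words need not be closed. The last clause is a genuine restriction: a rule such as
    [iso_zigzag_left] relates the empty word, which always runs, to a word that runs only if the
    labels fit. *)
Definition wstep (s : slice n) (u v : word n) : Prop :=
  exists w1 u' v' w2 s', [/\ u = w1 ++ u' ++ w2, v = w1 ++ v' ++ w2,
    run s w1 = Some s', rule_union X (@link_rule n) s' u' v' &
    run s' u' = run s' v'].

Definition weq s : word n -> word n -> Prop :=
  clos_refl_sym_trans _ (wstep s).

Lemma weq_refl s u : weq s u u. Proof. exact: rst_refl. Qed.
Lemma weq_sym s u v : weq s u v -> weq s v u. Proof. exact: rst_sym. Qed.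
Lemma weq_trans s u v w : weq s u v -> weq s v w -> weq s u w.
Proof. exact: rst_trans. Qed.

Lemma weq_run s u v : weq s u v -> run s u = run s v.
Proof.
elim=> [{}u {}v [w1 [u' [v' [w2 [s' [-> -> E _ e]]]]]]|//|//|x y z _ -> _ ->//].
by rewrite !run_cat E /= !run_cat e.
Qed.

Lemma weq_ctx s s' w1 u v w2 : run s w1 = Some s' -> weq s' u v ->
  weq s (w1 ++ u ++ w2) (w1 ++ v ++ w2).
Proof.
move=> E; elim=> [{}u {}v st|{}u|{}u {}v _ H|{}u v' {}v _ H1 _ H2].
- apply: rst_step; case: st => [a [u' [v' [b [t [-> -> Ea r e]]]]]].
  exists (w1 ++ a), u', v', (b ++ w2), t.
  by rewrite run_cat E -!catA; split.
- exact: rst_refl.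
- exact: rst_sym.
- exact: rst_trans H1 H2.
Qed.

Lemma weq_catl s s' w u v : run s w = Some s' -> weq s' u v ->
  weq s (w ++ u) (w ++ v).
Proof. by move=> E H; have := weq_ctx [::] E H; rewrite !cats0. Qed.

Lemma weq_catr s u v w : weq s u v -> weq s (u ++ w) (v ++ w).
Proof. exact: (@weq_ctx s s [::]). Qed.

Lemma weq_rule s u v : rule_union X (@link_rule n) s u v ->
  run s u = run s v -> weq s u v.
Proof.
move=> r e; apply: rst_step; exists [::], u, v, [::], s.
by rewrite !cats0; split.
Qed.

Lemma weq_iso s u v : isotopy s u v -> run s u = run s v -> weq s u v.
Proof. by move=> r; apply: weq_rule; right; left. Qed.

Lemma weq_reid s u v : reidemeister s u v -> run s u = run s v -> weq s u v.
Proof. by move=> r; apply: weq_rule; right; right. Qed.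

(** [iso_exchange] swaps two single layers; iterating it moves [l] past a word on the strands to its
    right, whose positions depend on how many strands [l] leaves on the left. *)
Lemma weq_interchange1 s1 s2 l s1' w s2' : step s1 l = Some s1' ->
  run s2 w = Some s2' ->
  weq (s1 ++ s2) (l :: sh (size s1') w) (sh (size s1) w ++ [:: l]).
Proof.
move=> E; elim: w s2 => [|m w IH] s2 /=; first by move=> _; apply: weq_refl.
case Em: (step s2 m) => [t|] //= /IH {}IH.
case: l E IH => g p E IH; case: m Em => h q Em.
have [t1 [m1 [m1' [t2 [[e1 e1' ep em em']] _]]]] := stepP E.
have S1 : size s1 = p + arity_in g + size t2.
  by rewrite e1 !size_cat ep em addnA.
have S1' : size s1' = p + arity_out g + size t2.
  by rewrite e1' !size_cat ep em' addnA.
have El := step_left s2 E.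
have Er := step_sh s1 s2 (h, q); rewrite Em /= in Er.
have Er' := step_sh s1' s2 (h, q); rewrite Em /= in Er'.
apply: (@weq_trans _ _ ([:: (h, size s1 + q); (g, p)] ++ sh (size s1') w)).
  rewrite -[_ :: _]/([:: (g, p); (h, size s1' + q)] ++ sh (size s1') w).
  apply: weq_catr; apply: weq_iso.
    by rewrite S1 S1' -!addnA !(addnA p); apply: iso_exchange.
  by rewrite /run El /= Er' Er /= (step_left t E).
by apply: (@weq_catl _ _ [:: (h, size s1 + q)]) IH; rewrite /run Er.
Qed.

Lemma weq_interchange s1 s2 u s1' w s2' : run s1 u = Some s1' ->
  run s2 w = Some s2' ->
  weq (s1 ++ s2) (u ++ sh (size s1') w) (sh (size s1) w ++ u).
Proof.
elim: u s1 => [|l u IH] s1 /=; first by case=> <- _; rewrite cats0; apply: weq_refl.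
case E: (step s1 l) => [t|] //= /IH {}IH E2.
apply: (@weq_trans _ _ ([:: l] ++ (sh (size t) w ++ u))).
  rewrite -cat1s; apply: weq_catl (IH E2).
  by rewrite /run (step_left s2 E).
rewrite catA -[l :: u]cat1s catA; apply: weq_catr.
exact: weq_interchange1 E E2.
Qed.

Hypothesis Xsh : shift_closed X.

Lemma link_rule_sh (s1 s : slice n) u v : link_rule s u v ->
  link_rule (s1 ++ s) (sh (size s1) u) (sh (size s1) v).
Proof.
case=> [] [].
- move=> t g h p r; left; rewrite /sh /= !addnA; exact: iso_exchange.
- move=> t x p; left; rewrite /sh /= !addnS; exact: iso_zigzag_left.
- move=> t x p; left; rewrite /sh /= !addnS; exact: iso_zigzag_right.
- move=> t k p; left; rewrite /sh /= !addnS; exact: iso_cap.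
- move=> t x k p; left; rewrite /sh /= !addnS; exact: iso_cup.
- move=> t k p; right; exact: reid1.
- move=> t k p; right; exact: reid2.
- move=> t k1 k2 k3 p sl; right; rewrite /sh /= !addnS; exact: reid3.
Qed.

Lemma weq_sh s1 s u v : weq s u v ->
  weq (s1 ++ s) (sh (size s1) u) (sh (size s1) v).
Proof.
elim=> [{}u {}v st|{}u|{}u {}v _ H|{}u v' {}v _ H1 _ H2].
- apply: rst_step; case: st => [a [u' [v' [b [t [-> -> Ea r e]]]]]].
  exists (sh (size s1) a), (sh (size s1) u'), (sh (size s1) v').
  exists (sh (size s1) b), (s1 ++ t); rewrite !sh_cat !run_sh Ea e; split=> //.
  by case: r => r; [left; apply: Xsh | right; apply: link_rule_sh].
- exact: rst_refl.
- exact: rst_sym.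
- exact: rst_trans H1 H2.
Qed.

Lemma weq_at p s u v : p <= size s -> weq (drop p s) u v ->
  weq s (sh p u) (sh p v).
Proof.
move=> le_ps /(weq_sh (take p s)).
by rewrite cat_take_drop size_takel.
Qed.

End WordEquivalence.

(** * Local relations *)

Arguments opp_strand : simpl never.

Lemma opp_strandK n : involutive (@opp_strand n).
Proof. by case=> i b; rewrite /opp_strand /= negbK. Qed.

Lemma flipK : involutive flip. Proof. by case. Qed.

Ltac run_tac := rewrite /run /step;
  do ?[progress rewrite /= ?take0 ?drop0 ?opp_strandK ?eqxx].

(** Serves the tactic [wsub i k mid], which replaces the [k] layers from number [i] on by [mid].
    With numerals, [take] and [drop] compute, and the local equivalence and the rest of the
    calculation remain as goals. *)
Lemma weq_sub n (X : rule n) i k mid s' s W Z :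
  run s (take i W) = Some s' -> weq X s' (take k (drop i W)) mid ->
  weq X s (take i W ++ mid ++ drop (i + k) W) Z -> weq X s W Z.
Proof.
move=> E e; apply: weq_trans; rewrite -{1}(cat_take_drop i W).
rewrite -{1}(cat_take_drop k (drop i W)) drop_drop addnC.
exact: weq_ctx E e.
Qed.

Ltac wsub i k mid := 
  apply: (@weq_sub _ _ i k mid); [by run_tac | rewrite /= | rewrite /=].
Ltac iso r := apply: weq_iso; [exact: r | by run_tac].
Ltac isoR r := apply: weq_sym; apply: weq_iso; [exact: r | by run_tac].

Ltac reidR r := apply: weq_sym; apply: weq_reid; [exact: r | by run_tac].
Ltac reid r := apply: weq_reid; [exact: r | by run_tac].

Section LocalMoves.
Variables (n : nat) (X : rule n).
Hypothesis Xsh : shift_closed X.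

Local Notation weq := (weq X).
Local Notation "k @ p" := (@Cross n k, p) (at level 30).
Local Notation cup x p := (@Cup n x, p).
Local Notation cap p := (@Cap n, p).

Lemma weq_reid2 x y t k : weq (x :: y :: t) [:: k @ 0; flip k @ 0] [::].
Proof. reid reid2. Qed.

(* Turning a crossing by a quarter: it exchanges the same-direction and the
   opposite-direction cases. *)
Lemma weq_rotate x y t k : weq (x :: y :: t) [:: k @ 0]
  [:: cup (opp_strand x) 2; flip k @ 1; cap 0].
Proof.
apply: weq_sym; wsub 1 2 [:: k @ 0; cap 1]; first by isoR iso_cap.
wsub 0 2 [:: k @ 0; cup (opp_strand x) 2].
  by isoR (iso_exchange (x :: y :: t) (@Cross n k) (Cup (opp_strand x)) 0 0).
wsub 1 2 (Nil (layer n)); first by iso iso_zigzag_left.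
exact: weq_refl.
Qed.

(** [reid1] removes kinks at maxima only. A quarter turn of the crossing carries the kink of the
    minimum to a maximum, where it is removed. *)
Lemma weq_cup_reid1 x t k :
  weq t [:: cup x 0; k @ 0] [:: cup (opp_strand x) 0].
Proof.
wsub 1 1 [:: cup (opp_strand x) 2; flip k @ 1; cap 0].
  exact: weq_rotate.
wsub 0 2 [:: cup (opp_strand x) 0; cup x 0].
  by iso (iso_exchange t (Cup x) (Cup (opp_strand x)) 0 0).
wsub 1 2 [:: cup x 1; k @ 0].
  by rewrite -{2}(flipK k); iso iso_cup.
wsub 2 2 [:: cap 0]; first by reid reid1.
wsub 1 2 (Nil (layer n)); first by iso iso_zigzag_left.
exact: weq_refl.
Qed.

Lemma weq_kink a t k : weq (a :: t) [:: cup a 1; k @ 0; cap 1] [::].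
Proof.
wsub 1 2 [:: flip k @ 1; cap 0]; first by iso iso_cap.
wsub 0 2 [:: cup (opp_strand a) 1].
  exact: (weq_sh Xsh [:: a] (weq_cup_reid1 a t (flip k))).
wsub 0 2 (Nil (layer n)); first by iso iso_zigzag_left.
exact: weq_refl.
Qed.

(* Joining the rightmost top and bottom ends turns the middle crossing of the
   triangle into a kink. *)
Lemma weq_trace a b t k k1 k2 :
  weq (a :: b :: t) [:: cup a 2; k @ 0; k1 @ 1; k2 @ 0; cap 2]
    [:: k @ 0; k2 @ 0].
Proof.
wsub 0 2 [:: k @ 0; cup a 2].
  by isoR (iso_exchange (a :: b :: t) (@Cross n k) (@Cup n a) 0 0).
wsub 3 2 [:: cap 2; k2 @ 0].
  by iso (iso_exchange [:: b, a, a, opp_strand a & t] (@Cross n k2) (@Cap n) 0 0).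
wsub 1 3 (Nil (layer n)).
  exact: (weq_sh Xsh [:: b] (weq_kink a t k1)).
exact: weq_refl.
Qed.

(** Joining the right strands of the two pairs of the grid makes their crossing [k @ 2] a kink; the
    other three crossings form a triangle. *)
Lemma weq_grid_trace a b c t k :
  weq (a :: b :: c :: t) [:: cup b 3; k @ 1; k @ 0; k @ 2; k @ 1; cap 3]
    [:: k @ 1; k @ 0; k @ 1].
Proof.
wsub 0 3 [:: k @ 1; k @ 0; cup b 3].
  apply: weq_sym.
  apply: (@weq_interchange _ _ [:: a; b; c] t [:: k @ 1; k @ 0] [:: c; a; b]
    [:: cup b 0] [:: b, opp_strand b & t]); by run_tac.
wsub 4 2 [:: cap 3; k @ 1].
  by iso (iso_exchange [:: c, a, b, b, opp_strand b & t]
            (@Cross n k) (@Cap n) 1 0).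
wsub 2 3 (Nil (layer n)).
  exact: (weq_sh Xsh [:: c; a] (weq_kink b t k)).
exact: weq_refl.
Qed.

(* The strand [z] is reversed and moved to the left of [x] and [y]. *)
Lemma weq_rotate3 x y z t k : weq (x :: y :: z :: t) [:: k @ 0; k @ 1; k @ 0]
  [:: cup z 0; k @ 2; flip k @ 1; flip k @ 2; cap 3].
Proof.
apply: weq_sym.
wsub 3 2 [:: k @ 3; cap 2].
  by rewrite -{2}(flipK k); iso iso_cap.
wsub 2 2 [:: k @ 3; flip k @ 1].
  by iso (iso_exchange [:: z, opp_strand z, y, x, z & t]
            (@Cross n (flip k)) (@Cross n k) 1 0).
wsub 3 2 [:: k @ 2; cap 1].
  by rewrite -{2}(flipK k); iso iso_cap.
wsub 0 4 [:: k @ 0; k @ 1; k @ 0; cup z 0].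
  apply: (@weq_interchange _ _ [::] [:: x, y, z & t] [:: cup z 0]
    [:: z; opp_strand z] [:: k @ 0; k @ 1; k @ 0] [:: z, y, x & t]); by run_tac.
wsub 3 2 (Nil (layer n)); first by iso iso_zigzag_right.
exact: weq_refl.
Qed.

End LocalMoves.

(* Words of crossings: [(true, p)] is the real crossing [OverNE] at position [p]
   (whether it is [OverNE] or [OverNW] will not matter), [(false, p)] a virtual
   one. *)
Definition cword : Type := seq (bool * nat).
HB.instance Definition _ := Equality.on cword.

Definition ckind (b : bool) : crossing := if b then OverNE else Virtual.

Definition cw n (u : cword) : word n := [seq (Cross (ckind l.1), l.2) | l <- u].
Arguments cw n u : clear implicits.

Definition csh k (u : cword) : cword := [seq (l.1, k + l.2) | l <- u].

(** One combinator for permutations ([f = id]) and for strands with marks ([f = tog b]). Out of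
    range it does nothing, so that the actions are total. *)
Fixpoint at2 T (f : T -> T) (q : nat) (s : seq T) : seq T :=
  match q, s with
  | 0, [:: x, y & t] => [:: f y, f x & t]
  | q'.+1, x :: t => x :: at2 f q' t
  | _, _ => s
  end.

Definition cperm T (u : cword) (s : seq T) : seq T :=
  foldl (fun s l => at2 id l.2 s) s u.

Definition cvalid m (u : cword) : bool := all (fun l => l.2.+1 < m) u.

Lemma cw_cat n u v : cw n (u ++ v) = cw n u ++ cw n v.
Proof. exact: map_cat. Qed.

Lemma cw_csh n k u : cw n (csh k u) = sh k (cw n u).
Proof. by rewrite /cw /sh /csh -!map_comp. Qed.

Lemma cvalid_cat m u v : cvalid m (u ++ v) = cvalid m u && cvalid m v.
Proof. exact: all_cat. Qed.

Lemma cvalid_csh k m u : cvalid (k + m) (csh k u) = cvalid m u.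
Proof.
by rewrite /cvalid all_map; apply: eq_all => l; rewrite /= -addnS ltn_add2l.
Qed.

Lemma size_at2 T (f : T -> T) q s : size (at2 f q s) = size s.
Proof. by elim: q s => [|q IH] [|x [|y t]] //=; rewrite IH. Qed.

Lemma size_cperm T u (s : seq T) : size (cperm u s) = size s.
Proof. by elim: u s => //= l u IH s; rewrite IH size_at2. Qed.

Lemma cperm_cat T u v (s : seq T) : cperm (u ++ v) s = cperm v (cperm u s).
Proof. exact: foldl_cat. Qed.

Lemma step_cross n (s : slice n) k q :
  step s (Cross k, q) = if q.+1 < size s then Some (at2 id q s) else None.
Proof.
rewrite /step; elim: q s => [|q IH] [|x t] //=; first by case: t.
by case: t => [|y t] //; move: (IH (y :: t)); rewrite ltnS; case: (drop q _)
  => [|a [|b r]] //=; case: ifP => // _ [->].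
Qed.

Lemma run_cw n (s : slice n) u :
  cvalid (size s) u -> run s (cw n u) = Some (cperm u s).
Proof.
elim: u s => //= l u IH s /andP[lt_l u_ok].
by rewrite step_cross lt_l /= IH // size_at2.
Qed.

(** * Certified rewriting of crossings on three strands *)

Section Chains.
Variables (n : nat) (X : rule n).

Definition weq3 (x y z : strand n) (u v : cword) : Prop :=
  forall t, weq X [:: x, y, z & t] (cw n u) (cw n v).

Definition oriented (o : seq bool) (u v : cword) : Prop :=
  forall x y z, [:: x.2; y.2; z.2] = o -> weq3 x y z u v.

Fixpoint all_oriented o (rs : seq (cword * cword)) : Prop :=
  if rs is r :: rs' then oriented o r.1 r.2 /\ all_oriented o rs' else True.

(* Certificates: [chain rules o u c] checks that each word of [u :: c] is obtained
   from the previous one by one rule, in either direction, where the rules that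
   may be used depend on the directions of the three strands at that height. *)
Definition rewrites_at (r : cword * cword) (u v : cword) i : bool :=
  (take (size r.1) (drop i u) == r.1) &&
  (v == take i u ++ r.2 ++ drop (size r.1) (drop i u)).

Definition rewrites (rules : seq bool -> seq (cword * cword)) o u v : bool :=
  cvalid 3 u && has (fun i => has (fun r => rewrites_at r u v i ||
     rewrites_at (r.2, r.1) u v i) (rules (cperm (take i u) o)))
    (iota 0 (size u).+1).

Fixpoint chain rules o u (c : seq cword) : bool :=
  if c is v :: c' then rewrites rules o u v && chain rules o v c' else true.

Lemma map_at2 T T' (f : T -> T') q s :
  [seq f i | i <- at2 id q s] = at2 id q [seq f i | i <- s].
Proof. by elim: q s => [|q IH] [|x [|y t]] //=; rewrite IH. Qed.

Lemma map_cperm T T' (f : T -> T') u s :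
  [seq f i | i <- cperm u s] = cperm u [seq f i | i <- s].
Proof. by elim: u s => //= l u IH s; rewrite IH map_at2. Qed.

Lemma all_orientedP o rs r : all_oriented o rs -> r \in rs -> oriented o r.1 r.2.
Proof.
elim: rs => //= r' rs IH [H1 H2].
by case/predU1P=> [->|] //; apply: IH.
Qed.

Lemma rewritesP rules o u v : (forall o', all_oriented o' (rules o')) ->
  rewrites rules o u v -> oriented o u v.
Proof.
move=> ok /andP[u_ok /hasP[i _ /hasP[r r_in rw]]] x y z oE t.
have {ok r_in rw} [l [r' [Hr /andP[/eqP tE /eqP ->]]]] : exists l r',
    oriented (cperm (take i u) o) l r' /\ rewrites_at (l, r') u v i.
  have Hr := all_orientedP (ok _) r_in.
  case/orP: rw => rw; first by exists r.1, r.2; split=> //; case: (r) rw.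
  exists r.2, r.1; split=> // a b c e t'; apply: weq_sym; exact: Hr.
rewrite /= in tE; rewrite -{1}(cat_take_drop i u).
rewrite -{1}(cat_take_drop (size l) (drop i u)) tE !cw_cat.
have okt : cvalid (size [:: x; y; z]) (take i u).
  by rewrite -[u](cat_take_drop i) cvalid_cat in u_ok; case/andP: u_ok.
apply: (@weq_ctx _ _ _ (cperm (take i u) [:: x; y; z] ++ t)).
  by rewrite -[[:: x, y, z & t]]/([:: x; y; z] ++ t); apply: run_left (run_cw okt).
case E: (cperm _ _) (size_cperm (take i u) [:: x; y; z]) => [|a [|b [|c [|//]]]] // _.
apply: Hr; have e2 := congr1 (map snd) E; rewrite map_cperm in e2.
by rewrite -oE; exact: (esym e2).
Qed.

Lemma chainP rules o u c : (forall o', all_oriented o' (rules o')) ->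
  chain rules o u c -> oriented o u (last u c).
Proof.
move=> ok; elim: c u => [|v c IH] u /=; first by move=> _ x y z _ t; apply: weq_refl.
case/andP=> /(rewritesP ok) H1 /IH H2 x y z e t.
by apply: weq_trans (H1 _ _ _ e t) (H2 _ _ _ e t).
Qed.

End Chains.

Definition V0 := (false, 0). Definition V1 := (false, 1).
Definition S0 := (true, 0). Definition S1 := (true, 1).

Definition crossing_changing n (X : rule n) : Prop := forall x y t, x.2 = y.2 ->
  weq X [:: x, y & t] [:: (Cross OverNE, 0)] [:: (Cross OverNW, 0)].

(** Three parallel strands are never coherent, so even [vDelta_wedge] provides this case. *)
Definition triangle_changing n (X : rule n) : Prop := forall x y z,
  x.2 = y.2 -> y.2 = z.2 -> weq3 X x y z [:: S0; S1; S0] [:: V0; V1; V0].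

(** * Relations between crossings for all directions of the strands *)

Section OrientedRelations.
Variables (n : nat) (X : rule n).
Hypotheses (Xsh : shift_closed X) (crossing_change : crossing_changing X)
  (triangle_change : triangle_changing X).

Local Notation weq := (weq X).
Local Notation "k @ p" := (@Cross n k, p) (at level 30).
Local Notation cup x p := (@Cup n x, p).
Local Notation cap p := (@Cap n, p).

Lemma weq_flip_same x y t k : x.2 = y.2 ->
  weq [:: x, y & t] [:: k @ 0] [:: flip k @ 0].
Proof.
move=> e; case: k; [exact: crossing_change | | exact: weq_refl].
by apply: weq_sym; exact: crossing_change.
Qed.

Lemma weq_flip x y t k : weq [:: x, y & t] [:: k @ 0] [:: flip k @ 0].
Proof.
have [/weq_flip_same|] := eqVneq x.2 y.2; first exact.
move=> ne; apply: weq_trans (weq_rotate _ _ _ _ _) _.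
apply: weq_trans (weq_sym (weq_rotate _ _ _ _ _)).
wsub 1 1 [:: flip (flip k) @ 1]; last exact: weq_refl.
have e : y.2 = (opp_strand x).2.
  by move: ne; rewrite /opp_strand /=; case: (x.2) (y.2) => [] [].
exact: (weq_sh Xsh [:: x] (weq_flip_same _ (flip k) e)).
Qed.

Lemma weq_flip_at s k q : q.+1 < size s -> weq s [:: k @ q] [:: flip k @ q].
Proof.
move=> lt_q; have := @weq_at n X Xsh q s [:: k @ 0] [:: flip k @ 0].
rewrite /sh /= addn0; apply; first exact: ltnW (ltnW lt_q).
case E: (drop q s) => [|x [|y t]]; last exact: weq_flip.
  by have := congr1 size E; rewrite size_drop /=; lia.
by have := congr1 size E; rewrite size_drop /=; lia.
Qed.

(** The relations that need no triangle change. [S0; S0] cancels although [reid2] asks for a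
    crossing and its flip, because flipping is free; the rules on three letters are instances of
    [reid3]. *)
Definition basic_rules : seq (cword * cword) :=
  [:: ([:: S0; S0], [::]); ([:: S1; S1], [::]); ([:: V0; V0], [::]);
      ([:: V1; V1], [::]); ([:: V0; V1; V0], [:: V1; V0; V1]);
      ([:: V0; V1; S0], [:: S1; V0; V1]); ([:: S0; V1; V0], [:: V1; V0; S1]);
      ([:: V0; S1; V0], [:: V1; S0; V1]); ([:: S0; S1; S0], [:: S1; S0; S1])].

Lemma basic_rulesP o : all_oriented X o basic_rules.
Proof.
have r3 k1 k2 k3 x y z t : slidable k1 k2 k3 -> weq [:: x, y, z & t]
    (triangle n false k1 k2 k3 0) (triangle n true k1 k2 k3 0).
  by move=> sl; apply: weq_reid; [exact: reid3 | run_tac].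
have ss x y t : weq [:: x, y & t] [:: OverNE @ 0; OverNE @ 0] [::].
  wsub 1 1 [:: OverNW @ 0]; first exact: weq_flip.
  exact: (weq_reid2 _ _ _ _ OverNE).
rewrite /= /oriented /weq3; split; first by move=> x y z _ t; apply: ss.
split; first by move=> x y z _ t; apply: (weq_sh Xsh [:: x] (ss _ _ _)).
split; first by move=> x y z _ t; apply: (weq_reid2 _ _ _ _ Virtual).
split.
  by move=> x y z _ t; apply: (weq_sh Xsh [:: x] (weq_reid2 _ _ _ _ Virtual)).
by do !split=> //; move=> x y z _ t; apply: r3.
Qed.

Local Notation tri_rule := ([:: S0; S1; S0], [:: V0; V1; V0]).
Local Notation tri_rule' := ([:: S1; S0; S1], [:: V1; V0; V1]).

Lemma basic_chain o u c : chain (fun _ => basic_rules) o u c ->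
  oriented X o u (last u c).
Proof. by apply: chainP => o'; exact: basic_rulesP. Qed.

Definition coherent_dirs (o : seq bool) : bool :=
  if o is [:: x; y; z] then (x == z) && (x != y) else true.

Lemma tri_mirror x y z :
  weq3 X x y z tri_rule.1 tri_rule.2 -> weq3 X x y z tri_rule'.1 tri_rule'.2.
Proof.
move=> H t.
have H1 := @basic_chain _ [:: S1; S0; S1] [:: [:: S0; S1; S0]] isT x y z erefl t.
have H2 := @basic_chain _ [:: V0; V1; V0] [:: [:: V1; V0; V1]] isT x y z erefl t.
by apply: weq_trans H1 _; apply: weq_trans (H t) H2.
Qed.

(** [weq_rotate3] bends the third strand around to the left and reverses it, at the price of flipped
    crossings, which crossing changes repair. *)
Lemma tri_rotate x y z : weq3 X (opp_strand z) x y tri_rule.1 tri_rule.2 ->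
  weq3 X x y z tri_rule.1 tri_rule.2.
Proof.
move=> /tri_mirror H t; apply: weq_trans (weq_rotate3 X x y z t OverNE) _.
apply: (weq_trans _ (weq_sym (weq_rotate3 X x y z t Virtual))).
wsub 2 1 [:: OverNE @ 1]; first exact: weq_flip_at.
wsub 3 1 [:: OverNE @ 2]; first exact: weq_flip_at.
wsub 1 3 (sh 1 (cw n [:: V1; V0; V1])); last exact: weq_refl.
exact: (weq_sh Xsh [:: z] (H (z :: t))).
Qed.

(** [tri_rotate] acts on directions by sending (a, b, c) to (not c, a, b). The eight triples split
    into an orbit of six, which contains the two parallel triples, and the pair of coherent ones; in
    the orbit of six, at most two rotations lead to a parallel triple. *)
Lemma tri_noncoherent x y z : ~~ coherent_dirs [:: x.2; y.2; z.2] ->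
  weq3 X x y z tri_rule.1 tri_rule.2.
Proof.
case: x y z => [i a] [j b] [k c] /= nco.
have step1 : a = b -> weq3 X (i, a) (j, b) (k, c) tri_rule.1 tri_rule.2.
  move=> ab; have [bc|bc] := eqVneq b c; first exact: triangle_change.
  apply: tri_rotate; rewrite /opp_strand /=; apply: triangle_change => //=.
  by move: ab bc; case: (a) (b) (c) => [] [] [].
have [/step1|ab] := eqVneq a b; first exact.
apply: tri_rotate; rewrite /opp_strand /=.
have ca : ~~ c = a by move: nco ab; case: (a) (b) (c) => [] [] [].
apply: tri_rotate; rewrite /opp_strand /=; apply: triangle_change => //=.
by move: ca ab; case: (a) (b) (c) => [] [] [].
Qed.

Definition tri_rules (o : seq bool) : seq (cword * cword) :=
  if coherent_dirs o then [::] else [:: tri_rule; tri_rule'].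

Lemma tri_rulesP o : all_oriented X o (tri_rules o).
Proof.
rewrite /tri_rules; case co: (coherent_dirs o) => //=.
have tri x y z : [:: x.2; y.2; z.2] = o -> weq3 X x y z tri_rule.1 tri_rule.2.
  by move=> e; apply: tri_noncoherent; rewrite e co.
by split=> [x y z /tri //|]; split=> // x y z /tri /tri_mirror.
Qed.

Lemma all_oriented_cat o r1 r2 : all_oriented X o r1 -> all_oriented X o r2 ->
  all_oriented X o (r1 ++ r2).
Proof. by elim: r1 => //= r r1 IH [H1 H2] H3; split=> //; apply: IH. Qed.

(** Two strands alone offer no triangle. Here [x] is folded, and virtual crossings turn the fold so
    that a strand with the direction of [x] runs just to the left of [x] and [y]. *)
Lemma weq_third_strand x y t k l :
  weq [:: x, y & t] [:: k @ 0; l @ 0]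
    [:: cup (opp_strand x) 1; Virtual @ 0; k @ 2; l @ 2; Virtual @ 0; cap 0].
Proof.
apply: weq_sym.
wsub 2 3 [:: Virtual @ 0; k @ 2; l @ 2].
  apply: weq_sym; apply: (@weq_interchange _ _ [:: opp_strand x; x]
    [:: x, y & t] [:: Virtual @ 0] [:: x; opp_strand x] [:: k @ 0; l @ 0]
    [:: x, y & t]); by run_tac.
wsub 1 2 (Nil (layer n)); first exact: (weq_reid2 _ _ _ _ Virtual).
wsub 1 3 [:: cap 0; k @ 0; l @ 0].
  apply: weq_sym; apply: (@weq_interchange _ _ [:: x; opp_strand x]
    [:: x, y & t] [:: cap 0] [::] [:: k @ 0; l @ 0]
    [:: x, y & t]); by run_tac.
wsub 0 2 (Nil (layer n)); last exact: weq_refl.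
by iso iso_zigzag_left.
Qed.

Lemma weq_comm_same x y t : x.2 = y.2 ->
  weq [:: x, y & t] [:: OverNE @ 0; Virtual @ 0] [:: Virtual @ 0; OverNE @ 0].
Proof.
move=> e; apply: weq_trans (weq_third_strand _ _ _ _ _) _.
apply: weq_trans (weq_sym (weq_third_strand _ _ _ _ _)).
wsub 2 2 [:: Virtual @ 2; OverNE @ 2]; last exact: weq_refl.
have rP o : all_oriented X o (basic_rules ++ tri_rules o).
  by apply: all_oriented_cat (tri_rulesP o); exact: basic_rulesP.
(* The triangle [V1; V0; V1] is made real and then the overlapping [S0; S1; S0] virtual; together
   they carry the real crossing to the other side. *)
have H := @chainP n X _ (nseq 3 y.2) [:: S1; V1]
  [:: [:: V0; V0; S1; V1]; [:: V0; V1; V1; V0; S1; V1];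
      [:: V0; V1; S0; V1; V0; V1]; [:: V0; V1; S0; S1; S0; S1];
      [:: V0; V1; V0; V1; V0; S1]; [:: V1; V0; V1; V1; V0; S1];
      [:: V1; V0; V0; S1]; [:: V1; S1]] rP.
have {}H : oriented X (nseq 3 y.2) [:: S1; V1] [:: V1; S1].
  by apply: H; case: (y.2).
apply: (weq_sh Xsh [:: opp_strand x] (H x x y _ t)).
by rewrite /= e.
Qed.

(** Slid over the maximum, the crossings of [x] with [y] become crossings of [x] with
    [opp_strand y], which is parallel to [x], so that the parallel case applies. *)
Lemma weq_comm_cap x y t : x.2 != y.2 ->
  weq [:: x, y, opp_strand y & t] [:: OverNE @ 0; Virtual @ 0; cap 1]
    [:: Virtual @ 0; OverNE @ 0; cap 1].
Proof.
move=> ne.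
wsub 1 2 [:: Virtual @ 1; cap 0]; first by iso iso_cap.
wsub 2 1 [:: Virtual @ 0; cap 0]; first by reidR reid1.
wsub 0 3 (cw n [:: V1; V0; S1]).
  exact: (@basic_chain _ [:: S0; V1; V0] [:: [:: V1; V0; S1]] isT _ _ _ erefl).
wsub 2 1 [:: OverNW @ 1]; first exact: weq_flip_at.
wsub 2 2 [:: OverNE @ 0; cap 1]; first by isoR iso_cap.
wsub 1 2 [:: OverNE @ 0; Virtual @ 0].
  apply: weq_sym; apply: weq_comm_same; rewrite /opp_strand /=.
  by case: (x.2) (y.2) ne => [] [].
wsub 2 2 [:: Virtual @ 1; cap 0]; first by iso iso_cap.
wsub 0 3 (cw n [:: V0; S1; V0]).
  exact: (@basic_chain _ [:: V1; S0; V1] [:: [:: V0; S1; V0]] isT _ _ _ erefl).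
wsub 2 2 [:: cap 0]; first by reid reid1.
wsub 1 1 [:: OverNW @ 1]; first exact: weq_flip_at.
wsub 1 2 [:: OverNE @ 0; cap 1]; first by isoR iso_cap.
exact: weq_refl.
Qed.

Lemma weq_uncap x y t k l :
  weq [:: x, y & t] [:: k @ 0; l @ 0]
    [:: cup (opp_strand y) 2; k @ 0; l @ 0; cap 1].
Proof.
apply: weq_sym; wsub 0 3 [:: k @ 0; l @ 0; cup (opp_strand y) 2].
  apply: weq_sym; apply: (@weq_interchange _ _ [:: x; y] t
    [:: k @ 0; l @ 0] [:: x; y] [:: cup (opp_strand y) 0]
    [:: opp_strand y, opp_strand (opp_strand y) & t]); by run_tac.
wsub 2 2 (Nil (layer n)); last exact: weq_refl.
by iso iso_zigzag_left.
Qed.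

Lemma weq_comm x y t :
  weq [:: x, y & t] [:: OverNE @ 0; Virtual @ 0] [:: Virtual @ 0; OverNE @ 0].
Proof.
have [/weq_comm_same|ne] := eqVneq x.2 y.2; first exact.
apply: weq_trans (weq_uncap _ _ _ _ _) _.
apply: weq_trans (weq_sym (weq_uncap _ _ _ _ _)).
wsub 1 3 [:: Virtual @ 0; OverNE @ 0; cap 1]; last exact: weq_refl.
exact: weq_comm_cap.
Qed.

Definition comm_rules : seq (cword * cword) :=
  [:: ([:: S0; V0], [:: V0; S0]); ([:: S1; V1], [:: V1; S1])].

Lemma comm_rulesP o : all_oriented X o comm_rules.
Proof.
split; first by move=> x y z _ t; exact: weq_comm.
by split=> // x y z _ t; exact: (weq_sh Xsh [:: x] (weq_comm _ _ _)).
Qed.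

Lemma weq_tri x y z : weq3 X x y z tri_rule.1 tri_rule.2.
Proof.
have [co|] := boolP (coherent_dirs [:: x.2; y.2; z.2]); last exact: tri_noncoherent.
have rP o : all_oriented X o (basic_rules ++ comm_rules ++ tri_rules o).
  apply: all_oriented_cat; first exact: basic_rulesP.
  by apply: all_oriented_cat (comm_rulesP o) (tri_rulesP o).
(* Inserting [S0; S0] below and using the braid relation leaves a real triangle just above a
   crossing of the first two strands. At that height the directions are no longer coherent;
   commutation clears the rest. *)
apply: (@chainP n X _ [:: x.2; y.2; z.2] [:: S0; S1; S0]
  [:: [:: S0; S0; S0; S1; S0]; [:: S0; S0; S1; S0; S1];
      [:: S0; V0; V1; V0; S1]; [:: V0; S0; V1; V0; S1];
      [:: V0; V1; V0; S1; S1]; [:: V0; V1; V0]] rP) => //.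
by move: co; case: (x.2) (y.2) (z.2) => [] [] [].
Qed.

Definition full_rules : seq (cword * cword) :=
  basic_rules ++ comm_rules ++ [:: tri_rule; tri_rule'].

Lemma full_chain x y z u c :
  chain (fun _ => full_rules) [:: x.2; y.2; z.2] u c -> weq3 X x y z u (last u c).
Proof.
move=> H; apply: chainP H _ _ _ erefl => o.
apply: all_oriented_cat; first exact: basic_rulesP.
apply: all_oriented_cat; first exact: comm_rulesP.
split; first by move=> x' y' z' _; exact: weq_tri.
by split=> // x' y' z' _; apply: tri_mirror; exact: weq_tri.
Qed.

(** With d the involution S V of the overview, this is d_xz = d_xy d_yz: a real crossing at the end
    of the path of [x] is traded for one at its start and one between the other strands. The next
    two lemmas are further forms of the same identity, used to move a chord past a crossing. *)
Lemma weq_V0S1 x y z : weq3 X x y z [:: V0; S1] [:: S1; V1; S0; V1].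
Proof.
exact: (@full_chain _ _ _ _ [:: [:: V1; V1; V0; S1];
  [:: V1; V1; V0; V1; V1; S1]; [:: V1; S1; S0; S1; V1; S1];
  [:: S1; V1; S0; S1; V1; S1]; [:: S1; V1; S0; V1; S1; S1];
  [:: S1; V1; S0; V1]]).
Qed.

Lemma weq_S0V0V1 x y z :
  weq3 X x y z [:: S0; V0; V1] [:: V1; S1; V1; S0; V0].
Proof.
exact: (@full_chain _ _ _ _ [:: [:: S0; V0; V1; V0; V0];
  [:: S0; S0; S1; S0; V0]; [:: S1; S0; V0]; [:: V1; V1; S1; S0; V0];
  [:: V1; S1; V1; S0; V0]]).
Qed.

Lemma weq_S0V0S1 x y z : weq3 X x y z [:: S0; V0; S1] [:: V1; S0; V0].
Proof.
exact: (@full_chain _ _ _ _ [:: [:: V0; S0; S1]; [:: V0; S0; S1; S0; S0];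
  [:: V0; V0; V1; V0; S0]; [:: V1; V0; S0]; [:: V1; S0; V0]]).
Qed.

End OrientedRelations.

(** * The moves vDelta, vDelta_wedge and vSharp *)

Section Instances.
Variable n : nat.
Local Notation "k @ p" := (@Cross n k, p) (at level 30).
Local Notation cup x p := (@Cup n x, p).
Local Notation cap p := (@Cap n, p).

Lemma up_at_sh (s1 s : slice n) p : up_at (s1 ++ s) (size s1 + p) = up_at s p.
Proof. by rewrite /up_at onth_cat ltnNge leq_addr /= addKn. Qed.

Lemma triangle_sh k e k1 k2 k3 p :
  sh k (triangle n e k1 k2 k3 p) = triangle n e k1 k2 k3 (k + p).
Proof. by case: e; rewrite /sh /= !addnS. Qed.

Lemma vDelta_sh : shift_closed (@vDelta n).
Proof.
move=> s1 s u v [e [k1 [k2 [k3 [p [alt -> ->]]]]]].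
exists e, k1, k2, k3, (size s1 + p).
by rewrite !triangle_sh; split.
Qed.

Lemma vDelta_wedge_sh : shift_closed (@vDelta_wedge n).
Proof.
move=> s1 s u v [e [k1 [k2 [k3 [p [alt nco -> ->]]]]]].
exists e, k1, k2, k3, (size s1 + p).
by rewrite !triangle_sh; split=> //; rewrite /coherent -!addnS !up_at_sh.
Qed.

Lemma vSharp_sh : shift_closed (@vSharp n).
Proof.
move=> s1 s u v [k [p [rk e1 e2 -> ->]]]; exists k, (size s1 + p).
by rewrite -!addnS !up_at_sh /sh /grid /= !addnS; split.
Qed.

Section FromTriangle.
Variable X : rule n.
Hypothesis alt_change : forall x y z t, x.2 = y.2 -> y.2 = z.2 ->
  X [:: x, y, z & t] (triangle n false OverNE OverNW OverNE 0)
    (triangle n false Virtual Virtual Virtual 0).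
Hypothesis Xsh : shift_closed X.

Lemma alt_crossing_changing : crossing_changing X.
Proof.
move=> x y t e.
(* It is enough to cancel [OverNE] with itself. Its square is the trace of an alternating triangle,
   and the trace of the virtual triangle is trivial. *)
wsub 0 0 [:: OverNW @ 0; OverNE @ 0].
  by apply: weq_sym; exact: (weq_reid2 _ _ _ _ OverNW).
wsub 1 2 (Nil (layer n)); last exact: weq_refl.
apply: weq_trans (weq_sym (weq_trace Xsh _ _ _ _ OverNW _)) _.
wsub 1 3 (triangle n false Virtual Virtual Virtual 0).
  by apply: weq_rule; [left; apply: alt_change | run_tac].
apply: weq_trans (weq_trace Xsh _ _ _ _ Virtual _) _.
exact: (weq_reid2 _ _ _ _ Virtual).
Qed.

Lemma alt_triangle_changing : triangle_changing X.
Proof.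
move=> x y z xy yz t.
wsub 1 1 [:: OverNW @ 1].
  by apply: (weq_sh Xsh [:: y] (alt_crossing_changing _ _)); rewrite -yz.
by apply: weq_rule; [left; apply: alt_change | run_tac].
Qed.
End FromTriangle.

Lemma vDelta_wedge_alt x y z t : x.2 = y.2 -> y.2 = z.2 ->
  vDelta_wedge [:: x, y, z & t] (triangle n false OverNE OverNW OverNE 0)
    (triangle n false Virtual Virtual Virtual 0).
Proof.
move=> xy yz; exists false, OverNE, OverNW, OverNE, 0; split=> //.
by rewrite /coherent /up_at /= xy yz eqxx.
Qed.

Lemma vDelta_alt x y z t : x.2 = y.2 -> y.2 = z.2 ->
  vDelta [:: x, y, z & t] (triangle n false OverNE OverNW OverNE 0)
    (triangle n false Virtual Virtual Virtual 0).
Proof. by exists false, OverNE, OverNW, OverNE, 0. Qed.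

(** The trace of the grid is the triangle of the other shape, so [reid3], available because the
    three crossings are of one kind, is applied before and after the move. *)
Lemma vSharp_triangle x y z t : x.2 = y.2 -> y.2 = z.2 ->
  weq (@vSharp n) [:: x, y, z & t] [:: OverNE @ 0; OverNE @ 1; OverNE @ 0]
    [:: Virtual @ 0; Virtual @ 1; Virtual @ 0].
Proof.
move=> xy yz.
have r3 k : weq (@vSharp n) [:: x, y, z & t] [:: k @ 0; k @ 1; k @ 0]
    [:: k @ 1; k @ 0; k @ 1].
  apply: weq_reid; last by run_tac.
  by apply: (@reid3 n _ k k k 0); case: k.
apply: weq_trans (r3 _) _; apply: weq_trans _ (weq_sym (r3 _)).
apply: weq_trans (weq_sym (weq_grid_trace vSharp_sh _ _ _ _ _)) _.
apply: weq_trans _ (weq_grid_trace vSharp_sh _ _ _ _ _).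
wsub 1 4 (grid n Virtual 0); last exact: weq_refl.
apply: weq_rule; last by run_tac.
by left; exists OverNE, 0; split=> //; rewrite /up_at /= ?xy -?yz ?xy.
Qed.

Lemma vSharp_crossing_changing : crossing_changing (@vSharp n).
Proof.
move=> x y t e.
wsub 0 0 [:: OverNW @ 0; OverNE @ 0].
  by apply: weq_sym; exact: (weq_reid2 _ _ _ _ OverNW).
wsub 1 2 (Nil (layer n)); last exact: weq_refl.
apply: weq_trans (weq_sym (weq_trace vSharp_sh _ _ _ _ OverNE _)) _.
wsub 1 3 [:: Virtual @ 0; Virtual @ 1; Virtual @ 0].
  exact: vSharp_triangle.
apply: weq_trans (weq_trace vSharp_sh _ _ _ _ Virtual _) _.
exact: (weq_reid2 _ _ _ _ Virtual).
Qed.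

Lemma vSharp_triangle_changing : triangle_changing (@vSharp n).
Proof. by move=> x y z xy yz t; exact: vSharp_triangle. Qed.

End Instances.

(** * Words of crossings *)

(* Strands carry a mark in Z/2, which each real crossing changes on both of its
   strands. *)
Definition tog T (b : bool) (x : T * bool) : T * bool := (x.1, x.2 (+) b).

Lemma tog0 T (x : T * bool) : tog false x = x.
Proof. by case: x => a b; rewrite /tog addbF. Qed.

Definition act T (u : cword) (st : seq (T * bool)) : seq (T * bool) :=
  foldl (fun st l => at2 (tog l.1) l.2 st) st u.

Lemma act_cat T u v (st : seq (T * bool)) : act (u ++ v) st = act v (act u st).
Proof. exact: foldl_cat. Qed.

Lemma size_act T u (st : seq (T * bool)) : size (act u st) = size st.
Proof. by elim: u st => //= l u IH st; rewrite IH size_at2. Qed.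

Lemma at2_catl T (f : T -> T) q (s1 s2 : seq T) :
  q.+1 < size s1 -> at2 f q (s1 ++ s2) = at2 f q s1 ++ s2.
Proof. by elim: q s1 => [|q IH] [|x [|y s]] //= lt_q; rewrite -IH. Qed.

Lemma at2_catr T (f : T -> T) q (s1 s2 : seq T) :
  at2 f (size s1 + q) (s1 ++ s2) = s1 ++ at2 f q s2.
Proof. by elim: s1 => //= x s ->. Qed.

Lemma act_catl T u (s1 s2 : seq (T * bool)) :
  cvalid (size s1) u -> act u (s1 ++ s2) = act u s1 ++ s2.
Proof.
elim: u s1 => //= l u IH s1 /andP[lt_l ok_u].
by rewrite at2_catl // IH // size_at2.
Qed.

Lemma act_catr T u (s1 s2 : seq (T * bool)) :
  act (csh (size s1) u) (s1 ++ s2) = s1 ++ act u s2.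
Proof. by elim: u s2 => //= l u IH s2; rewrite at2_catr IH. Qed.

Lemma map_at2_tog T T' (g : T * bool -> T' * bool) b q st :
  (forall x, g (tog b x) = tog b (g x)) ->
  map g (at2 (tog b) q st) = at2 (tog b) q (map g st).
Proof. by move=> gE; elim: q st => [|q IH] [|x [|y t]] //=; rewrite ?gE ?IH. Qed.

Lemma map_act T T' (g : T * bool -> T' * bool) u st :
  (forall b x, g (tog b x) = tog b (g x)) -> map g (act u st) = act u (map g st).
Proof. by move=> gE; elim: u st => //= l u IH st; rewrite IH map_at2_tog. Qed.

Lemma act_cperm T u (st : seq (T * bool)) :
  map fst (act u st) = cperm u (map fst st).
Proof.
elim: u st => //= l u IH st; rewrite IH; congr (cperm u _).
by elim: (l.2) st => [|q {}IH] [|x [|y t]] //=; rewrite ?IH.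
Qed.

(* [mv p] takes the leftmost strand to position [p]; [chord true] changes the marks
   of the two leftmost strands. *)
Definition mv p : cword := [seq (false, i) | i <- iota 0 p].
Arguments mv : simpl never.
Definition chord (d : bool) : cword := if d then [:: S0; V0] else [::].

Lemma mvS p : mv p.+1 = mv p ++ [:: (false, p)].
Proof. by rewrite /mv -addn1 iotaD map_cat. Qed.

Lemma mvD p r : mv (p + r) = mv p ++ csh p (mv r).
Proof.
by rewrite /mv iotaD map_cat add0n -{2}[p]addn0 iotaDl /csh -!map_comp.
Qed.

Lemma csh_cat k u v : csh k (u ++ v) = csh k u ++ csh k v.
Proof. exact: map_cat. Qed.

Lemma cvalidW m m' u : m <= m' -> cvalid m u -> cvalid m' u.
Proof. by move=> le_m; apply: sub_all => l /leq_trans; apply. Qed.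

Lemma cvalid_mv p m : p <= m -> cvalid m.+1 (mv p).
Proof.
move=> le_pm; apply/allP=> _ /mapP[i + ->] /=; rewrite mem_iota /=.
by rewrite ltnS => /leq_trans; apply.
Qed.

Lemma split_size T j m (s : seq T) : size s = j + m ->
  exists s1 s2, [/\ s = s1 ++ s2, size s1 = j & size s2 = m].
Proof.
move=> sE; exists (take j s), (drop j s).
by rewrite cat_take_drop size_drop size_takel sE ?leq_addr // addKn.
Qed.

(** * Normal form of words of crossings *)

Section CrossingWords.
Variables (n : nat) (X : rule n).
Hypotheses (Xsh : shift_closed X) (Xcc : crossing_changing X)
  (Xtc : triangle_changing X).

Local Notation weq := (weq X).

(** Equivalence and equality of actions are carried together, so that normal forms can be compared
    through their actions. All label types occur: strands are labelled by numbers in one use and by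
    themselves in another. *)
Definition ceq m (u v : cword) : Prop :=
  (forall s : slice n, size s = m -> weq s (cw n u) (cw n v)) /\
  (forall T (st : seq (T * bool)), size st = m -> act u st = act v st).

Lemma ceq_refl m u : ceq m u u.
Proof. by split=> // s _; apply: weq_refl. Qed.
Lemma ceq_sym m u v : ceq m u v -> ceq m v u.
Proof. by case=> H1 H2; split=> *; [apply: weq_sym; exact: H1 | rewrite H2]. Qed.
Lemma ceq_trans m u v w : ceq m u v -> ceq m v w -> ceq m u w.
Proof.
case=> H1 H2 [H3 H4]; split=> [s sE|T s sE]; last by rewrite H2 ?H4.
by apply: weq_trans (H1 _ sE) (H3 _ sE).
Qed.

Lemma ceq_ctx m w1 u v w2 : cvalid m w1 -> ceq m u v ->
  ceq m (w1 ++ u ++ w2) (w1 ++ v ++ w2).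
Proof.
move=> ok [H1 H2]; split=> [s sE|T s sE].
  rewrite !cw_cat; rewrite -sE in ok; apply: (weq_ctx _ (run_cw ok)).
  by apply: H1; rewrite size_cperm.
by rewrite !act_cat H2 // size_act.
Qed.

Lemma ceq_catl m w u v : cvalid m w -> ceq m u v -> ceq m (w ++ u) (w ++ v).
Proof. by move=> ok H; have := ceq_ctx [::] ok H; rewrite !cats0. Qed.

Lemma ceq_catr m w u v : ceq m u v -> ceq m (u ++ w) (v ++ w).
Proof. exact: (@ceq_ctx m [::]). Qed.

Lemma ceq_csh k m u v : ceq m u v -> ceq (k + m) (csh k u) (csh k v).
Proof.
case=> H1 H2; split=> [s sE|T s sE].
  rewrite !cw_csh; apply: (weq_at Xsh); first by rewrite sE leq_addr.
  by apply: H1; rewrite size_drop sE addKn.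
have [s1 [s2 [-> <- sz2]]] := split_size sE.
by rewrite !act_catr H2.
Qed.

Lemma ceq_interchange j m u v : cvalid j u -> cvalid m v ->
  ceq (j + m) (u ++ csh j v) (csh j v ++ u).
Proof.
move=> oku okv; split=> [s sE|T s sE].
  have sz1 : size (take j s) = j by rewrite size_takel // sE leq_addr.
  have sz2 : size (drop j s) = m by rewrite size_drop sE addKn.
  rewrite !cw_cat !cw_csh -{1}(cat_take_drop j s).
  have E1 : run (take j s) (cw n u) = Some (cperm u (take j s)).
    by apply: run_cw; rewrite sz1.
  have E2 : run (drop j s) (cw n v) = Some (cperm v (drop j s)).
    by apply: run_cw; rewrite sz2.
  by have := weq_interchange X E1 E2; rewrite size_cperm sz1.
have [s1 [s2 [-> sz1 sz2]]] := split_size sE.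
have e1 := act_catr v (act u s1) s2; have e2 := act_catr v s1 s2.
rewrite size_act sz1 in e1; rewrite sz1 in e2.
by rewrite !act_cat e2 !(@act_catl _ u) ?sz1 // e1.
Qed.

Lemma ceq2 q m u v : q + 2 <= m ->
  (forall x y t, weq [:: x, y & t] (cw n u) (cw n v)) ->
  (forall T (x y : T * bool) t, act u [:: x, y & t] = act v [:: x, y & t]) ->
  ceq m (csh q u) (csh q v).
Proof.
move=> le_m H1 H2; rewrite -(subnKC (leq_trans (leq_addr 2 q) le_m)).
by apply: ceq_csh; split=> [[|x [|y t]]|T [|x [|y t]]] //=; lia.
Qed.

Lemma ceq3 q m u v : q + 3 <= m -> (forall x y z, weq3 X x y z u v) ->
  (forall T (x y z : T * bool) t,
     act u [:: x, y, z & t] = act v [:: x, y, z & t]) ->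
  ceq m (csh q u) (csh q v).
Proof.
move=> le_m H1 H2; rewrite -(subnKC (leq_trans (leq_addr 3 q) le_m)).
apply: ceq_csh; split=> [[|x [|y [|z t]]]|T [|x [|y [|z t]]]] //=; try lia.
by move=> _; exact: H1.
Qed.

Lemma ceq_VV q m : q + 2 <= m -> ceq m [:: (false, q); (false, q)] [::].
Proof.
move=> le_m; have := @ceq2 q m [:: V0; V0] [::] le_m.
rewrite /csh /= addn0; apply.
  by move=> x y t; exact: (weq_reid2 _ _ _ _ Virtual).
by move=> T [x a] [y b] t; rewrite /act /= /tog /= !addbF.
Qed.

Lemma ceq_comm q m : q + 2 <= m ->
  ceq m [:: (false, q); (true, q)] [:: (true, q); (false, q)].
Proof.
move=> le_m; have := @ceq2 q m [:: V0; S0] [:: S0; V0] le_m.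
rewrite /csh /= addn0; apply.
  by move=> x y t; apply: weq_sym; exact: weq_comm.
by move=> T [x a] [y b] t; rewrite /act /= /tog /= !addbF.
Qed.

Lemma ceq_chordD d1 d2 m : (d1 || d2 -> 2 <= m) ->
  ceq m (chord d1 ++ chord d2) (chord (d1 (+) d2)).
Proof.
case: d1 d2 => [] []; rewrite ?cats0 //= => le_m; try exact: ceq_refl.
have := @ceq2 0 m [:: S0; V0; S0; V0] [::] (le_m isT).
apply; last first.
  by move=> T [x a] [y b] t; rewrite /act /= /tog /= !addbF -!addbA addbb !addbF.
move=> x y t; wsub 1 2 (cw n [:: S0; V0]).
  by apply: weq_sym; exact: weq_comm.
wsub 2 2 (Nil (layer n)); first exact: (weq_reid2 _ _ _ _ Virtual).
wsub 1 1 [:: (@Cross n OverNW, 0)]; first exact: weq_flip.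
exact: (weq_reid2 _ _ _ _ OverNE).
Qed.

Lemma ceq_natural k q m : q + 3 <= m ->
  ceq m [:: (false, q); (false, q.+1); (k, q)]
        [:: (k, q.+1); (false, q); (false, q.+1)].
Proof.
move=> le_m; have := @ceq3 q m [:: V0; V1; (k, 0)] [:: (k, 1); V0; V1] le_m.
rewrite /csh /= addn0 addn1; apply.
  move=> x y z; case: k.
    exact: (@full_chain n X Xsh Xcc Xtc x y z [:: V0; V1; S0] [:: [:: S1; V0; V1]]).
  exact: (@full_chain n X Xsh Xcc Xtc x y z [:: V0; V1; V0] [:: [:: V1; V0; V1]]).
by move=> T [x a] [y b] [z c] t; rewrite /act /= /tog /= !addbF.
Qed.

Lemma ceq_V0S1 q m : q + 3 <= m -> ceq m [:: (false, q); (true, q.+1)]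
  [:: (true, q.+1); (false, q.+1); (true, q); (false, q.+1)].
Proof.
move=> le_m; have := @ceq3 q m [:: V0; S1] [:: S1; V1; S0; V1] le_m.
rewrite /csh /= addn0 addn1; apply; first by move=> x y z; exact: weq_V0S1.
by move=> T [x a] [y b] [z c] t;
   rewrite /act /= /tog /= !addbF -!addbA addbb !addbF.
Qed.

(** Only [q = 0] matters: the crossing puts a new strand next to the first one, so the chord would
    join the first strand to another neighbour. The identity d_xy = d_xz d_yz restores it at the
    cost of crossings that avoid the first strand. *)
Lemma chord_letter d k q m : q.+1 < m -> exists w', cvalid m w' /\
  ceq m.+1 (chord d ++ [:: (k, q.+1)]) (csh 1 w' ++ chord d).
Proof.
move=> lt_q; case: d; last first.
  exists [:: (k, q)]; rewrite /cvalid /= lt_q; split=> //; exact: ceq_refl.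
case: q lt_q => [|q] lt_q; last first.
  exists [:: (k, q.+1)]; rewrite /cvalid /= lt_q; split=> //.
  have := @ceq_interchange 2 m.-1 (chord true) [:: (k, q)] isT.
  rewrite (_ : 2 + m.-1 = m.+1); last by lia.
  by apply; rewrite /cvalid /=; lia.
have le3 : 0 + 3 <= m.+1 by lia.
case: k.
  exists [:: V0]; rewrite /cvalid /= lt_q; split=> //.
  apply: (@ceq3 0 _ [:: S0; V0; S1] [:: V1; S0; V0]) => //.
    by move=> x y z; exact: weq_S0V0S1.
  by move=> T [x a] [y b] [z c] t;
     rewrite /act /= /tog /= !addbF -!addbA addbb !addbF.
exists [:: V0; S0; V0]; rewrite /cvalid /= lt_q; split=> //.
apply: (@ceq3 0 _ [:: S0; V0; V1] [:: V1; S1; V1; S0; V0]) => //.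
  by move=> x y z; exact: weq_S0V0V1.
by move=> T [x a] [y b] [z c] t;
   rewrite /act /= /tog /= !addbF -!addbA addbb !addbF.
Qed.

Lemma cvalid_chord (d : bool) m : (d -> 2 <= m) -> cvalid m (chord d).
Proof. by case: d => // /(_ isT) le_m; rewrite /cvalid /= le_m. Qed.

Lemma cvalid_csh1 m u : cvalid m.+1 (csh 1 u) = cvalid m u.
Proof. exact: (cvalid_csh 1). Qed.

Lemma chord_csh (d : bool) w m : cvalid m w -> (d -> 0 < m) -> exists w', cvalid m w' /\
  ceq m.+1 (chord d ++ csh 1 w) (csh 1 w' ++ chord d).
Proof.
move=> + ok_d; elim/last_ind: w => [|w [k q] IH].
  by exists [::]; rewrite cats0; split=> //; exact: ceq_refl.
rewrite -cats1 cvalid_cat => /andP[/IH[w1 [ok1 e1]] /andP[/= lt_q _]].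
have [w2 [ok2 e2]] := @chord_letter d k q m lt_q.
exists (w1 ++ w2); rewrite cvalid_cat ok1 ok2; split=> //.
rewrite !csh_cat catA. apply: ceq_trans (ceq_catr _ e1) _.
by rewrite -!catA; apply: ceq_catl e2; rewrite cvalid_csh1.
Qed.

(** [ceq_V0S1] pulls the real crossing at the end of the path of the first strand back by one place;
    at the start of the path it becomes the chord. *)
Lemma mv_S p m : p < m -> exists w', cvalid m w' /\
  ceq m.+1 (mv p ++ [:: (true, p)]) (csh 1 w' ++ chord true ++ mv p.+1).
Proof.
elim: p => [|p IH] lt_p.
  exists [::]; split=> //=; apply: ceq_sym.
  by apply: (@ceq_catl _ [:: S0]); [rewrite /cvalid /=; lia | exact: ceq_VV].
have [|w [ok e]] := IH; first lia.
exists ([:: (true, p); (false, p)] ++ w).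
split; first by rewrite cvalid_cat ok /cvalid /= lt_p.
rewrite mvS -catA; apply: ceq_trans.
  by apply: ceq_catl (ceq_V0S1 _); [apply: cvalid_mv; lia | lia].
rewrite -[[:: _, _, _ & _]]/([:: (true, p.+1); (false, p.+1)] ++
  [:: (true, p); (false, p.+1)]) catA.
have em : m.+1 = p.+1 + (m - p) by lia.
have e1 := @ceq_interchange p.+1 (m - p) (mv p) [:: S0; V0] (cvalid_mv (leqnn _)).
rewrite -em /csh [map _ _]/= addn0 in e1.
apply: ceq_trans (ceq_catr _ (e1 _)) _; first by rewrite /cvalid /=; lia.
rewrite -catA csh_cat -!catA; apply: ceq_catl; first by rewrite /cvalid /=; lia.
rewrite -[[:: _; _]]/([:: (true, p)] ++ [:: (false, p.+1)]) catA.
by rewrite (mvS p.+1) !catA; apply: ceq_catr; rewrite -catA.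
Qed.

(** Four cases for the new crossing: it lies to the right of the path [mv p], prolongs it ([q = p]),
    undoes its last step ([p = q.+1]), or lies to its left, and then slides below the path and moves
    one place to the right. *)
Lemma mv_letter p k q m : p <= m -> q < m -> exists w' (d : bool) p',
  [/\ cvalid m w', p' <= m, d -> 0 < m &
    ceq m.+1 (mv p ++ [:: (k, q)]) (csh 1 w' ++ chord d ++ mv p')].
Proof.
move=> le_p lt_q; have [lt_pq|le_qp] := ltnP p q.
  exists [:: (k, q.-1)], false, p; split=> //.
    by rewrite /cvalid /=; lia.
  rewrite (_ : m.+1 = p.+1 + (m - p)); last by lia.
  have := @ceq_interchange p.+1 (m - p) (mv p) [:: (k, q - p.+1)].
  rewrite /csh /= subnKC // add1n prednK; last by lia.
  by apply; [exact: cvalid_mv | rewrite /cvalid /=; lia].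
have [qp|ne_qp] := eqVneq q p.
  rewrite qp in lt_q *; case: k.
    have [w [ok e]] := mv_S lt_q.
    by exists w, true, p.+1; split=> // _; lia.
  by exists [::], false, p.+1; rewrite mvS; split=> //; exact: ceq_refl.
have [pq|ne_qp1] := eqVneq p q.+1.
  rewrite pq mvS -catA; case: k.
    have [w [ok e]] := mv_S lt_q.
    exists w, true, q; split=> //; [exact: ltnW | by lia |].
    apply: ceq_trans.
      by apply: ceq_catl (ceq_comm _); [apply: cvalid_mv; lia | lia].
    rewrite -[[:: _; _]]/([:: (true, q)] ++ [:: (false, q)]) catA.
    apply: ceq_trans (ceq_catr _ e) _; rewrite mvS -!catA.
    rewrite !catA -(catA _ [:: _]) -[X in ceq _ _ X]cats0.
    apply: ceq_catl (ceq_VV _); last by lia.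
    rewrite !cvalid_cat cvalid_csh1 ok cvalid_mv ?(ltnW lt_q) //=.
    by rewrite /cvalid /=; lia.
  exists [::], false, q; split=> //; first exact: ltnW.
  rewrite -[X in ceq _ _ X]cats0; apply: ceq_catl (ceq_VV _); last by lia.
  by apply: cvalid_mv; lia.
have [r pE] : exists r, p = q.+2 + r by exists (p - q.+2); lia.
have mvE : mv p = mv q ++ [:: (false, q); (false, q.+1)] ++ csh q.+2 (mv r).
  by rewrite pE mvD !mvS -!catA.
exists [:: (k, q)], false, p; split=> //; first by rewrite /cvalid /=; lia.
rewrite mvE -!catA; apply: ceq_trans.
  rewrite catA; apply: ceq_catl.
    by rewrite cvalid_cat cvalid_mv /cvalid /=; lia.
  apply: ceq_sym; rewrite (_ : m.+1 = q.+2 + (m - q.+1)); last by lia.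
  apply: (@ceq_interchange q.+2 (m - q.+1) [:: (k, q)]).
    by rewrite /cvalid /=; lia.
  by apply: (@cvalidW r.+1); [lia | exact: cvalid_mv].
rewrite -[chord false]/(Nil (bool * nat)) cat0s -!catA; apply: ceq_trans.
  rewrite (catA _ [:: (k, q)]); apply: ceq_catl; first by apply: cvalid_mv; lia.
  by apply: ceq_catr; apply: ceq_natural; lia.
rewrite -[[:: _; _; _]]/([:: (k, q.+1)] ++ [:: (false, q); (false, q.+1)]).
rewrite -!catA !(catA (mv q)) !(catA (csh 1 _)) !catA; do 2!apply: ceq_catr.
rewrite (_ : m.+1 = q.+1 + (m - q)); last by lia.
have := @ceq_interchange q.+1 (m - q) (mv q) [:: (k, 0)].
rewrite /csh /= addn0; apply; first exact: cvalid_mv.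
by rewrite /cvalid /=; lia.
Qed.

(** Coset decomposition: [csh 1 w'] lies in the subgroup that avoids the first strand, and the words
    [chord d ++ mv p] represent its cosets. For positive [m] there are 2(m + 1) of them, the index
    of D_m in D_(m+1). *)
Lemma cword_normal m w : cvalid m.+1 w -> exists w' (d : bool) p,
  [/\ cvalid m w', p <= m, d -> 0 < m &
    ceq m.+1 w (csh 1 w' ++ chord d ++ mv p)].
Proof.
elim/last_ind: w => [|w [k q] IH].
  by exists [::], false, 0; split=> //; exact: ceq_refl.
rewrite -cats1 cvalid_cat => /andP[/IH[w1 [d1 [p1 [ok1 le1 gd1 e1]]]]].
rewrite /cvalid /= andbT ltnS => lt_q.
have [w2 [d2 [p2 [ok2 le2 gd2 e2]]]] := mv_letter k le1 lt_q.
have [w3 [ok3 e3]] := chord_csh ok2 gd1.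
exists (w1 ++ w3), (d1 (+) d2), p2.
split; [by rewrite -/(cvalid _ _) cvalid_cat ok1 | by [] | |].
  by move: gd1 gd2; case: (d1); case: (d2).
apply: ceq_trans (ceq_catr _ e1) _; rewrite csh_cat -!catA.
apply: ceq_catl; first by rewrite cvalid_csh1.
apply: ceq_trans.
  apply: ceq_catl e2; apply: cvalid_chord => /gd1; lia.
rewrite !catA; apply: ceq_catr; apply: ceq_trans (ceq_catr _ e3) _.
rewrite -!catA; apply: ceq_catl; first by rewrite cvalid_csh1.
by apply: ceq_chordD; move: gd1 gd2; case: (d1); case: (d2) => // H1 H2 _; auto.
Qed.

Lemma act_mv T p (x : T * bool) s : p <= size s ->
  act (mv p) (x :: s) = take p s ++ x :: drop p s.
Proof.
elim: p => [|p IH] le_p; first by rewrite take0 drop0.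
rewrite mvS act_cat IH ?(ltnW le_p) //.
have [y [t E]] : exists y t, drop p s = y :: t.
  case E: (drop p s) => [|y t]; last by exists y, t.
  by move: (congr1 size E); rewrite size_drop /=; lia.
have -> : drop p.+1 s = t by rewrite -add1n -drop_drop E /= drop0.
have -> : take p.+1 s = take p s ++ [:: y].
  by rewrite -addn1 takeD E /= take0.
rewrite /= E -[X in at2 _ X](_ : size (take p s) + 0 = _); last first.
  by rewrite addn0 size_takel // ltnW.
by rewrite at2_catr /= -catA !tog0.
Qed.

Definition tog_head T (d : bool) (s : seq (T * bool)) : seq (T * bool) :=
  if s is x :: s' then tog d x :: s' else [::].

Lemma act_normal T (d : bool) p w (x : T * bool) s : (d -> 0 < size s) -> p <= size s ->
  act (csh 1 w ++ chord d ++ mv p) (x :: s) =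
  take p (tog_head d (act w s)) ++ tog d x :: drop p (tog_head d (act w s)).
Proof.
move=> gd le_p; rewrite !act_cat (act_catr w [:: x]).
have szh r : size (tog_head d r) = size r by case: r.
rewrite -(act_mv (tog d x)) ?szh ?size_act //; congr (act _ _).
case: d gd szh => gd _.
  have := size_act w s; case: (act w s) (gd isT) => [|y t]; first by case: (s).
  by case: x y => x a [y b]; rewrite /chord /act /= /tog /= !addbF.
by rewrite tog0; case: (act w s) => //= y t; rewrite tog0.
Qed.

Lemma tog_head_inj T (d : bool) : injective (@tog_head T d).
Proof.
case=> [|[x a] s] [|[y b] t] //= [-> e ->]; congr ((_, _) :: _).
by move: e; case: d a b => [] [] [].
Qed.

Lemma cat_cons_inj (T : eqType) (x : T) (a b : bool) s1 s2 t1 t2 :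
  x \notin map fst s1 -> x \notin map fst t1 ->
  s1 ++ (x, a) :: s2 = t1 ++ (x, b) :: t2 -> [/\ s1 = t1, a = b & s2 = t2].
Proof.
elim: s1 t1 => [|[y c] s1 IH] [|[z d] t1] //=.
- by move=> _ _ [-> ->].
- by rewrite inE => _ /norP[/eqP ne _] [e]; case: ne.
- by rewrite inE => /norP[/eqP ne _] _ [e]; case: ne.
rewrite !inE => /norP[_ H1] /norP[_ H2] [-> -> /(IH _ H1 H2)[-> -> ->]].
by [].
Qed.

Lemma perm_act_fst (T : eqType) u (s : seq (T * bool)) :
  perm_eq (map fst (act u s)) (map fst s).
Proof.
rewrite act_cperm; elim: u (map fst s) => //= l u IH r.
apply: perm_trans (IH _) _.
elim: (l.2) r => [|q {}IH] [|x t] //=; last by rewrite perm_cons.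
case: t => [|y t] //=; by rewrite (perm_catCA [:: y] [:: x] t).
Qed.

(* The permutation and the marks are a complete invariant: the words of crossings
   on m strands form the Weyl group of type D_m. *)
Theorem cword_faithful (T : eqType) m u v (st : seq (T * bool)) :
  cvalid m u -> cvalid m v -> size st = m -> uniq (map fst st) ->
  act u st = act v st -> ceq m u v.
Proof.
elim: m u v st => [|m IH] u v st oku okv szst un e.
  by case: u v oku okv {e} => [|[? ?] ?] [|[? ?] ?] // _ _; exact: ceq_refl.
have [u1 [d1 [p1 [ok1 le1 gd1 e1]]]] := cword_normal oku.
have [u2 [d2 [p2 [ok2 le2 gd2 e2]]]] := cword_normal okv.
have [_ a1] := e1; have [_ a2] := e2.
apply: ceq_trans e1 _; apply: ceq_trans (ceq_sym e2).
case: st szst un e => // [[x a]] s [szs] /= /andP[xs un].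
rewrite a1 /= ?szs // a2 /= ?szs // !act_normal ?szs //.
have notin (d : bool) w p :
  x \notin map fst (take p (tog_head d (act w s))).
  apply: contra xs => /mapP[y /mem_take yin ->].
  have: y.1 \in map fst (act w s).
    have -> : map fst (act w s) = map fst (tog_head d (act w s)).
      by case: (act w s).
    exact: map_f.
  by rewrite (perm_mem (perm_act_fst _ _)).
(* The place of [x] after the action gives [p] and its mark gives [d]; what remains is the action on
   the other strands, up to the common [tog_head]. *)
move=> /cat_cons_inj[]// E1 E2 E3.
have {E2} d12 : d1 = d2 by move: E2; case: (a) (d1) (d2) => [] [] [].
have p12 : p1 = p2.
  have := congr1 size E1; rewrite !size_takel //.
    by case: (d2) gd2 => gd2; rewrite /tog_head; case E: (act u2 s)
      (size_act u2 s) => [|? ?] /=; rewrite ?szs; lia.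
  by case: (d1) gd1 => gd1; rewrite /tog_head; case E: (act u1 s)
      (size_act u1 s) => [|? ?] /=; rewrite ?szs; lia.
rewrite d12 p12 in E1 E3 *; apply: ceq_catr; apply: (ceq_csh 1).
apply: (IH _ _ s) => //; apply: (@tog_head_inj _ d2).
by rewrite -(cat_take_drop p2 (tog_head d2 (act u1 s))) E1 E3 cat_take_drop.
Qed.

End CrossingWords.

(** * Plat forms *)

(** Each new minimum is put at the far left, so the list is reversed to let [xs] read the minima
    from left to right. *)
Definition cups n (xs : seq (strand n)) : word n := [seq (Cup x, 0) | x <- rev xs].
Definition caps n k : word n := nseq k (Cap, 0).
Definition plat n (xs : seq (strand n)) (u : cword) : word n :=
  cups xs ++ cw n u ++ caps n (size xs).

Fixpoint ends n (xs : seq (strand n)) : slice n :=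
  if xs is x :: xs' then [:: x, opp_strand x & ends xs'] else [::].

(* [carry p] takes the two leftmost strands to positions [p] and [p.+1], and
   [uncarry p] takes them back. *)
Fixpoint carry p : cword :=
  if p is p'.+1 then carry p' ++ [:: (false, p); (false, p')] else [::].
Fixpoint uncarry p : cword :=
  if p is p'.+1 then [:: (false, p'); (false, p)] ++ uncarry p' else [::].

Lemma cups_cons n (x : strand n) xs : cups (x :: xs) = cups xs ++ [:: (Cup x, 0)].
Proof. by rewrite /cups rev_cons map_rcons cats1. Qed.

Lemma cups_cat n (xs ys : seq (strand n)) : cups (xs ++ ys) = cups ys ++ cups xs.
Proof. by rewrite /cups rev_cat map_cat. Qed.

Lemma size_ends n (xs : seq (strand n)) : size (ends xs) = (size xs).*2.
Proof. by elim: xs => //= x xs ->. Qed.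

Lemma ends_cat n (xs ys : seq (strand n)) : ends (xs ++ ys) = ends xs ++ ends ys.
Proof. by elim: xs => //= x xs ->. Qed.

Lemma run_cups n (xs : seq (strand n)) s : run s (cups xs) = Some (ends xs ++ s).
Proof.
elim: xs s => [|x xs IH] s //.
by rewrite cups_cons run_cat IH /= /step /=; case: (ends xs ++ s).
Qed.

Lemma run_caps n (xs : seq (strand n)) s : run (ends xs ++ s) (caps n (size xs)) = Some s.
Proof.
elim: xs s => [|x xs IH] s //; rewrite /caps /= -/(caps n _) /step /= eqxx /=.
by case: (ends xs ++ s) (IH s).
Qed.

Lemma run_capsP n k (T s : slice n) : run T (caps n k) = Some s ->
  exists ys, size ys = k /\ T = ends ys ++ s.
Proof.
elim: k T => [|k IH] T /=; first by case=> ->; exists [::].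
rewrite /step /=; case: T => [|x [|y T]] //=; rewrite ?drop0 //.
case: eqP => //= -> /= /IH[ys [<- ->]].
by exists (x :: ys).
Qed.

Lemma cvalid_carry p m : p.+2 <= m -> cvalid m (carry p).
Proof.
elim: p => //= p IH lt_p; rewrite cvalid_cat IH; last by lia.
by rewrite /cvalid /=; lia.
Qed.

Lemma cvalid_uncarry p m : p.+2 <= m -> cvalid m (uncarry p).
Proof.
elim: p => //= p IH lt_p; rewrite /cvalid /= -/(cvalid m _) IH; last by lia.
by rewrite !andbT; lia.
Qed.

Lemma act_virtual T q (a b : T * bool) s1 s2 : size s1 = q ->
  act [:: (false, q)] (s1 ++ [:: a, b & s2]) = s1 ++ [:: b, a & s2].
Proof. by move=> <-; rewrite /= -[size s1]addn0 at2_catr /= !tog0. Qed.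

Lemma act_carry T (a b : T * bool) s1 s2 :
  act (carry (size s1)) [:: a, b & s1 ++ s2] = s1 ++ [:: a, b & s2].
Proof.
elim/last_ind: s1 s2 => [|s1 c IH] s2 //.
rewrite size_rcons [carry _]/= act_cat cat_rcons IH.
rewrite -[[:: _; _]]/([:: (false, (size s1).+1)] ++ [:: (false, size s1)]).
rewrite act_cat -(cat_rcons a) act_virtual ?size_rcons //.
by rewrite cat_rcons act_virtual // cat_rcons.
Qed.

Lemma act_uncarry T (a b : T * bool) s1 s2 :
  act (uncarry (size s1)) (s1 ++ [:: a, b & s2]) = [:: a, b & s1 ++ s2].
Proof.
elim/last_ind: s1 s2 => [|s1 c IH] s2 //.
rewrite size_rcons /uncarry -/uncarry act_cat cat_rcons.
rewrite -[[:: _; _]]/([:: (false, size s1)] ++ [:: (false, (size s1).+1)]).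
rewrite act_cat act_virtual // -(cat_rcons a) act_virtual ?size_rcons //.
by rewrite cat_rcons IH cat_rcons.
Qed.

Lemma cperm_catr T u (s1 s2 : seq T) :
  cperm (csh (size s1) u) (s1 ++ s2) = s1 ++ cperm u s2.
Proof. by elim: u s2 => //= l u IH s2; rewrite at2_catr IH. Qed.

Section Plats.
Variables (n : nat) (X : rule n).
Hypotheses (Xsh : shift_closed X) (Xcc : crossing_changing X)
  (Xtc : triangle_changing X).

Local Notation weq := (weq X).
Local Notation "k @ p" := (@Cross n k, p) (at level 30).
Local Notation cup x p := (@Cup n x, p).
Local Notation cap p := (@Cap n, p).

Lemma weq_cup_shift x y t :
  weq (y :: t) [:: cup x 1] [:: cup x 0; Virtual @ 1; Virtual @ 0].
Proof.
apply: weq_sym; wsub 0 2 [:: cup x 1; Virtual @ 0]; first by iso iso_cup.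
wsub 1 2 (Nil (layer n)); last exact: weq_refl.
exact: (weq_reid2 _ _ _ _ Virtual).
Qed.

Lemma weq_cap_shift x y z t : weq [:: x, y, z & t] [:: cap 1]
  [:: Virtual @ 0; Virtual @ 1; cap 0].
Proof.
apply: weq_sym; wsub 1 2 [:: Virtual @ 0; cap 1]; first by isoR iso_cap.
wsub 0 2 (Nil (layer n)); last exact: weq_refl.
exact: (weq_reid2 _ _ _ _ Virtual).
Qed.

Lemma weq_cup_carry x p s : p <= size s ->
  weq s [:: cup x p] ([:: cup x 0] ++ cw n (carry p)).
Proof.
elim: p => [|p IH] lt_p; first exact: weq_refl.
apply: (@weq_trans _ _ _ _ ([:: cup x p] ++ [:: Virtual @ p.+1; Virtual @ p])).
  have := @weq_at _ X Xsh p s [:: cup x 1] [:: cup x 0; Virtual @ 1; Virtual @ 0].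
  rewrite /sh /= addn0 addn1; apply; first exact: ltnW.
  case E: (drop p s) (size_drop p s) => [|y t]; last by move=> _; exact: weq_cup_shift.
  by rewrite /=; lia.
rewrite /= cw_cat; apply: (weq_catr _ (IH _)); exact: ltnW.
Qed.

Lemma weq_cap_carry p s : p.+1 < size s ->
  weq s [:: cap p] (cw n (uncarry p) ++ [:: cap 0]).
Proof.
elim: p s => [|p IH] s lt_p; first exact: weq_refl.
apply: (@weq_trans _ _ _ _ (cw n [:: (false, p); (false, p.+1)] ++ [:: cap p])).
  have := @weq_at _ X Xsh p s [:: cap 1] [:: Virtual @ 0; Virtual @ 1; cap 0].
  rewrite /sh /= addn0 addn1; apply; first by lia.
  case E: (drop p s) (size_drop p s) => [|x [|y [|z t]]] /=; try lia.
  by move=> _; exact: weq_cap_shift.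
rewrite /uncarry -/uncarry cw_cat -catA.
apply: weq_catl; first by apply: run_cw; rewrite /cvalid /=; lia.
by apply: IH; rewrite size_cperm; lia.
Qed.

(** Induction on the last layer. The maxima already present close only the [l.*2] leftmost strands,
    so the new layer slides below them with its position raised by [l.*2]. A minimum is then carried
    in from the far left, and a maximum is reached by carrying its two strands there. *)
Lemma plat_form w s : run [::] w = Some s -> exists xs u l,
  [/\ cvalid (size xs).*2 u, (size xs).*2 = l.*2 + size s &
    weq [::] w (cups xs ++ cw n u ++ caps n l)].
Proof.
elim/last_ind: w s => [|w [g q] IH] s.
  by case=> <-; exists [::], [::], 0; split=> //; exact: weq_refl.
rewrite -cats1 run_cat; case Ew: (run [::] w) => [s0|] //=.
have [xs [u [l [oku sz e]]]] := IH _ Ew.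
case Es: (step s0 (g, q)) => [s1|] //= [s1E].
have rxs := run_cups xs [::]; rewrite cats0 in rxs.
have okT : cvalid (size (ends xs)) u by rewrite size_ends.
have [ys [szy TE]] : exists ys, size ys = l /\ cperm u (ends xs) = ends ys ++ s0.
  by apply: run_capsP; move: (weq_run e); rewrite Ew run_cat rxs /= run_cat run_cw.
have e1 : weq [::] (w ++ [:: (g, q)])
    (cups xs ++ cw n u ++ [:: (g, l.*2 + q)] ++ caps n l).
  apply: weq_trans (weq_catr _ e) _; rewrite -!catA.
  apply: (weq_catl rxs); apply: (weq_catl (run_cw okT)); rewrite TE.
  have r1 := run_caps ys [::]; rewrite cats0 szy in r1.
  have r2 : run s0 [:: (g, q)] = Some s1 by rewrite /= Es.
  have H := weq_interchange X r1 r2; rewrite size_ends szy in H; exact: H.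
case: g {IH} Es e1 => [x||k] Es e1.
- exists (x :: xs), (csh 2 u ++ carry (l.*2 + q)), l.
  have [le_q szs] : q <= size s0 /\ size s = (size s0).+2.
    move: Es; rewrite /step; case: leqP => // le_q [].
    rewrite s1E => <-; split=> //.
    by rewrite size_cat /= size_takel // size_drop; lia.
  split; first by rewrite cvalid_cat (cvalid_csh 2) oku cvalid_carry //= doubleS; lia.
    by rewrite /= doubleS szs; lia.
  apply: weq_trans e1 _; rewrite cups_cons cw_cat -!catA.
  apply: (weq_catl rxs); apply: (@weq_trans _ _ _ _
    (cw n u ++ ([:: cup x 0] ++ cw n (carry (l.*2 + q))) ++ caps n l)).
    apply: (weq_catl (run_cw okT)); apply: weq_catr; apply: weq_cup_carry.
    by rewrite size_cperm size_ends sz leq_add2l.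
  rewrite -catA (catA (cw n u)) (catA [:: cup x 0]); apply: weq_catr.
  have r1 : run [::] [:: cup x 0] = Some [:: x; opp_strand x] by run_tac.
  have := weq_interchange X r1 (run_cw okT); rewrite cw_csh /= sh0.
  by move/weq_sym.
- exists xs, (u ++ uncarry (l.*2 + q)), l.+1.
  have [le_q szs] : q.+2 <= size s0 /\ size s0 = (size s).+2.
    have [a [m [m' [b [[-> e2 <- mE m'E] _]]]]] := stepP Es.
    by rewrite -s1E e2 !size_cat mE m'E /=; split; lia.
  split; first by rewrite cvalid_cat oku cvalid_uncarry // sz; lia.
    by rewrite sz szs; lia.
  apply: weq_trans e1 _; apply: (weq_catl rxs); rewrite cw_cat -catA.
  apply: (weq_catl (run_cw okT)); rewrite -[caps n l.+1]/([:: cap 0] ++ caps n l).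
  rewrite catA; apply: weq_catr; apply: weq_cap_carry.
  by rewrite size_cperm size_ends sz; lia.
have [lt_q szs] : q.+1 < size s0 /\ size s = size s0.
  by move: Es; rewrite step_cross s1E; case: ifP => // lt_q [<-]; rewrite size_at2.
exists xs, (u ++ [:: (k != Virtual, l.*2 + q)]), l; split.
- by rewrite cvalid_cat oku /cvalid /= sz; lia.
- by rewrite szs.
apply: weq_trans e1 _; apply: (weq_catl rxs); rewrite cw_cat -catA.
apply: (weq_catl (run_cw okT)); apply: (@weq_catr _ _ _ [:: _]).
case: k {Es} => /=; [exact: weq_refl | | exact: weq_refl].
(* An [OverNW] crossing is recorded as [OverNE]. *)
apply: (weq_flip_at Xsh Xcc).
by rewrite size_cperm size_ends sz; lia.
Qed.

Lemma diagram_plat w : run [::] w = Some [::] -> exists xs u,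
  cvalid (size xs).*2 u /\ weq [::] w (plat xs u).
Proof.
case/plat_form=> xs [u [l [oku sz e]]]; exists xs, u; split=> //.
rewrite /plat (_ : size xs = l) //.
by move: sz; rewrite addn0 => /double_inj.
Qed.

Lemma run_plat xs u : cvalid (size xs).*2 u ->
  run [::] (plat xs u) = run (cperm u (ends xs)) (caps n (size xs)).
Proof.
move=> oku; rewrite /plat run_cat run_cups cats0 /= run_cat.
by rewrite run_cw ?size_ends.
Qed.

Lemma ceq_plat xs u v : ceq X (size xs).*2 u v ->
  weq [::] (plat xs u) (plat xs v).
Proof.
case=> H _; have rxs := run_cups xs [::]; rewrite cats0 in rxs.
by apply: (weq_ctx _ rxs); apply: H; rewrite size_ends.
Qed.

Definition cup_move xs ys v : Prop := [/\ size xs = size ys,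
  cvalid (size ys).*2 v & weq [::] (cups xs) (cups ys ++ cw n v)].

Lemma cup_move_plat xs ys v u : cup_move xs ys v ->
  weq [::] (plat xs u) (plat ys (v ++ u)).
Proof.
case=> sz okv e; rewrite /plat sz cw_cat -!catA (catA (cups ys)).
exact: weq_catr.
Qed.

Lemma cup_move_trans xs ys zs v w : cup_move xs ys v -> cup_move ys zs w ->
  cup_move xs zs (w ++ v).
Proof.
case=> sz okv e [sz' okw e']; split; first by rewrite sz.
  by rewrite cvalid_cat okw -sz'.
by apply: weq_trans e _; rewrite cw_cat catA; apply: weq_catr.
Qed.

Lemma cup_move_cons x xs ys v : cup_move xs ys v ->
  cup_move (x :: xs) (x :: ys) (csh 2 v).
Proof.
case=> sz okv e; split=> /=; first by rewrite sz.
  by rewrite doubleS (cvalid_csh 2).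
rewrite !cups_cons; apply: weq_trans (weq_catr _ e) _; rewrite -!catA.
have rys := run_cups ys [::]; rewrite cats0 in rys.
apply: (weq_catl rys).
have r1 : run [::] [:: cup x 0] = Some [:: x; opp_strand x] by run_tac.
have okv' : cvalid (size (ends ys)) v by rewrite size_ends.
have := weq_interchange X r1 (run_cw okv'); rewrite cw_csh /= sh0.
by move/weq_sym.
Qed.

Lemma cup_move_flip x xs : cup_move (x :: xs) (opp_strand x :: xs) [:: V0].
Proof.
split=> //; rewrite !cups_cons -catA.
have rys := run_cups xs [::]; rewrite cats0 in rys.
apply: (weq_catl rys); apply: weq_sym.
rewrite -{2}[x]opp_strandK; exact: weq_cup_reid1.
Qed.

(** The chord above a minimum consists of two kinks. Hence the marks at the two ends of a minimum
    may be changed together, and only their sum counts. *)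
Lemma cup_move_chord x xs : cup_move (x :: xs) (x :: xs) [:: S0; V0].
Proof.
split=> //; rewrite !cups_cons -catA.
have rys := run_cups xs [::]; rewrite cats0 in rys.
apply: (weq_catl rys); apply: weq_sym.
wsub 0 2 [:: cup (opp_strand x) 0]; first exact: weq_cup_reid1.
rewrite -{2}[x]opp_strandK; exact: weq_cup_reid1.
Qed.

Lemma cup_move_refl xs : cup_move xs xs [::].
Proof. by split=> //; rewrite cats0; exact: weq_refl. Qed.

Lemma cup_move_front x ys1 ys2 : cup_move (ys1 ++ x :: ys2)
  (x :: ys1 ++ ys2) (carry (size ys1).*2).
Proof.
have sz : size (ys1 ++ x :: ys2) = (size (ys1 ++ ys2)).+1.
  by rewrite !size_cat /= addnS.
split; [by rewrite sz | by rewrite cvalid_carry //= size_cat; lia |].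
rewrite cups_cons -cat1s !cups_cat -!catA.
have rys := run_cups ys2 [::]; rewrite cats0 in rys.
apply: (weq_catl rys).
have r1 : run [::] [:: cup x 0] = Some [:: x; opp_strand x] by run_tac.
have r2 := run_cups ys1 [::]; rewrite cats0 in r2.
have H := weq_interchange X r2 (run_left (ends ys2) r1).
have r3 := run_cups ys1 (ends ys2).
apply: (@weq_trans _ _ _ _ (cups ys1 ++ [:: cup x (size ys1).*2])).
  apply: weq_sym; rewrite size_ends /sh /= addn0 in H; exact: H.
apply: (weq_catl r3); apply: weq_cup_carry.
by rewrite size_cat size_ends leq_addr.
Qed.

Lemma caps_front y ys1 ys2 (ys := ys1 ++ y :: ys2) : weq (ends ys)
  (caps n (size ys)) (cw n (uncarry (size ys1).*2) ++ caps n (size ys)).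
Proof.
have cE : caps n (size ys) = caps n (size ys1) ++ [:: cap 0] ++ caps n (size ys2).
  by rewrite /caps size_cat /= -[_ + _]/(_ + (1 + _)) !nseqD.
have cE' : caps n (size ys) = [:: cap 0] ++ caps n (size ys1) ++ caps n (size ys2).
  by rewrite /caps size_cat /= addnS -nseqD.
rewrite {1}cE cE' !catA; apply: weq_catr; apply: (@weq_trans _ _ _ _
  ([:: cap (size ys1).*2] ++ caps n (size ys1))).
  have r1 := run_caps ys1 [::]; rewrite cats0 in r1.
  have r2 : run (ends (y :: ys2)) [:: cap 0] = Some (ends ys2).
    by rewrite /= /step /= eqxx /=; case: (ends ys2).
  have H := weq_interchange X r1 r2.
  rewrite size_ends /sh /= !addn0 in H; rewrite /ys ends_cat; exact: H.
apply: weq_catr; apply: weq_cap_carry.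
by rewrite /ys ends_cat size_cat size_ends /=; lia.
Qed.

Lemma caps_flip y ys : weq (ends (y :: ys)) (caps n (size ys).+1)
  ([:: Virtual @ 0] ++ caps n (size ys).+1).
Proof.
rewrite -[caps n _.+1]/([:: cap 0] ++ caps n (size ys)) catA; apply: weq_catr.
by reidR reid1.
Qed.

Lemma plat_top xs u v : cvalid (size xs).*2 u ->
  run [::] (plat xs u) = Some [::] ->
  (forall ys, size ys = size xs -> cperm u (ends xs) = ends ys ->
    weq (ends ys) (caps n (size ys)) (cw n v ++ caps n (size ys))) ->
  weq [::] (plat xs u) (plat xs (u ++ v)).
Proof.
move=> oku; rewrite run_plat // => /run_capsP; case=> ys [sz E] H; rewrite cats0 in E.
have rxs := run_cups xs [::]; rewrite cats0 in rxs.
apply: (weq_catl rxs); rewrite cw_cat -catA.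
have okT : cvalid (size (ends xs)) u by rewrite size_ends.
by apply: (weq_catl (run_cw okT)); rewrite E -sz; apply: H.
Qed.

(** The normal form of [u] sends the first strand to place [p] with mark [d]; here this forces
    [p = 0] and [d = false], so that only the part avoiding that strand is left. *)
Lemma fix_first (T : eqType) m u a (s s' : seq (T * bool)) :
  cvalid m.+1 u -> size s = m -> uniq (a :: map fst s) ->
  act u ((a, false) :: s) = (a, false) :: s' ->
  exists u', cvalid m u' /\ act u' s = s'.
Proof.
move=> oku sz /= /andP[a_s un] e.
have [w [d [p [okw le_p gd e1]]]] := cword_normal Xsh Xcc Xtc oku.
have [_ a1] := e1; have szh r : size (tog_head d r) = size r by case: r.
move: e; rewrite a1 /= ?sz // act_normal ?sz // =>
  /(@cat_cons_inj _ a (false (+) d) false _ _ [::])[] //.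
  apply: contra a_s => /mapP[y /mem_take yin ->].
  have: y.1 \in map fst (act w s).
    have -> : map fst (act w s) = map fst (tog_head d (act w s)).
      by case: (act w s).
    exact: map_f.
  by rewrite (perm_mem (perm_act_fst _ _)).
move=> /(congr1 size); rewrite size_takel ?szh ?size_act ?sz //= => p0.
rewrite p0 drop0 => d0 <-.
exists w; rewrite d0; split=> //.
by case: (act w s) => // y t; rewrite /= tog0.
Qed.

Definition untog (T : Type) (s : seq T) : seq (T * bool) :=
  [seq (x, false) | x <- s].

Lemma map_fst_untog (T : Type) (s : seq T) : map fst (untog s) = s.
Proof. by rewrite -map_comp map_id. Qed.

(** The basic cancellation: the leftmost maximum joins the right end of [x] to the left end of [y],
    without marks. By faithfulness [u] may be replaced by [[:: V0; V1]] followed by a word on the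
    remaining strands, after which a minimum and the maximum form a zigzag. The strands of a slice
    may coincide, hence the separate distinct labels. *)
Lemma merge_unlinked (T : eqType) x y zs u (l0 l1 l2 l3 : T) L r
    (xs := [:: x, y & zs]) :
  cvalid (size xs).*2 u -> run [::] (plat xs u) = Some [::] ->
  uniq [:: l0, l1, l2, l3 & L] -> size L = (size zs).*2 ->
  act u (untog [:: l0, l1, l2, l3 & L]) = [:: (l1, false), (l2, false) & r] ->
  exists v, cvalid (size zs).+1.*2 v /\ weq [::] (plat xs u) (plat (y :: zs) v).
Proof.
(* [[:: V1; V0]] undoes [[:: V0; V1]], so that [u1] fixes the two strands joined by the leftmost
   maximum. *)
move=> oku run_u un sz e; pose u1 := [:: V1; V0] ++ u.
have okxs : (size xs).*2 = (size zs).*2.+4 by [].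
have oku1 : cvalid (size zs).*2.+4 u1.
  by rewrite -okxs cvalid_cat oku andbT.
have e1 : act u1 (untog [:: l1, l2, l0, l3 & L]) =
    [:: (l1, false), (l2, false) & r].
  by rewrite -e act_cat /= /tog /=.
have un1 : uniq [:: l1, l2, l0, l3 & L].
  by rewrite -(perm_uniq (_ : perm_eq [:: l0, l1, l2, l3 & L] _)) //
    (perm_catCA [:: l0] [:: l1; l2] (l3 :: L)).
have un1' := un1; rewrite -[X in uniq X]map_fst_untog in un1'.
have [||u2 [oku2 e2]] := fix_first oku1 _ _ e1.
- by rewrite /= size_map sz.
- exact: un1'.
have [||u3 [oku3 e3]] := fix_first oku2 _ _ e2.
- by rewrite /= size_map sz.
- by case/andP: un1'.
exists u3; split; first by rewrite doubleS.
have okv : cvalid (size xs).*2 ([:: V0; V1] ++ csh 2 u3).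
  by rewrite okxs cvalid_cat (cvalid_csh 2) oku3 /cvalid /=.
have H : ceq X (size xs).*2 u ([:: V0; V1] ++ csh 2 u3).
  apply: (cword_faithful Xsh Xcc Xtc oku okv)
    (_ : size (untog [:: l0, l1, l2, l3 & L]) = _) _ _.
  - by rewrite okxs -sz size_map.
  - by rewrite map_fst_untog.
  - rewrite e act_cat /= /tog /=.
    have := act_catr u3 [:: (l1, false); (l2, false)] (untog [:: l0, l3 & L]).
    by rewrite e3 /= => ->.
have e4 := ceq_plat H; apply: (weq_trans e4).
have := weq_run e4; rewrite run_u => /esym.
rewrite run_plat // cperm_cat.
have perm2 (a b : strand n) t :
    cperm (csh 2 u3) [:: a, b & t] = [:: a, b & cperm u3 t].
  by have := cperm_catr u3 [:: a; b] t.
rewrite [cperm [:: V0; V1] _]/= perm2 [caps _ _]/= run_cons {1}/step /=.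
(* The maximum joins [opp_strand x] to [y], which forces [y = x]. *)
case: eqP => //; rewrite opp_strandK => yx _.
have rzs := run_cups zs [::]; rewrite cats0 in rzs.
suff key : weq (ends zs) ([:: cup y 0] ++ [:: cup x 0] ++
    cw n ([:: V0; V1] ++ csh 2 u3) ++ caps n (size zs).+2)
    ([:: cup y 0] ++ cw n u3 ++ caps n (size zs).+1).
  rewrite /plat /xs !cups_cons -!catA; exact: (weq_catl rzs key).
rewrite yx cw_cat cw_csh -[caps n _.+2]/([:: cap 0] ++ caps n (size zs).+1).
apply: (@weq_trans _ _ _ _ ([:: cup x 0; cup x 0; Virtual @ 0; Virtual @ 1;
    cap 0] ++ cw n u3 ++ caps n (size zs).+1)); last first.
  apply: (@weq_catr _ _ _ _ [:: cup x 0]).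
  wsub 3 2 [:: Virtual @ 0; cap 1]; first by isoR iso_cap.
  wsub 2 2 (Nil (layer n)); first exact: (weq_reid2 _ _ _ _ Virtual).
  wsub 1 2 (Nil (layer n)); last exact: weq_refl.
  by iso iso_zigzag_right.
rewrite -!catA.
have r2 : run (ends zs) [:: cup x 0; cup x 0; Virtual @ 0; Virtual @ 1] =
  Some [:: opp_strand x, x, x, opp_strand x & ends zs] by run_tac.
apply: (@weq_catl _ _ _ _ [:: cup x 0; cup x 0; Virtual @ 0; Virtual @ 1]
  (sh 2 (cw n u3) ++ [:: cap 0] ++ caps n (size zs).+1)
  ([:: cap 0] ++ cw n u3 ++ caps n (size zs).+1) r2).
rewrite !catA; apply: weq_catr; apply: weq_sym.
have r3 : run [:: opp_strand x; x] [:: cap 0] = Some [::] by run_tac.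
have r4 : run [:: x, opp_strand x & ends zs] (cw n u3) =
  Some (cperm u3 [:: x, opp_strand x & ends zs]).
  by apply: run_cw; rewrite /= size_ends.
by have := weq_interchange X r3 r4; rewrite sh0.
Qed.

Definition closed_plat (xs : seq (strand n)) u : Prop :=
  cvalid (size xs).*2 u /\ run [::] (plat xs u) = Some [::].

Definition shrinks xs u : Prop := exists zs v, [/\ size zs < size xs,
  cvalid (size zs).*2 v & weq [::] (plat xs u) (plat zs v)].

Lemma cup_move_closed xs ys v u : cup_move xs ys v ->
  closed_plat xs u -> closed_plat ys (v ++ u).
Proof.
move=> mv [oku ru]; split.
  by case: mv => sz okv _; rewrite cvalid_cat okv -sz.
by rewrite -(weq_run (cup_move_plat u mv)).
Qed.

Lemma cup_move_shrinks xs ys v u : cup_move xs ys v ->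
  shrinks ys (v ++ u) -> shrinks xs u.
Proof.
move=> mv [zs [w [sz okw e]]]; exists zs, w; split=> //.
  by case: mv => ->.
by apply: weq_trans e; exact: cup_move_plat.
Qed.

Lemma untog_cat (T : Type) (s t : seq T) : untog (s ++ t) = untog s ++ untog t.
Proof. exact: map_cat. Qed.

(** The marks [ea] and [eb] are cancelled in advance, by chords above the minima [x] and [y]. *)
Lemma merge_tops (T : eqType) x y zs u (l0 l1 l2 l3 : T) L ea eb r
    (xs := [:: x, y & zs]) : closed_plat xs u ->
  uniq [:: l0, l1, l2, l3 & L] -> size L = (size zs).*2 ->
  act u (untog [:: l0, l1, l2, l3 & L]) = [:: (l1, ea), (l2, eb) & r] ->
  shrinks xs u.
Proof.
move=> clu un sz e; pose v := chord ea ++ csh 2 (chord eb).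
have mvv : cup_move xs xs v.
  apply: cup_move_trans.
    case: (eb); last exact: cup_move_refl.
    exact: (cup_move_cons x (cup_move_chord y zs)).
  by case: (ea); [exact: cup_move_chord | exact: cup_move_refl].
apply: (cup_move_shrinks mvv); have [okvu rvu] := cup_move_closed mvv clu.
(* The marks that [v] puts on the ends of the two minima; they pass through [u] unchanged because
   the marks are additive. *)
pose f l := if l \in [:: l0; l1] then ea else
  if l \in [:: l2; l3] then eb else false.
pose g (p : T * bool) := (p.1, p.2 (+) f p.1).
have e1 : act v (untog [:: l0, l1, l2, l3 & L]) =
    map g (untog [:: l0, l1, l2, l3 & L]).
  have -> : map g (untog [:: l0, l1, l2, l3 & L]) =
      [:: (l0, ea), (l1, ea), (l2, eb), (l3, eb) & untog L].
    rewrite /untog /= /g /f /= !inE !eqxx !orbT /=; move: un => /=.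
    rewrite !inE !negb_or -!andbA.
    case/and5P=> n01 n02 n03 n0L /and5P[n12 n13 n1L n23 /and3P[n2L n3L _]].
    rewrite ![l2 == _]eq_sym ![l3 == _]eq_sym (negPf n02) (negPf n03).
    rewrite (negPf n12) (negPf n13) /=; do 4!congr (_ :: _).
    rewrite -map_comp; apply/eq_in_map=> l lL /=; rewrite !inE.
    have ne k : k \notin L -> (l == k) = false.
      by apply: contraNF => /eqP <-.
    by rewrite !ne.
  by rewrite /v; case: (ea); case: (eb); rewrite /act /= /tog /=.
have e2 : act (v ++ u) (untog [:: l0, l1, l2, l3 & L]) =
    [:: (l1, false), (l2, false) & map g r].
  rewrite act_cat e1 -map_act; last first.
    by move=> b p; rewrite /g /tog /= addbAC.
  rewrite e /= /g /f /= !inE eqxx orbT; move: un => /=.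
  rewrite !inE !negb_or -!andbA => /and5P[_ n02 _ _ /andP[n12 _]].
  by rewrite ![l2 == _]eq_sym (negPf n02) (negPf n12) eqxx /= !addbb.
have [w [okw ew]] := merge_unlinked okvu rvu un sz e2.
by exists (y :: zs), w.
Qed.

(** From here to [merge_caps] the assumptions of [merge_tops] are removed one at a time: the
    direction of the second minimum, its place, the direction of the first one, the order of the two
    strands at the maximum, and the place of the maximum. *)
Lemma merge_second (T : eqType) x y zs u (l0 l1 l2 l3 : T) L b ea eb r
    (xs := [:: x, y & zs]) : closed_plat xs u ->
  uniq [:: l0, l1, l2, l3 & L] -> size L = (size zs).*2 -> b \in [:: l2; l3] ->
  act u (untog [:: l0, l1, l2, l3 & L]) = [:: (l1, ea), (b, eb) & r] ->
  shrinks xs u.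
Proof.
move=> clu un sz; rewrite !inE => /orP[] /eqP -> e.
  exact: merge_tops clu un sz e.
have mvv := cup_move_cons x (cup_move_flip y zs).
apply: (cup_move_shrinks mvv).
apply: (@merge_tops _ _ _ _ _ l0 l1 l3 l2 L ea eb r) => //.
- exact: cup_move_closed mvv clu.
- have P : perm_eq [:: l0, l1, l2, l3 & L] [:: l0, l1, l3, l2 & L].
    by rewrite !perm_cons (perm_catCA [:: l2] [:: l3] L).
  by rewrite -(perm_uniq P).
Qed.

Lemma size_split (T : eqType) (b : T) L k : size L = k.*2 -> b \in L ->
  exists j M1 c d M2, [/\ L = M1 ++ [:: c, d & M2], size M1 = j.*2, j < k &
    b \in [:: c; d]].
Proof.
elim: k L => [|k IH] [|c [|d L]] //= [sz].
rewrite !inE orbA => /orP[cd|/(IH _ sz)[j [M1 [c' [d' [M2 [-> sz1 lt_j bin]]]]]]].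
  by exists 0, [::], c, d, L; split=> //; rewrite !inE.
by exists j.+1, [:: c, d & M1], c', d', M2; rewrite doubleS -sz1.
Qed.

Lemma merge_one (T : eqType) x ys u (l0 l1 : T) L b ea eb r
    (xs := x :: ys) : closed_plat xs u ->
  uniq [:: l0, l1 & L] -> size L = (size ys).*2 -> b \in L ->
  act u (untog [:: l0, l1 & L]) = [:: (l1, ea), (b, eb) & r] -> shrinks xs u.
Proof.
move=> clu un sz bL e.
have [j [M1 [c [d [M2 [LE sz1 lt_j bcd]]]]]] := size_split sz bL.
have [y [ys1 [ys2 [ysE szy]]]] : exists y ys1 ys2,
    ys = ys1 ++ y :: ys2 /\ size ys1 = j.
  exists (nth x ys j), (take j ys), (drop j.+1 ys).
  by rewrite -drop_nth // cat_take_drop size_takel // ltnW.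
have mvv := cup_move_cons x (cup_move_front y ys1 ys2).
rewrite /xs ysE in clu *; apply: (cup_move_shrinks mvv).
have pE : perm_eq L [:: c, d & M1 ++ M2].
  by rewrite LE (perm_catCA M1 [:: c; d] M2).
apply: (@merge_second _ _ _ _ _ l0 l1 c d (M1 ++ M2) b ea eb r) => //.
- exact: cup_move_closed mvv clu.
- have P : perm_eq [:: l0, l1 & L] [:: l0, l1, c, d & M1 ++ M2].
    by rewrite !perm_cons.
  by rewrite -(perm_uniq P).
- move: sz; rewrite LE ysE !size_cat /= !addnS !doubleS => -[->].
  by rewrite doubleD szy.
- rewrite -e act_cat; congr (act _ _); rewrite LE.
  rewrite (act_catr _ [:: (l0, false); (l1, false)] (untog [:: c, d & M1 ++ M2])).
  rewrite /= -/(untog _) !untog_cat; congr [:: _, _ & _].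
  by rewrite szy -sz1 -(size_map (fun l => (l, false))) act_carry.
Qed.

Lemma merge_front (T : eqType) x ys u (l0 l1 : T) L a b ea eb r
    (xs := x :: ys) : closed_plat xs u ->
  uniq [:: l0, l1 & L] -> size L = (size ys).*2 ->
  a \in [:: l0; l1] -> b \in L ->
  act u (untog [:: l0, l1 & L]) = [:: (a, ea), (b, eb) & r] -> shrinks xs u.
Proof.
move=> clu un sz; rewrite !inE => /orP[] /eqP -> bL e; last first.
  exact: merge_one clu un sz bL e.
have mvv := cup_move_flip x ys; apply: (cup_move_shrinks mvv).
apply: (@merge_one _ _ _ _ l1 l0 L b ea eb r) => //.
- exact: cup_move_closed mvv clu.
- have P : perm_eq [:: l0, l1 & L] [:: l1, l0 & L].
    by rewrite (perm_catCA [:: l0] [:: l1] L).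
  by rewrite -(perm_uniq P).
Qed.

Lemma plat_top_shrinks xs u v : closed_plat xs u -> cvalid (size xs).*2 v ->
  (forall ys, size ys = size xs -> cperm u (ends xs) = ends ys ->
    weq (ends ys) (caps n (size ys)) (cw n v ++ caps n (size ys))) ->
  closed_plat xs (u ++ v) /\ (shrinks xs (u ++ v) -> shrinks xs u).
Proof.
case=> oku ru okv H; have e := plat_top oku ru H; split.
  by split; [rewrite cvalid_cat oku | rewrite -(weq_run e)].
by case=> zs [w [sz okw e']]; exists zs, w; split=> //; exact: weq_trans e e'.
Qed.

Lemma merge_pair (T : eqType) x ys u (l0 l1 : T) L a b ea eb r
    (xs := x :: ys) : closed_plat xs u ->
  uniq [:: l0, l1 & L] -> size L = (size ys).*2 ->
  (a \in [:: l0; l1]) != (b \in [:: l0; l1]) ->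
  act u (untog [:: l0, l1 & L]) = [:: (a, ea), (b, eb) & r] -> shrinks xs u.
Proof.
move=> clu un sz ab e.
have pE := perm_act_fst u (untog [:: l0, l1 & L]).
rewrite e map_fst_untog /= in pE.
have inL c : c \in [:: a; b] -> c \notin [:: l0; l1] -> c \in L.
  move=> cin; have: c \in [:: l0, l1 & L].
    rewrite -(perm_mem pE) inE; move: cin; rewrite !inE.
    by case/orP=> ->; rewrite ?orbT.
  by rewrite -[[:: _, _ & _]]/([:: l0; l1] ++ L) mem_cat => /orP[->|].
have [a01|a01] := boolP (a \in [:: l0; l1]); rewrite ?a01 ?(negPf a01) in ab.
  apply: merge_front clu un sz a01 _ e; apply: inL.
    by rewrite !inE eqxx orbT.
  by move: ab; case: (b \in _).
have b01 : b \in [:: l0; l1] by move: ab; case: (b \in _).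
have [||clv imp] := @plat_top_shrinks xs u [:: V0] clu.
- by rewrite /cvalid /=.
- case=> [|y zs] // [szz] _; exact: caps_flip.
apply: imp; apply: (merge_front clv un sz b01 (inL a _ a01)).
  by rewrite inE eqxx.
by rewrite act_cat e /= !tog0.
Qed.

Lemma merge_caps (T : eqType) x ys u (l0 l1 : T) L t1 t2 a b ea eb c
    (xs := x :: ys) : closed_plat xs u ->
  uniq [:: l0, l1 & L] -> size L = (size ys).*2 -> size t1 = c.*2 ->
  (a \in [:: l0; l1]) != (b \in [:: l0; l1]) ->
  act u (untog [:: l0, l1 & L]) = t1 ++ [:: (a, ea), (b, eb) & t2] ->
  shrinks xs u.
Proof.
move=> clu un sz szt ab e.
have lt_c : c < size xs.
  have := congr1 size e; rewrite size_act size_map /= size_cat sz szt /=; lia.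
have [||clv imp] := @plat_top_shrinks xs u (uncarry c.*2) clu.
- by apply: cvalid_uncarry; lia.
- move=> zs szz _; rewrite -szz in lt_c.
  have := @caps_front (nth x zs c) (take c zs) (drop c.+1 zs).
  by rewrite -drop_nth // cat_take_drop size_takel // ltnW.
apply: imp; apply: (merge_pair clv un sz ab (ea := ea) (eb := eb) (r := t1 ++ t2)).
by rewrite act_cat e -szt act_uncarry.
Qed.

End Plats.

Fixpoint paired (T : Type) (P : rel T) (s : seq T) : bool :=
  match s with
  | [::] => true
  | [:: a, b & s'] => P a b && paired P s'
  | _ => false
  end.

Lemma pairedPn (T : Type) (P : rel T) k s : size s = k.*2 -> ~~ paired P s ->
  exists c t1 a b t2, [/\ s = t1 ++ [:: a, b & t2], size t1 = c.*2 & ~~ P a b].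
Proof.
elim: k s => [|k IH] [|a [|b s]] //= [sz]; case Pab: (P a b) => /=; last first.
  by exists 0, [::], a, b, s; rewrite Pab.
move=> /(IH _ sz)[c [t1 [a' [b' [t2 [-> sz1 nP]]]]]].
by exists c.+1, [:: a, b & t1], a', b', t2; rewrite doubleS -sz1.
Qed.

Lemma cperm_act T u (s : seq T) : cperm u s = map fst (act u (untog s)).
Proof. by rewrite act_cperm map_fst_untog. Qed.

(** * Plats with one minimum for each component *)

Section StandardPlats.
Variables (n : nat) (X : rule n).
Hypotheses (Xsh : shift_closed X) (Xcc : crossing_changing X)
  (Xtc : triangle_changing X).

Local Notation weq := (weq X).
Local Notation "k @ p" := (@Cross n k, p) (at level 30).
Local Notation cup x p := (@Cup n x, p).
Local Notation cap p := (@Cap n, p).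

(** The ends of the minima are labelled 0, 1, 2, ..., and those below 2 belong to the first minimum.
    In the paired case one maximum joins these two ends, so that the first minimum makes up a whole
    circle. *)
Lemma merge_or_paired x ys u (xs := x :: ys) : closed_plat xs u ->
  shrinks X xs u \/
  paired (fun p q => (p.1 < 2) == (q.1 < 2))
    (act u (untog (iota 0 (size xs).*2))).
Proof.
move=> clu; set t := act _ _; set P := fun _ _ => _.
have szt : size t = (size xs).*2 by rewrite size_act size_map size_iota.
have [|nP] := boolP (paired P t); first by right.
left; have [c [t1 [[a ea] [[b eb] [t2 [e sz1 Pab]]]]]] := pairedPn szt nP.
have iE : iota 0 (size xs).*2 = [:: 0, 1 & iota 2 (size ys).*2] by [].
apply: (merge_caps Xsh Xcc Xtc clu (l0 := 0) (l1 := 1) (a := a) (b := b)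
  (L := iota 2 (size ys).*2) _ _ sz1) => //.
- by rewrite -iE iota_uniq.
- by rewrite size_iota.
- by move: Pab; rewrite /P !inE /=; case: (a) (b) => [|[|?]] [|[|?]].
- by rewrite -iE -/t e.
Qed.

Lemma cup_move_perm xs ys : perm_eq xs ys -> exists v, cup_move X xs ys v.
Proof.
elim: ys xs => [|y ys IH] xs pxy.
  by rewrite (perm_nilP pxy); exists [::]; exact: cup_move_refl.
have yin : y \in xs by rewrite (perm_mem pxy) inE eqxx.
case/splitPr: yin pxy => a b; rewrite (perm_catCA a [:: y] b) perm_cons.
case/IH=> v mv; exists (csh 2 v ++ carry (size a).*2).
exact: cup_move_trans (cup_move_front Xsh y a b) (cup_move_cons y mv).
Qed.

Definition upward (x : strand n) : strand n := (x.1, true).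

Lemma cup_move_upward xs : exists v, cup_move X xs (map upward xs) v.
Proof.
elim: xs => [|x xs [v mv]]; first by exists [::]; exact: cup_move_refl.
have := cup_move_cons x mv; rewrite /= => mv'.
case ex: x.2.
  by exists (csh 2 v); move: mv' ex; case: (x) => i [].
exists ([:: V0] ++ csh 2 v); apply: cup_move_trans mv' _.
rewrite (_ : upward x = opp_strand x); last first.
  by rewrite /opp_strand /upward ex.
exact: cup_move_flip.
Qed.

(** Counterpart of [cup_move] for maxima. A [Cap] carries no label, so the strands that reach the
    maxima after [v] are recorded by the clause on [cperm]. *)
Definition cap_move ys zs v : Prop := [/\ size ys = size zs,
  cvalid (size ys).*2 v, cperm v (ends ys) = ends zs &
  weq (ends ys) (caps n (size ys)) (cw n v ++ caps n (size ys))].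

Lemma cap_move_refl ys : cap_move ys ys [::].
Proof. by split=> //; exact: weq_refl. Qed.

Lemma cap_move_trans xs ys zs v w : cap_move xs ys v -> cap_move ys zs w ->
  cap_move xs zs (v ++ w).
Proof.
case=> sz okv pv e [sz' okw pw e']; split; first by rewrite sz.
- by rewrite cvalid_cat okv sz.
- by rewrite cperm_cat pv.
apply: weq_trans e _; rewrite cw_cat -catA.
have okv' : cvalid (size (ends xs)) v by rewrite size_ends.
by apply: (weq_catl (run_cw okv')); rewrite pv sz.
Qed.

Lemma cap_move_cons y ys zs v : cap_move ys zs v ->
  cap_move (y :: ys) (y :: zs) (csh 2 v).
Proof.
case=> sz okv pv e; split; first by rewrite /= sz.
- by rewrite /= doubleS (cvalid_csh 2).
- by have := cperm_catr v [:: y; opp_strand y] (ends ys); rewrite pv.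
rewrite -[caps n _]/([:: cap 0] ++ caps n (size ys)).
have r1 : run [:: y; opp_strand y] [:: cap 0] = Some [::] by run_tac.
apply: weq_trans (weq_catl (run_left (ends ys) r1) e) _.
rewrite !catA; apply: weq_catr.
have okv' : cvalid (size (ends ys)) v by rewrite size_ends.
by have := weq_interchange X r1 (run_cw okv'); rewrite cw_csh /= sh0.
Qed.

Lemma cap_move_flip y ys : cap_move (y :: ys) (opp_strand y :: ys) [:: V0].
Proof.
split=> //=; first by rewrite opp_strandK.
exact: caps_flip.
Qed.

Lemma cap_move_front y ys1 ys2 : cap_move (ys1 ++ y :: ys2)
  (y :: ys1 ++ ys2) (uncarry (size ys1).*2).
Proof.
split; last exact: caps_front.
- by rewrite /= !size_cat /= addnS.
- by apply: cvalid_uncarry; rewrite size_cat /=; lia.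
rewrite cperm_act !ends_cat.
rewrite untog_cat -size_ends -(size_map (fun l => (l, false))).
rewrite act_uncarry -untog_cat -ends_cat.
exact: (map_fst_untog (ends (y :: ys1 ++ ys2))).
Qed.

Lemma cap_move_perm ys zs : perm_eq ys zs -> exists v, cap_move ys zs v.
Proof.
elim: zs ys => [|y zs IH] ys pxy.
  by rewrite (perm_nilP pxy); exists [::]; exact: cap_move_refl.
have yin : y \in ys by rewrite (perm_mem pxy) inE eqxx.
case/splitPr: yin pxy => a b; rewrite (perm_catCA a [:: y] b) perm_cons.
case/IH=> v mv; exists (uncarry (size a).*2 ++ csh 2 v).
exact: cap_move_trans (cap_move_front y a b) (cap_move_cons y mv).
Qed.

Lemma cap_move_upward ys : exists v, cap_move ys (map upward ys) v.
Proof.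
elim: ys => [|x xs [v mv]]; first by exists [::]; exact: cap_move_refl.
have := cap_move_cons x mv; rewrite /= => mv'.
case ex: x.2.
  by exists (csh 2 v); move: mv' ex; case: (x) => i [].
exists (csh 2 v ++ [:: V0]); apply: cap_move_trans mv' _.
rewrite (_ : upward x = opp_strand x); last first.
  by rewrite /opp_strand /upward ex.
exact: cap_move_flip.
Qed.

Definition std : seq (strand n) := [seq (i, true) | i <- enum 'I_n].

(** The permutation of the strands is trivial here, so that two such plats differ only in their
    marks. *)
Definition std_plat u : Prop :=
  cvalid (size std).*2 u /\ cperm u (ends std) = ends std.

(** With one minimum for each component the strands are distinct and can themselves serve as labels
    in [cword_faithful]. *)
Lemma uniq_ends (xs : seq (strand n)) : uniq (map fst xs) -> uniq (ends xs).
Proof.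
elim: xs => //= x xs IH /andP[nx /IH ->]; rewrite andbT.
have nin z : z.1 = x.1 -> z \notin ends xs.
  move=> zx; apply: contra nx; rewrite -zx => {zx x}.
  elim: xs {IH} => //= y xs IH; rewrite !inE.
  by case/or3P=> [/eqP->|/eqP->|/IH->]; rewrite ?eqxx ?orbT.
rewrite inE negb_or !nin // !andbT; case: x {nx nin} => i b.
by rewrite /opp_strand /= xpair_eqE negb_and; case: b; rewrite ?orbT.
Qed.

Lemma count_ends (ys : seq (strand n)) i :
  count_mem (i, true) (ends ys) = count_mem i (map fst ys).
Proof.
elim: ys => //= -[j b] ys ->; rewrite addnA /opp_strand /= !xpair_eqE.
by congr (_ + _); case: (j == i); case: b.
Qed.

Lemma std_fst : map fst std = enum 'I_n.
Proof. by rewrite -map_comp map_id. Qed.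

Lemma perm_ends_std (ys : seq (strand n)) : perm_eq (ends ys) (ends std) ->
  perm_eq (map upward ys) std.
Proof.
move=> p; have p1 : perm_eq (map fst ys) (enum 'I_n).
  rewrite -std_fst /perm_eq; apply/allP=> i _; apply/eqP.
  by rewrite -!count_ends; exact/permP.
rewrite /std -(_ : map (fun i => (i, true)) (map fst ys) = map upward ys).
  exact: perm_map.
by rewrite -map_comp.
Qed.

Lemma ends_inj : injective (@ends n).
Proof.
elim=> [|x xs IH] [|y ys] //= E; congr (_ :: _).
  exact: (congr1 (head x) E).
by apply: IH; exact: (congr1 (behead \o behead) E).
Qed.

Lemma weq_std_plat xs u : closed_plat xs u -> perm_eq (map fst xs) (enum 'I_n) ->
  exists2 v, std_plat v & weq [::] (plat xs u) (plat std v).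
Proof.
move=> clu p.
have [v1 mv1] := cup_move_upward xs.
have pxs : perm_eq (map upward xs) std.
  rewrite (_ : map upward xs = [seq (i, true) | i <- map fst xs]).
    exact: perm_map.
  by rewrite -map_comp.
have [v2 mv2] := cup_move_perm pxs.
have mv := cup_move_trans mv1 mv2.
have clv := cup_move_closed mv clu; set w := (v2 ++ v1) ++ u in clv.
have [okw rw] := clv; have := rw; rewrite run_plat //.
case/run_capsP=> ys [szy yE]; rewrite cats0 in yE.
have pys : perm_eq (ends ys) (ends std).
  rewrite -yE cperm_act -[X in perm_eq _ X]map_fst_untog.
  exact: perm_act_fst.
have [v3 mv3] := cap_move_upward ys.
have [v4 mv4] := cap_move_perm (perm_ends_std pys).
have [szv okv pv ev] := cap_move_trans mv3 mv4.
exists (w ++ (v3 ++ v4)).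
  split; first by rewrite cvalid_cat okw -szy.
  by rewrite cperm_cat yE.
apply: weq_trans (cup_move_plat u mv) _; apply: plat_top => // zs szz.
by rewrite yE => /ends_inj <-.
Qed.

Lemma cup_move_chords (f : 'I_n -> bool) xs : exists2 v, cup_move X xs xs v &
  act v (untog (ends xs)) = [seq (x, f x.1) | x <- ends xs].
Proof.
elim: xs => [|x xs [v mv ev]]; first by exists [::]; [exact: cup_move_refl |].
exists (chord (f x.1) ++ csh 2 v).
  apply: cup_move_trans (cup_move_cons x mv) _.
  by case: (f _); [exact: cup_move_chord | exact: cup_move_refl].
rewrite act_cat.
have -> : act (chord (f x.1)) (untog (ends (x :: xs))) =
    [:: (x, f x.1); (opp_strand x, f x.1)] ++ untog (ends xs).
  by case: (f _); rewrite /act /= /tog /=.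
by rewrite (act_catr v [:: _; _]) ev.
Qed.

Lemma graph_fun (T : eqType) (s : seq (T * bool)) : uniq (map fst s) ->
  exists c, s = [seq (x, c x) | x <- map fst s].
Proof.
elim: s => [|[x d] s IH] /=; first by exists (fun _ => false).
case/andP=> nx /IH[c sE]; exists (fun y => if y == x then d else c y).
rewrite eqxx {1}sE; congr (_ :: _); apply/eq_in_map=> y yin.
by case: eqP => // yx; rewrite -yx yin in nx.
Qed.

Lemma weq_std_plats u1 u2 c1 c2 : std_plat u1 -> std_plat u2 ->
  act u1 (untog (ends std)) = [seq (x, c1 x) | x <- ends std] ->
  act u2 (untog (ends std)) = [seq (x, c2 x) | x <- ends std] ->
  (forall i, c1 (i, true) (+) c1 (i, false) = c2 (i, true) (+) c2 (i, false)) ->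
  weq [::] (plat std u1) (plat std u2).
Proof.
move=> [ok1 p1] [ok2 p2] e1 e2 par.
(* By [par] the marks [c1] and [c2] differ by the same amount at both ends of the minimum [i];
   chords above the minima supply this difference. *)
pose f i := c1 (i, true) (+) c2 (i, true).
have [v mv ev] := cup_move_chords f std.
apply: weq_sym; apply: weq_trans (cup_move_plat u2 mv) _.
apply: ceq_plat.
have un : uniq (map fst (untog (ends std))).
  by rewrite map_fst_untog uniq_ends // std_fst enum_uniq.
have okv : cvalid (size std).*2 (v ++ u2).
  by rewrite cvalid_cat ok2; case: mv => _ ->.
apply: (cword_faithful Xsh Xcc Xtc okv ok1
  (_ : size (untog (ends std)) = _) un).
  by rewrite size_map size_ends.
pose g (p : strand n * bool) := (p.1, p.2 (+) f p.1.1).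
rewrite act_cat ev (_ : map _ _ = map g (untog (ends std))); last first.
  by rewrite -map_comp.
rewrite -map_act; last by move=> b p; rewrite /g /tog /= addbAC.
rewrite e2 e1 -map_comp; apply: eq_map => -[i b] /=; congr (_, _).
rewrite /g /f /=; move: (par i); case: b; last first.
  by case: (c1 _) (c1 _) (c2 _) (c2 _) => [] [] [] [].
by case: (c1 _) (c2 _) => [] [].
Qed.

End StandardPlats.

(** * Invariance of connectedness *)

Section Relabelling.
Variables (m n : nat) (f : 'I_m -> 'I_n).

Definition relabel_strand (x : strand m) : strand n := (f x.1, x.2).
Definition relabel_event (g : event m) : event n :=
  match g with Cup x => Cup (relabel_strand x) | Cap => Cap | Cross k => Cross k end.
Definition relabel_layer (l : layer m) : layer n := (relabel_event l.1, l.2).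
Definition relabel (w : word m) : word n := map relabel_layer w.

Lemma arity_in_relabel g : arity_in (relabel_event g) = arity_in g.
Proof. by case: g. Qed.
Lemma arity_out_relabel g : arity_out (relabel_event g) = arity_out g.
Proof. by case: g. Qed.

Lemma relabel_opp x : relabel_strand (opp_strand x) = opp_strand (relabel_strand x).
Proof. by []. Qed.

Lemma step_relabel s l s' : step s l = Some s' ->
  step (map relabel_strand s) (relabel_layer l) = Some (map relabel_strand s').
Proof.
case: l => g p; rewrite /step /= -map_drop -map_take size_map.
case: g => [x||k] /=.
- by case: ifP => // _ [<-]; rewrite map_cat.
- case: (drop p s) => [|x [|y t]] //=; case: eqP => // -> [<-].
  by rewrite relabel_opp eqxx map_cat.
- by case: (drop p s) => [|x [|y t]] //= [<-]; rewrite map_cat.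
Qed.

Lemma run_relabel s w s' : run s w = Some s' ->
  run (map relabel_strand s) (relabel w) = Some (map relabel_strand s').
Proof.
elim: w s => /= [|l w IH] s; first by case=> ->.
by case E: (step s l) => [t|] //= /IH <-; rewrite (step_relabel E).
Qed.

Lemma relabel_cat u v : relabel (u ++ v) = relabel u ++ relabel v.
Proof. exact: map_cat. Qed.

Lemma relabel_sh k w : relabel (sh k w) = sh k (relabel w).
Proof. by rewrite /relabel /sh -!map_comp. Qed.

End Relabelling.

(** Labels enter a word at minima only, so above the empty slice these are all the labels that
    occur. *)
Definition cup_labels n (w : word n) : seq 'I_n :=
  pmap (fun l : layer n => if l.1 is Cup x then Some x.1 else None) w.

Lemma cup_labels_cat n (u v : word n) :
  cup_labels (u ++ v) = cup_labels u ++ cup_labels v.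
Proof. exact: pmap_cat. Qed.

Lemma cup_labels_sh n k (w : word n) : cup_labels (sh k w) = cup_labels w.
Proof. by elim: w => //= -[[x||c] p] w /= ->. Qed.

Lemma step_labels n (s s' : slice n) l : step s l = Some s' ->
  {subset map fst s' <= map fst s ++ cup_labels [:: l]}.
Proof.
case: l => g p /stepP[a [t [t' [b [[-> -> _ em _] e]]]]] i.
rewrite !map_cat !mem_cat; case/or3P=> [->|+|->]; rewrite ?orbT //.
case: g em e => [x||k]; rewrite /step /=.
- case: t => //= _ [<-]; rewrite !inE /= => /orP[]/eqP->.
    by rewrite eqxx !orbT.
  by rewrite /opp_strand /= eqxx !orbT.
- by case: t => [|x [|y []]] //= _; case: ifP => // _ [<-].
case: t => [|x [|y []]] //= _ [<-]; rewrite !inE /=.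
by case/orP=> ->; rewrite ?orbT.
Qed.

Lemma run_labels n (s t : slice n) w : run s w = Some t ->
  {subset map fst t <= map fst s ++ cup_labels w}.
Proof.
elim: w s => [|l w IH] s; first by case=> ->; rewrite cats0.
rewrite run_cons; case E: (step s l) => [s'|//] /IH H i /H.
rewrite -[l :: w]cat1s mem_cat cup_labels_cat catA => /orP[/(step_labels E)|].
  by rewrite (mem_cat i (_ ++ _)) => ->.
by rewrite (mem_cat i (_ ++ _)) => ->; rewrite orbT.
Qed.

Lemma cup_labels_swap n (a b : layer n) :
  cup_labels [:: a; b] =i cup_labels [:: b; a].
Proof. by case: a b => [[x||c] p] [[y||d] q] i; rewrite /= ?inE // orbC. Qed.

Lemma run_exchange n (s t : slice n) g h p r :
  run s [:: (g, p); (h, p + arity_out g + r)] = Some t <->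
  run s [:: (h, p + arity_in g + r); (g, p)] = Some t.
Proof.
split; rewrite !run_cons.
- case E: (step s (g, p)) => [s'|] //=.
  have [a [c [c' [b [[-> -> <- ec ec'] e]]]]] := stepP E.
  rewrite -ec -ec' -!size_cat !catA (step_sh (a ++ c') b (h, r)).
  rewrite (step_sh (a ++ c) b (h, r)).
  case: (step b (h, r)) => [b'|] //= [<-].
  rewrite -catA -[size a]addn0 (step_sh a (c ++ b') (g, 0)).
  by rewrite (step_left b' e) /= catA.
- case E: (step s (h, _)) => [s'|] //=.
  have [a [c [c' [b [[-> -> sa ec ec'] e]]]]] := stepP E.
  case E': (step _ (g, p)) => [t'|] //= [<-] {t}.
  have [a2 [c2 [c2' [b2 [[e2 -> sa2 ec2 ec2'] e3]]]]] := stepP E'.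
  (* As [h] acts at least [p + arity_in g] strands in, the block touched by [g] lies inside [a]. *)
  have [a3 ea] : exists a3, a = a2 ++ c2 ++ a3.
    have le : size (a2 ++ c2) <= size a by rewrite size_cat sa2 ec2 sa leq_addr.
    exists (drop (size (a2 ++ c2)) a).
    have := congr1 (take (size (a2 ++ c2))) e2.
    rewrite (catA a2) (@take_size_cat _ _ (a2 ++ c2)) // takel_cat // => e4.
    by rewrite catA -{1}e4 cat_take_drop.
  have sa3 : size a3 = r by move: sa; rewrite ea !size_cat sa2 ec2; lia.
  have eb : b2 = a3 ++ c' ++ b.
    by move: e2; rewrite ea -!catA => /eqP; rewrite !eqseq_cat // !eqxx => /eqP <-.
  rewrite ea -!catA -sa2 -[size a2]addn0 (step_sh a2 _ (g, 0)).
  rewrite (step_left (a3 ++ c ++ b) e3) /=.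
  rewrite addn0 -ec2' -size_cat catA (step_sh (a2 ++ c2') _ (h, r)) -sa3.
  rewrite -[size a3]addn0 (step_sh a3 _ (h, 0)) (step_left b e) /=.
  by rewrite eb -!catA.
Qed.

(** * Lifting of rules along relabellings *)

Section Lifting.
Variables (m n : nat) (f : 'I_m -> 'I_n).
Local Notation rs := (relabel_strand f).

(* [u] can be replaced by [v] above [s] in any word that [f] relabels to the given
   one. *)
Definition lifts (s : slice n) (u v : word n) : Prop :=
  forall s1 u1 t1, map rs s1 = s -> relabel f u1 = u -> run s1 u1 = Some t1 ->
  run s v -> exists v1, [/\ relabel f v1 = v, run s1 v1 = Some t1,
    {subset cup_labels u1 <= map fst s1 ++ cup_labels v1} &
    {subset cup_labels v1 <= map fst s1 ++ cup_labels u1}].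

Lemma relabel_shP k u u1 : relabel f u1 = sh k u ->
  exists2 u0, u1 = sh k u0 & relabel f u0 = u.
Proof.
elim: u u1 => [|[g p] u IH] [|[g1 p1] u1] //=; first by exists [::].
case=> eg ep /IH[u0 -> eu]; exists ((g1, p) :: u0); rewrite /= ?ep //.
by rewrite /relabel_layer /= eg -eu.
Qed.

Lemma lifts_sh (s0 s : slice n) u v : lifts s u v ->
  lifts (s0 ++ s) (sh (size s0) u) (sh (size s0) v).
Proof.
move=> H s1 u1 t1 es1 /relabel_shP[u0 -> eu].
have [a [b [e1 sza eb]]] : exists a b,
    [/\ s1 = a ++ b, size a = size s0 & map rs b = s].
  exists (take (size s0) s1), (drop (size s0) s1).
  rewrite cat_take_drop size_takel ?map_drop ?es1 ?drop_size_cat //.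
  by rewrite -(size_map rs) es1 size_cat leq_addr.
rewrite e1 -{1}sza !run_sh; case E: (run b u0) => [t|] //= [t1E].
case Ev: (run s v) => [s'|] //= _.
have [|v0 [ev rv sub1 sub2]] := H _ _ _ eb eu E; first by rewrite Ev.
have sub i (r : word m) : i \in map fst b ++ cup_labels r ->
    i \in map fst (a ++ b) ++ cup_labels (sh (size s0) r).
  rewrite cup_labels_sh map_cat !mem_cat => /orP[->|->]; by rewrite !orbT.
exists (sh (size s0) v0); split.
- by rewrite relabel_sh ev.
- by rewrite -sza run_sh rv /= t1E.
- by move=> i; rewrite cup_labels_sh => /sub1 /sub.
- by move=> i; rewrite cup_labels_sh => /sub2 /sub.
Qed.

Lemma run_sh_oversize k (s : slice k) p l w : size s < p ->
  run s (sh p (l :: w)) = None.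
Proof.
move=> lt_s; rewrite /sh /= -/(sh p w); case: l => g q /=.
case E: (step s _) => [s'|] //=.
have [a [t [t' [b [[sE _ sz _ _] _]]]]] := stepP E.
by move: lt_s; rewrite sE !size_cat sz; lia.
Qed.

(** Beyond the end of the slice a nonempty shifted word does not run, so there is nothing to lift;
    this is where one of the words has to be nonempty. *)
Lemma lifts_at p (s : slice n) u v : (u != [::]) || (v != [::]) ->
  lifts (drop p s) u v -> lifts s (sh p u) (sh p v).
Proof.
move=> ne H; have [le_p|lt_p] := leqP p (size s).
  by have := @lifts_sh (take p s) _ _ _ H; rewrite cat_take_drop size_takel.
move=> s1 u1 t1 es1 /relabel_shP[u0 -> eu].
case: v ne H => [|l v] ne H; last by rewrite run_sh_oversize.
case: u0 eu => [|l u0] eu; first by rewrite -eu in ne.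
by rewrite run_sh_oversize // -(size_map rs) es1.
Qed.

Definition bilifts s u v : Prop := lifts s u v /\ lifts s v u.

Lemma bilifts_at p (s : slice n) u v : (u != [::]) || (v != [::]) ->
  bilifts (drop p s) u v -> bilifts s (sh p u) (sh p v).
Proof.
by move=> ne [H1 H2]; split; apply: lifts_at => //; rewrite orbC.
Qed.

Definition cupless k (u : word k) : bool :=
  all (fun l => if l.1 is Cup _ then false else true) u.

Lemma cup_labels_cupless k (u : word k) : cupless u -> cup_labels u = [::].
Proof. by elim: u => // -[[x||c] p] u IH //= /IH ->. Qed.

Definition copy_layer k k' (l : layer k) : layer k' :=
  match l.1 with Cross c => (Cross c, l.2) | _ => (Cap, l.2) end.
Definition copy k k' (u : word k) : word k' := map (@copy_layer k k') u.

Lemma relabel_copy u u1 : cupless u -> relabel f u1 = u -> u1 = copy m u.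
Proof.
move=> + e; rewrite -{u}e; elim: u1 => //= -[[x||c] p] u1 IH //= /IH {1}->.
  by [].
by [].
Qed.

Lemma copy_relabel (v : word n) : cupless v -> relabel f (copy m v) = v.
Proof. by elim: v => // -[[x||c] p] v IH //= /IH ->. Qed.

Lemma cupless_copy k k' (u : word k) : cupless (copy k' u).
Proof. by elim: u => // -[[x||c] p] u IH. Qed.

(** Without minima there are no labels to choose, so the copy is the only possible lift. *)
Lemma lifts_cupless s u v : cupless u -> cupless v ->
  (forall (s1 t1 : slice m), run s1 (copy m u) = Some t1 ->
     run (map rs s1) v -> run s1 (copy m v) = Some t1) -> lifts s u v.
Proof.
move=> cu cv H s1 u1 t1 es eu r rv; exists (copy m v).
rewrite (relabel_copy cu eu) in r *.
rewrite !(cup_labels_cupless (cupless_copy _ _)).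
by split=> //; [exact: copy_relabel | apply: H; rewrite // es].
Qed.

Ltac cupless_tac := apply: lifts_cupless => //; case=> [|? [|? [|? ?]]] ?;
  rewrite /copy /copy_layer; run_tac; try done.

Lemma isotopy_lifts s u v : isotopy s u v -> bilifts s u v.
Proof.
case=> {s u v}.
- move=> s g h p r; split=> s1 u1 t1 es eu ru _.
    case: u1 eu ru => [|[g1 p1] [|[h1 p2] [|? ?]]] //= [<- <- <- ->] ru.
    exists [:: (h1, p1 + arity_in g1 + r); (g1, p1)].
    split; first by rewrite /= arity_in_relabel.
    + by apply/run_exchange; move: ru; rewrite arity_out_relabel.
    + by move=> i; rewrite mem_cat cup_labels_swap => ->; rewrite orbT.
    + by move=> i; rewrite mem_cat cup_labels_swap => ->; rewrite orbT.
  case: u1 eu ru => [|[h1 p2] [|[g1 p1] [|? ?]]] //= [<- -> <- <-] ru.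
  exists [:: (g1, p1); (h1, p1 + arity_out g1 + r)].
  split; first by rewrite /= arity_out_relabel.
  + by apply/run_exchange; move: ru; rewrite arity_in_relabel.
  + by move=> i; rewrite mem_cat cup_labels_swap => ->; rewrite orbT.
  + by move=> i; rewrite mem_cat cup_labels_swap => ->; rewrite orbT.
- move=> s x p; have := @bilifts_at p s [:: (Cup x, 1); (Cap, 0)] [::].
  rewrite /sh /= addn0 addn1; apply=> //; move: (drop p s) => r0 {s}.
  split=> s1 u1 t1 es eu.
    case: u1 eu => [|[[x1||?] p1] [|[[?|| ?] p2] [|? ?]]] //= [_ -> ->].
    case: s1 es => [|y s1] _; run_tac => //.
    case: eqP => // ->; rewrite ?opp_strandK => -[<-] _.
    exists [::]; split=> //.
    + by move=> i; rewrite !inE => /eqP ->; rewrite eqxx.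
  case: u1 eu => //= _ [<-].
  case: s1 es => [|y s1] <-; run_tac => //.
  (* The lifted minimum takes its label from the strand on which the zigzag is created. *)
  case: eqP => // -> _; exists [:: (Cup (opp_strand y), 1); (Cap, 0)].
  split=> //; first by run_tac.
  by move=> i; rewrite !inE => /eqP ->; rewrite eqxx.
- move=> s x p; have := @bilifts_at p s [:: (Cup x, 0); (Cap, 1)] [::].
  rewrite /sh /= addn0 addn1; apply=> //; move: (drop p s) => r0 {s}.
  split=> s1 u1 t1 es eu.
    case: u1 eu => [|[[x1||?] p1] [|[[?|| ?] p2] [|? ?]]] //= [_ -> ->].
    case: s1 es => [|y s1] _; run_tac => //.
    case: eqP => // ->; rewrite ?opp_strandK => -[<-] _.
    exists [::]; split=> //.
    + by move=> i; rewrite !inE => /eqP ->; rewrite eqxx.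
  case: u1 eu => //= _ [<-].
  case: s1 es => [|y s1] <-; run_tac => //.
  case: eqP => // e _; exists [:: (Cup y, 0); (Cap, 1)].
  split=> //; [| by run_tac |].
    by rewrite /relabel /relabel_layer /= e.
  by move=> i; rewrite !inE => /eqP ->; rewrite eqxx.
- move=> s k p; have := @bilifts_at p s [:: (Cross k, 0); (Cap, 1)]
    [:: (Cross (flip k), 1); (Cap, 0)].
  rewrite /sh /= addn0 addn1; apply=> //; move: (drop p s) => r0 {s}.
  split; cupless_tac.
- move=> s x k p; have := @bilifts_at p s [:: (Cup x, 0); (Cross k, 1)]
    [:: (Cup x, 1); (Cross (flip k), 0)].
  rewrite /sh /= addn0 addn1; apply=> //; move: (drop p s) => r0 {s}.
  have sub (r l : seq 'I_m) : {subset l <= r ++ l}.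
    by move=> i il; rewrite mem_cat il orbT.
  split=> s1 u1 t1 es eu.
    case: u1 eu => [|[[x1||?] p1] [|[[?|| ?] p2] [|? ?]]] //= [ex -> -> ->].
    case: s1 es => [|y s1] _; run_tac => // -[<-] _.
    exists [:: (Cup x1, 1); (Cross (flip k), 0)]; split=> //.
    + by rewrite /relabel /relabel_layer /= ex.
    + by run_tac.
    + exact: (sub (map fst (y :: s1)) [:: x1.1]).
    + exact: (sub (map fst (y :: s1)) [:: x1.1]).
  case: u1 eu => [|[[x1||?] p1] [|[[?|| ?] p2] [|? ?]]] //= [ex -> -> ->].
  case: s1 es => [|y s1] _; run_tac => // -[<-] _.
  exists [:: (Cup x1, 0); (Cross k, 1)]; split=> //.
  + by rewrite /relabel /relabel_layer /= ex.
  + exact: (sub (map fst (y :: s1)) [:: x1.1]).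
  + exact: (sub (map fst (y :: s1)) [:: x1.1]).
Qed.

Lemma eq_opp_sym k (x y : strand k) : (x == opp_strand y) = (y == opp_strand x).
Proof. by rewrite eq_sym -(inj_eq (inv_inj (@opp_strandK k))) opp_strandK. Qed.

Lemma reidemeister_lifts s u v : reidemeister s u v -> bilifts s u v.
Proof.
case=> {s u v}.
- move=> s k p; have := @bilifts_at p s [:: (Cross k, 0); (Cap, 0)] [:: (Cap, 0)].
  rewrite /sh /= addn0; apply=> //; move: (drop p s) => r0 {s}.
  by split; cupless_tac => //; rewrite eq_opp_sym.
- move=> s k p; have := @bilifts_at p s [:: (Cross k, 0); (Cross (flip k), 0)] [::].
  rewrite /sh /= addn0; apply=> //; move: (drop p s) => r0 {s}.
  by split; cupless_tac.
- move=> s k1 k2 k3 p _.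
  have := @bilifts_at p s (triangle n false k1 k2 k3 0) (triangle n true k1 k2 k3 0).
  rewrite /sh /= addn0 addn1; apply=> //; move: (drop p s) => r0 {s}.
  by split; cupless_tac.
Qed.

(** Changing only the kinds of crossings, as all three moves do, has no effect on how labels run
    through a word, whatever the directions. *)
Definition same_shape (u v : word n) : Prop :=
  exists ks ks', [/\ u = [seq (Cross x.1, x.2) | x <- ks],
    v = [seq (Cross x.1, x.2) | x <- ks'] & map snd ks = map snd ks'].

Lemma same_shape_lifts s u v : same_shape u v -> bilifts s u v.
Proof.
have one ks ks' : map snd ks = map snd ks' -> forall s,
    lifts s [seq (Cross x.1, x.2) | x <- ks] [seq (Cross x.1, x.2) | x <- ks'].
  move=> e s0; apply: lifts_cupless.
  - by elim: ks {e}.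
  - by elim: ks' {e}.
  move=> s1 t1 + _; elim: ks ks' e s1 => [|[k q] ks IH] [|[k' q'] ks'] //=.
  case=> <- /IH {}IH s1; rewrite /copy_layer /= !step_cross.
  by case: ifP => //= _ /IH.
by case=> ks [ks' [-> -> e]]; split; apply: one.
Qed.


End Lifting.

Arguments onth : simpl never.

Lemma slice_step n (w : word n) t h l : run [::] w = Some t ->
  onth w h = Some l -> step (slice_at w h) l = Some (slice_at w h.+1).
Proof.
move=> rw lh; have lt_h : h < size w by rewrite -onthTE lh.
have wE : take h.+1 w = take h w ++ [:: l].
  by rewrite (take_nth l) // cats1 -odflt_onth lh.
move: rw; rewrite -{1}(cat_take_drop h.+1 w) /slice_at wE !run_cat.
case: (run _ (take h w)) => [s|] //=.
by case: (step s l).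
Qed.

Lemma onth_catr T (s1 s2 : seq T) j : onth (s1 ++ s2) (size s1 + j) = onth s2 j.
Proof. by rewrite onth_cat ltnNge leq_addr /= addKn. Qed.

Lemma onth_at T (s1 s2 : seq T) x : onth (s1 ++ x :: s2) (size s1) = Some x.
Proof. by rewrite -[size s1]addn0 onth_catr. Qed.

Lemma onth_atS T (s1 s2 : seq T) x y :
  onth (s1 ++ [:: x, y & s2]) (size s1).+1 = Some y.
Proof. by rewrite -addn1 onth_catr. Qed.

Lemma joined_label n (w : word n) a b : run [::] w = Some [::] -> joined w a b ->
  omap fst (onth (slice_at w a.1) a.2) = omap fst (onth (slice_at w b.1) b.2).
Proof.
move=> rw; case=> {a b}.
- move=> h g p j /(slice_step rw)/stepP[a [m [m' [b [[-> -> <- _ _] _]]]]] lt_j.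
  by rewrite !onth_cat /= lt_j.
- move=> h g p j /(slice_step rw)/stepP[a [m [m' [b [[-> -> <- <- <-] _]]]]].
  by rewrite -!addnA !onth_catr.
- move=> h x p /(slice_step rw)/stepP[a [m [m' [b [[_ -> <- em _] e]]]]].
  by case: m em e => //= _; rewrite /step /= => -[<-]; rewrite /= onth_at onth_atS.
- move=> h p /(slice_step rw)/stepP[a [m [m' [b [[-> _ <- em _] e]]]]].
  case: m em e => [|x [|y []]] //= _; rewrite /step /=; case: eqP => // -> _.
  by rewrite /= onth_at onth_atS.
- move=> h k p /(slice_step rw)/stepP[a [m [m' [b [[-> -> <- em _] e]]]]].
  case: m em e => [|x [|y []]] //= _; rewrite /step /= => -[<-].
  by rewrite /= onth_at onth_atS.
- move=> h k p /(slice_step rw)/stepP[a [m [m' [b [[-> -> <- em _] e]]]]].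
  case: m em e => [|x [|y []]] //= _; rewrite /step /= => -[<-].
  by rewrite /= onth_at onth_atS.
Qed.

Lemma joined_relabel m n (f : 'I_m -> 'I_n) (w : word m) a b :
  joined (relabel f w) a b -> joined w a b.
Proof.
have rE h : onth (relabel f w) h = omap (relabel_layer f) (onth w h).
  by rewrite onth_map.
case=> {a b} [h g p j|h g p j|h x p|h p|h k p|h k p];
  rewrite rE; case E: (onth w h) => [[g' p']|] //= [].
- by move=> _ <-; apply: joined_left E.
- by move=> <- <-; rewrite arity_in_relabel arity_out_relabel; apply: joined_right E.
- by case: g' E => // y E _ <-; apply: joined_cup E.
- by case: g' E => // E _ <-; apply: joined_cap E.
- by case: g' E => // k' E _ <-; apply: joined_NE E.
- by case: g' E => // k' E _ <-; apply: joined_NW E.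
Qed.

Lemma cup_labelsP n (w : word n) i : reflect
  (exists h x p, onth w h = Some (Cup x, p) /\ x.1 = i) (i \in cup_labels w).
Proof.
apply: (iffP idP).
  rewrite mem_pmap => /mapP[[[x||k] p] //] /onthP[h hE] [->].
  by exists h, x, p.
case=> h [x [p [hE <-]]]; rewrite mem_pmap; apply/mapP.
by exists (Cup x, p) => //; apply/onthP; exists h.
Qed.

Lemma cup_point n (w : word n) t h x p : run [::] w = Some t ->
  onth w h = Some (Cup x, p) -> onth (slice_at w h.+1) p = Some x.
Proof.
move=> rw /(slice_step rw)/stepP[a [m [m' [b [[_ -> <- em _] e]]]]].
by case: m em e => //= _; rewrite /step /= => -[<-]; rewrite onth_at.
Qed.

Lemma run_take n (w : word n) t h : run [::] w = Some t ->
  run [::] (take h w) = Some (slice_at w h).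
Proof.
rewrite -{1}(cat_take_drop h w) run_cat /slice_at.
by case: (run _ (take h w)).
Qed.

Lemma slice_at_label n (w : word n) t h j x : run [::] w = Some t ->
  onth (slice_at w h) j = Some x -> x.1 \in cup_labels w.
Proof.
move=> /(run_take h)/run_labels sub E.
have /sub : x.1 \in map fst (slice_at w h).
  by apply: map_f; apply/onthP; exists j.
rewrite /= -{2}(cat_take_drop h w) cup_labels_cat mem_cat => ->.
by [].
Qed.

Definition proj n (i : 'I_(n + n)) : 'I_n :=
  match split i with inl j => j | inr j => j end.
Definition paint n (b : bool) (i : 'I_n) : 'I_(n + n) :=
  if b then rshift n i else lshift n i.

Lemma paintK n b : cancel (@paint n b) (@proj n).
Proof.
move=> i; rewrite /proj /paint.
case: b; first by rewrite -[rshift n i]/(unsplit (inr i)) unsplitK.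
by rewrite -[lshift n i]/(unsplit (inl i)) unsplitK.
Qed.

Lemma paint_inj n b c (i j : 'I_n) : paint b i = paint c j -> b = c.
Proof.
rewrite /paint; case: b c => [] [] // /(congr1 val) /=.
  by have := ltn_ord j; lia.
by have := ltn_ord i; lia.
Qed.

(* Doubling the set of labels expresses that the strands of each component form a
   single circle in a form which local moves transport, unlike paths in
   [joined]. *)
Definition rigid n (w : word n) : Prop := forall w1 : word (n + n),
  relabel (@proj n) w1 = w -> run [::] w1 = Some [::] ->
  {in cup_labels w1 &, forall i j, proj i = proj j -> i = j}.

Section Painting.
Variables (n : nat) (w : word n) (c : nat * nat -> bool).
Hypothesis cE : forall a b, joined w a b -> c a = c b.

Fixpoint paint_slice h k (s : slice n) : slice (n + n) :=
  if s is x :: s' then (paint (c (h, k)) x.1, x.2) :: paint_slice h k.+1 s'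
  else [::].

(** A minimum has no points at height [h], so its colour is read just above it. *)
Definition paint_layer h (l : layer n) : layer (n + n) :=
  match l.1 with
  | Cup x => (Cup (paint (c (h.+1, l.2)) x.1, x.2), l.2)
  | Cap => (Cap, l.2)
  | Cross k => (Cross k, l.2)
  end.

Fixpoint paint_word h (u : word n) : word (n + n) :=
  if u is l :: u' then paint_layer h l :: paint_word h.+1 u' else [::].

Lemma paint_slice_cat h k s1 s2 : paint_slice h k (s1 ++ s2) =
  paint_slice h k s1 ++ paint_slice h (k + size s1) s2.
Proof.
by elim: s1 k => [|x s1 IH] k /=; rewrite ?addn0 ?addnS // IH addSn.
Qed.

Lemma eq_paint_slice h h' k k' s :
  (forall j, j < size s -> c (h, k + j) = c (h', k' + j)) ->
  paint_slice h k s = paint_slice h' k' s.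
Proof.
elim: s k k' => //= x s IH k k' H; have := H 0 isT; rewrite !addn0 => ->.
by congr (_ :: _); apply: IH => j lt_j; rewrite !addSnnS; apply: H.
Qed.

Lemma size_paint_slice h k s : size (paint_slice h k s) = size s.
Proof. by elim: s k => //= x s IH k; rewrite IH. Qed.

Lemma step_paint h s l s' : onth w h = Some l -> step s l = Some s' ->
  step (paint_slice h 0 s) (paint_layer h l) = Some (paint_slice h.+1 0 s').
Proof.
case: l => g p lh /stepP[a [m [m' [b [[-> -> sa em em'] e]]]]].
rewrite !paint_slice_cat !add0n sa.
have ea : paint_slice h 0 a = paint_slice h.+1 0 a.
  apply: eq_paint_slice => j lt_j; apply: cE; apply: joined_left lh _.
  by rewrite -sa.
have eb : paint_slice h (p + size m) b = paint_slice h.+1 (p + size m') b.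
  apply: eq_paint_slice => j _; rewrite em em'; apply: cE.
  exact: joined_right lh.
rewrite ea eb; have sa' : size (paint_slice h.+1 0 a) = p.
  by rewrite size_paint_slice.
suff e1 : step (paint_slice h p m) ((paint_layer h (g, p)).1, 0) =
    Some (paint_slice h.+1 p m').
  have -> : paint_layer h (g, p) =
      ((paint_layer h (g, p)).1, size (paint_slice h.+1 0 a) + 0).
    by rewrite addn0 sa'; case: (g).
  rewrite (step_sh _ _ (_, 0)) (step_left _ e1) //.
case: g lh em em' e => [x||k] lh em em'; rewrite /step /=.
- case: m em {eb} => //= _ [<-] /=; rewrite /opp_strand /=.
  by rewrite (cE (joined_cup lh)).
- case: m em {eb} => [|x [|y []]] //= _; case: eqP => // -> [<-] /=.
  by rewrite (cE (joined_cap lh)) /opp_strand /= eqxx.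
- case: m em {eb} => [|x [|y []]] //= _ [<-] /=.
  by rewrite (cE (joined_NE lh)) (cE (joined_NW lh)).
Qed.

Lemma run_paint h u v v' s s' : w = u ++ v ++ v' -> size u = h -> run s v = Some s' ->
  run (paint_slice h 0 s) (paint_word h v) =
  Some (paint_slice (h + size v) 0 s').
Proof.
elim: v h u s => [|l v IH] h u s wE su /=; first by rewrite addn0 => -[->].
case E: (step s l) => [t|] //= r.
rewrite (@step_paint h s l t) //=; last first.
  by rewrite wE -su -[size u]addn0 onth_catr.
by rewrite (IH _ (rcons u l)) ?addSnnS ?size_rcons ?su // cat_rcons.
Qed.

Lemma relabel_paint h u : relabel (@proj n) (paint_word h u) = u.
Proof.
elim: u h => //= -[[[i b]||k] p] u IH h; rewrite IH //.
by rewrite /paint_layer /relabel_layer /= /relabel_strand /= paintK.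
Qed.

Lemma paint_word_cat h u v :
  paint_word h (u ++ v) = paint_word h u ++ paint_word (h + size u) v.
Proof.
by elim: u h => [|l u IH] h /=; rewrite ?addn0 // IH addSnnS.
Qed.

Lemma onth_paint_slice h k s j : onth (paint_slice h k s) j =
  omap (fun x => (paint (c (h, k + j)) x.1, x.2)) (onth s j).
Proof.
elim: s k j => [|x s IH] k j; first by rewrite !onth0n.
case: j => [|j]; first by rewrite addn0.
by have := IH k.+1 j; rewrite addSnnS.
Qed.
End Painting.

(** Arcs preserve labels in every lift, so minima on one circle get equal labels. Conversely, if two
    points of component [i] were not joined, colouring the [joined] class of the first point would
    give a lift that uses both copies of the label [i]. *)
Theorem is_diagramP n (w : word n) : is_diagram w <->
  [/\ run [::] w = Some [::], forall i, i \in cup_labels w & rigid w].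
Proof.
split=> [[rw dw]|[rw occ rig]].
  split=> // [i|w1 ew rw1 i j].
    have [[a [o E]] _] := dw i.
    exact: slice_at_label rw E.
  case/cup_labelsP=> h [x [p [hE <-]]] /cup_labelsP[h' [y [p' [hE' <-]]]] exy.
  have same a b : clos_refl_sym_trans _ (joined w) a b ->
    omap fst (onth (slice_at w1 a.1) a.2) = omap fst (onth (slice_at w1 b.1) b.2).
    elim=> [{}a {}b|//|{}a {}b _ -> //|{}a b' {}b _ -> _ -> //].
    by rewrite -ew => /joined_relabel; apply: joined_label.
  have ons h0 x0 p0 : onth w1 h0 = Some (Cup x0, p0) ->
      on_component w (proj x0.1) (h0.+1, p0).
    move=> E; exists x0.2; rewrite /= -ew /slice_at -map_take.
    have := run_relabel (@proj n) (run_take h0.+1 rw1) => -> /=.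
    by rewrite onth_map (cup_point rw1 E).
  have o1 := ons _ _ _ hE; have o2 := ons _ _ _ hE'; rewrite -exy in o2.
  have /same /= := (dw _).2 _ _ o1 o2.
  by rewrite (cup_point rw1 hE) (cup_point rw1 hE') => -[].
split=> // i; split.
  have /cup_labelsP[h [x [p [hE xi]]]] := occ i.
  exists (h.+1, p), x.2; rewrite /= (cup_point rw hE) -xi.
  by case: (x).
move=> a b [o ao] [o' bo].
pose c z := `[< clos_refl_sym_trans _ (joined w) a z >].
have cE z t : joined w z t -> c z = c t.
  move=> zt; apply/asboolP/asboolP => H; apply: rst_trans H _.
    exact: rst_step.
  by apply: rst_sym; exact: rst_step.
have rp u v s : w = u ++ v -> run [::] u = Some s ->
    run [::] (paint_word c 0 u) = Some (paint_slice c (size u) 0 s).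
  by move=> wE; apply: (@run_paint n w c cE 0 [::] u v).
pose w1 := paint_word c 0 w.
have rw1 : run [::] w1 = Some [::] by exact: (rp w [::] [::] (esym (cats0 w)) rw).
have lab h j y : onth (slice_at w h) j = Some y ->
    paint (c (h, j)) y.1 \in cup_labels w1.
  move=> E; have r1 := run_take h rw.
  have le_h : h <= size w.
    rewrite leqNgt; apply/negP => lt_h.
    by move: E; rewrite /slice_at take_oversize ?(ltnW lt_h) // rw onth0n.
  have r2 := rp _ _ _ (esym (cat_take_drop h w)) r1.
  rewrite size_takel // in r2.
  have /(run_labels r2) : paint (c (h, j)) y.1 \in
      map fst (paint_slice c h 0 (slice_at w h)).
    apply/mapP; exists (paint (c (h, j)) y.1, y.2) => //.
    by apply/onthP; exists j; rewrite onth_paint_slice E.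
  rewrite /= /w1 -{2}(cat_take_drop h w) paint_word_cat cup_labels_cat mem_cat.
  by move=> ->.
have := rig w1 (relabel_paint c 0 w) rw1 _ _ (lab _ _ _ ao) (lab _ _ _ bo).
rewrite !paintK => /(_ erefl)/paint_inj e.
have : c (a.1, a.2) by rewrite -surjective_pairing; apply/asboolP; exact: rst_refl.
by rewrite e -surjective_pairing => /asboolP.
Qed.

(** * Moves preserve diagrams *)

Section Preservation.
Variables (n : nat) (X : rule n).
Hypothesis Xlifts : forall m (f : 'I_m -> 'I_n) s u v, X s u v -> bilifts f s u v.

Lemma rule_bilifts m (f : 'I_m -> 'I_n) s u v :
  rule_union X (@link_rule n) s u v -> bilifts f s u v.
Proof.
case=> [|[]]; [exact: Xlifts | exact: isotopy_lifts | exact: reidemeister_lifts].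
Qed.

Lemma relabel_id (u : word n) : relabel id u = u.
Proof.
rewrite /relabel map_id_in // => -[g p] _; rewrite /relabel_layer /=.
by case: g => [[i b]||k].
Qed.

Lemma relabel_slice_id (s : slice n) : map (relabel_strand id) s = s.
Proof. by rewrite map_id_in // => -[i b]. Qed.

(** For [f = id] a word is its own lift. This recovers the equality of results that [wstep] demands
    and [local_move] does not mention. *)
Lemma bilifts_run (s : slice n) u v t : bilifts id s u v -> run s u = Some t ->
  run s v -> run s v = Some t.
Proof.
case=> H _ ru rv.
have [v1 [ev <- _ _]] := H s u t (relabel_slice_id s) (relabel_id u) ru rv.
by rewrite -ev relabel_id.
Qed.

(** Rigidity passes to the new word because a lift of it becomes a lift of the old one on lifting
    the replacement backwards; no label is lost, since each label of the replaced part occurs below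
    it or in its replacement. *)
Lemma is_diagram_replace (w1 w2 : word n) s u v : run [::] w1 = Some s ->
  (forall m (f : 'I_m -> 'I_n), lifts f s u v) ->
  (forall m (f : 'I_m -> 'I_n), lifts f s v u) ->
  run s u = run s v -> is_diagram (w1 ++ u ++ w2) -> is_diagram (w1 ++ v ++ w2).
Proof.
move=> r1 luv lvu ruv /is_diagramP[rw occ rig]; apply/is_diagramP.
have [t ru] : exists t, run s u = Some t.
  by move: rw; rewrite !run_cat r1 /= run_cat; case: (run s u) => // t; exists t.
have rv : run s v = Some t by rewrite -ruv.
split.
- by rewrite -rw !run_cat r1 /= !run_cat ruv.
- move=> i; have := occ i; rewrite !cup_labels_cat !mem_cat.
  case/or3P=> [->//|iu|->]; last by rewrite !orbT.
  have [|v1 [ev _ sub _]] := luv n id s u t (relabel_slice_id s) (relabel_id u) ru.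
    by rewrite rv.
  rewrite relabel_id in ev; move: (sub i iu); rewrite ev mem_cat.
  case/orP=> [/(run_labels r1)/= ->//|->]; by rewrite orbT.
move=> w' ew rw'.
have [a [b [c [e1 ea eb ec]]]] : exists a b c, [/\ w' = a ++ b ++ c,
    relabel (@proj n) a = w1, relabel (@proj n) b = v & relabel (@proj n) c = w2].
  exists (take (size w1) w'), (take (size v) (drop (size w1) w')),
    (drop (size v) (drop (size w1) w')).
  rewrite !cat_take_drop /relabel !(map_take, map_drop) -/(relabel _ _) ew.
  by rewrite take_size_cat // drop_size_cat // take_size_cat // drop_size_cat.
rewrite e1 in rw' *; move: rw'; rewrite !run_cat.
case ra: (run _ a) => [s1|] //=; rewrite run_cat.
case rb: (run s1 b) => [t1|] //= rc.
have es : map (relabel_strand (@proj n)) s1 = s.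
  by have := run_relabel (@proj n) ra; rewrite ea r1 => -[].
have [|u1 [eu ru1 sub1 sub2]] := lvu _ (@proj n) s1 b t1 es eb rb.
  by rewrite ru.
have := rig (a ++ u1 ++ c); rewrite !relabel_cat ea eu ec !run_cat ra /=.
rewrite run_cat ru1 /= rc => /(_ erefl erefl) H i j.
have sub k : k \in cup_labels (a ++ b ++ c) -> k \in cup_labels (a ++ u1 ++ c).
  rewrite !cup_labels_cat !mem_cat => /or3P[->//|/sub1|->]; last by rewrite !orbT.
  by rewrite mem_cat => /orP[/(run_labels ra)/= ->|->]; rewrite ?orbT.
by move=> /sub iin /sub jin; exact: H.
Qed.

Lemma is_diagram_weq u v : weq X [::] u v -> (is_diagram u <-> is_diagram v).
Proof.
elim=> [{}u {}v [w1 [u' [v' [w2 [s [-> -> r1 r e]]]]]]|//|x y _ []|x y z _ [] + + _ []];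
  last by move=> H1 H2 H3 H4; split=> H; auto.
  have bl m (f : 'I_m -> 'I_n) := rule_bilifts f r.
  by split; apply: is_diagram_replace r1 _ _ _ => // m f; case: (bl m f).
by split.
Qed.

(** All words in a chain of [wstep] that starts at a diagram are diagrams, so the chain is a
    sequence of moves between diagrams. *)
Lemma diagram_chain (D E : diagram n) : weq X [::] (sval D) (sval E) ->
  equiv_by (rule_union X (@link_rule n)) D E.
Proof.
case: D E => [u pu] [v pv] /= e.
elim: e pu pv => [{}u {}v [w1 [u' [v' [w2 [s [eu ev r1 r e]]]]]]|{}u|{}u {}v _ H|
  {}u w {}v uw H1 wv H2] pu pv.
- by apply: rst_step; exists w1, u', v', w2, s; split.
- by rewrite (bool_irrelevance pu pv); exact: rst_refl.
- by apply: rst_sym; exact: H.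
have pw : `[< is_diagram w >].
  by apply/asboolP; apply/(is_diagram_weq uw); apply/asboolP.
exact: rst_trans (H1 pu pw) (H2 pw pv).
Qed.

End Preservation.

(** * Parity *)

Section Parity.
Variables (n : nat) (i : 'I_n).

(** Signs disappear modulo 2, so the parity becomes a boolean count of real crossings between
    component [i] and the others. *)
Definition odd_layer (s : slice n) (l : layer n) : bool :=
  match l.1, drop l.2 s with
  | Cross k, [:: x, y & _] => real k && ((x.1 == i) (+) (y.1 == i))
  | _, _ => false
  end.

Fixpoint odd_word (s : slice n) (w : word n) : bool :=
  if w is l :: w' then odd_layer s l (+) odd_word (odflt [::] (step s l)) w'
  else false.

Lemma odd_word_cat s t u v : run s u = Some t ->
  odd_word s (u ++ v) = odd_word s u (+) odd_word t v.
Proof.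
elim: u s => [|l u IH] s; first by case=> ->.
rewrite run_cons /=; case E: (step s l) => [s'|//] /= /IH ->.
by rewrite addbA.
Qed.

Lemma odd_layer_sh s1 s l : odd_layer (s1 ++ s) (l.1, size s1 + l.2) = odd_layer s l.
Proof. by rewrite /odd_layer /= drop_cat ltnNge leq_addr /= addKn. Qed.

Lemma odd_word_sh s1 s w t : run s w = Some t ->
  odd_word (s1 ++ s) (sh (size s1) w) = odd_word s w.
Proof.
elim: w s => //= l w IH s; rewrite -/(sh _ _) odd_layer_sh step_sh.
by case: (step s l) => [s'|] //= /IH ->.
Qed.

Lemma odd_layer_left s1 s2 l s1' : step s1 l = Some s1' ->
  odd_layer (s1 ++ s2) l = odd_layer s1 l.
Proof.
case: l => g p /stepP[a [m [m' [b [[-> _ <- em _] _]]]]].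
rewrite /odd_layer /= -!catA !drop_size_cat //.
by case: g em => // k; case: m => [|x [|y m]].
Qed.

Lemma odd_word_exchange s t g h p r :
  run s [:: (g, p); (h, p + arity_out g + r)] = Some t ->
  odd_word s [:: (g, p); (h, p + arity_out g + r)] =
  odd_word s [:: (h, p + arity_in g + r); (g, p)].
Proof.
rewrite run_cons; case E: (step s (g, p)) => [s'|] //.
have [a [c [c' [b [[sE s'E ap ec ec'] e]]]]] := stepP E.
rewrite /= E /= !addbF sE s'E -ap -ec -ec' -!size_cat !catA.
rewrite (step_sh (a ++ c') b (h, r)) (step_sh (a ++ c) b (h, r)).
rewrite (odd_layer_sh (a ++ c') b (h, r)) (odd_layer_sh (a ++ c) b (h, r)).
have ea : step (a ++ c) (g, size a) = Some (a ++ c').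
  by rewrite -[size a]addn0 (step_sh a c (g, 0)) e.
case: (step b (h, r)) => [b'|] //= _.
by rewrite !(odd_layer_left _ ea) addbC.
Qed.

Definition odd_invariant s u v : Prop := forall t,
  run s u = Some t -> run s v = Some t -> odd_word s u = odd_word s v.

Lemma odd_invariant_at p s u v : (u != [::]) || (v != [::]) ->
  odd_invariant (drop p s) u v -> odd_invariant s (sh p u) (sh p v).
Proof.
move=> ne H t; have [le_p|lt_p] := leqP p (size s).
  have [s1 [s2 [sE sz _]]] := split_size (esym (subnKC le_p)).
  rewrite sE drop_size_cat // in H; rewrite sE -sz !run_sh {s le_p sE}.
  case Eu: (run _ u) => [t1|] //=; case Ev: (run _ v) => [t2|] //= [<-] e.
  rewrite (odd_word_sh _ Eu) (odd_word_sh _ Ev); apply: (H t1) => //.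
  by rewrite Ev; case: e => /eqP; rewrite eqseq_cat // eqxx => /eqP ->.
case: u ne {H} => [|l u] ne; last by rewrite run_sh_oversize.
by case: v ne => [|l v] // _ _; rewrite run_sh_oversize.
Qed.

Lemma real_flip k : real (flip k) = real k. Proof. by case: k. Qed.

Lemma link_rule_odd s u v : link_rule s u v -> odd_invariant s u v.
Proof.
case=> [] [].
- by move=> {}s g h p r t ru _; exact: odd_word_exchange ru.
- move=> {}s x p; have := @odd_invariant_at p s [:: (Cup x, 1); (Cap, 0)] [::].
  by rewrite /sh /= addn0 addn1; apply.
- move=> {}s x p; have := @odd_invariant_at p s [:: (Cup x, 0); (Cap, 1)] [::].
  by rewrite /sh /= addn0 addn1; apply.
- move=> {}s k p; have := @odd_invariant_at p s [:: (Cross k, 0); (Cap, 1)]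
    [:: (Cross (flip k), 1); (Cap, 0)].
  rewrite /sh /= addn0 addn1; apply=> //; move: (drop p s) => r0 {s}.
  case: r0 => [|x [|y [|z s]]] t; run_tac => //.
  case: eqP => // -> _ _.
  rewrite /odd_word /step /odd_layer /= ?take0 ?drop0 /= real_flip.
  by rewrite !addbF addbC.
- move=> {}s x k p; have := @odd_invariant_at p s [:: (Cup x, 0); (Cross k, 1)]
    [:: (Cup x, 1); (Cross (flip k), 0)].
  rewrite /sh /= addn0 addn1; apply=> //; move: (drop p s) => r0 {s}.
  case: r0 => [|y s] t; run_tac => // _ _.
  rewrite /odd_word /step /odd_layer /= ?take0 ?drop0 /= real_flip.
  by rewrite /opp_strand /= !addbF addbC.
- move=> {}s k p; have := @odd_invariant_at p s [:: (Cross k, 0); (Cap, 0)] [:: (Cap, 0)].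
  rewrite /sh /= addn0; apply=> //; move: (drop p s) => r0 {s}.
  case: r0 => [|x [|y s]] t; run_tac => //.
  case: eqP => // -> _ _; rewrite /odd_word /step /odd_layer /= ?take0 ?drop0 /=.
  by rewrite /opp_strand /= addbb andbF.
- move=> {}s k p; have := @odd_invariant_at p s [:: (Cross k, 0); (Cross (flip k), 0)] [::].
  rewrite /sh /= addn0; apply=> //; move: (drop p s) => r0 {s}.
  case: r0 => [|x [|y s]] t; run_tac => // _ _.
  rewrite /odd_word /step /odd_layer /= ?take0 ?drop0 /= real_flip.
  by rewrite [X in _ && X (+) _]addbC addbF addbb.
- move=> {}s k1 k2 k3 p _.
  have := @odd_invariant_at p s (triangle n false k1 k2 k3 0) (triangle n true k1 k2 k3 0).
  rewrite /sh /= addn0 addn1; apply=> //; move: (drop p s) => r0 {s}.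
  case: r0 => [|x [|y [|z s]]] t; run_tac => // _ _.
  rewrite /odd_word /step /odd_layer /= ?take0 ?drop0 /=.
  by rewrite !addbF addbA addbC; congr (_ (+) _); rewrite addbC.
Qed.

(** Of the three pairs of strands of a triangle, either none or exactly two consist of one strand on
    [i] and one off [i]. *)
Lemma vDelta_odd s u v : vDelta s u v -> odd_invariant s u v.
Proof.
case=> e [k1 [k2 [k3 [p [alt -> ->]]]]].
have := @odd_invariant_at p s (triangle n e k1 k2 k3 0)
  (triangle n e Virtual Virtual Virtual 0).
rewrite !triangle_sh addn0; apply; first by case: (e).
have [r1 [r2 r3]] : real k1 /\ real k2 /\ real k3.
  by move: alt; rewrite /alternating; case/and4P.
move: (drop p s) => r0 {s}; case: e; case: r0 => [|x [|y [|z s]]] t;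
  run_tac => // _ _; rewrite /odd_word /step /odd_layer /= ?take0 ?drop0 /=;
  rewrite r1 r2 r3 /=; by case: (x.1 == i) (y.1 == i) (z.1 == i) => [] [] [].
Qed.

Lemma vDelta_wedge_odd s u v : vDelta_wedge s u v -> odd_invariant s u v.
Proof.
case=> e [k1 [k2 [k3 [p [alt _ eu ev]]]]]; apply: vDelta_odd.
by exists e, k1, k2, k3, p.
Qed.

Lemma vSharp_odd s u v : vSharp s u v -> odd_invariant s u v.
Proof.
case=> k [p [rk _ _ -> ->]].
have := @odd_invariant_at p s (grid n k 0) (grid n Virtual 0).
rewrite /sh /grid /= addn0 addn1 addn2; apply=> //.
move: (drop p s) => r0 {s}; case: r0 => [|x [|y [|z [|t s]]]] r;
  run_tac => // _ _; rewrite /odd_word /step /odd_layer /= ?take0 ?drop0 /=;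
  rewrite rk /=.
by case: (x.1 == i) (y.1 == i) (z.1 == i) (t.1 == i) => [] [] [] [].
Qed.

End Parity.

Section LinkingParity.
Import GRing.Theory.
Local Open Scope ring_scope.
Variables (n : nat) (i : 'I_n).

Lemma F2_addb (a b : bool) : ((a (+) b)%:R : 'F_2) = a%:R + b%:R.
Proof. by case: a b => [] []; apply/eqP. Qed.

Lemma crossing_sign_odd k (x y : strand n) :
  ((crossing_sign k x y)%:~R : 'F_2) = (real k)%:R.
Proof. by rewrite /crossing_sign; case: k => //=; case: eqP => _; apply/eqP. Qed.

(** The crossing is counted at the single [j] that names its other component; self-crossings of [i]
    drop out because [j = i] is excluded. *)
Lemma sum_over (x y : 'I_n) (z : int) :
  \sum_(j < n | j != i) ((if (x == i) && (y == j) then z else 0) +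
    (if (x == j) && (y == i) then z else 0)) =
  if (x == i) (+) (y == i) then z else 0.
Proof.
rewrite big_split /=.
have one (a b : 'I_n) : \sum_(j < n | j != i) (if (a == i) && (b == j) then z else 0)
    = if (a == i) && (b != i) then z else 0.
  case: (a == i) => /=; last by rewrite big1.
  have [->|bi] := eqVneq b i.
    by rewrite big1 // => j; rewrite eq_sym => /negPf ->.
  rewrite (bigD1 b) //= eqxx big1 ?addr0 // => j /andP[_].
  by rewrite eq_sym => /negPf ->.
rewrite one (eq_bigr (fun j => if (y == i) && (x == j) then z else 0)); last first.
  by move=> j _; rewrite andbC.
rewrite one; case: (x == i) (y == i) => [] [] /=; rewrite ?addr0 ?add0r //.
Qed.

Lemma layer_odd (s : slice n) (l : layer n) :
  ((\sum_(j < n | j != i) (over_sign i j s l + over_sign j i s l))%:~R : 'F_2)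
  = (odd_layer i s l)%:R.
Proof.
rewrite /over_sign /odd_layer; case: l => [[x||k] p] /=; try by rewrite big1.
case: (drop p s) => [|a [|b t]]; try by rewrite big1 //; case: k.
case: k; rewrite ?sum_over /=; last by rewrite big1.
  by case: (_ (+) _) => //; rewrite (crossing_sign_odd OverNE).
by rewrite addbC; case: (_ (+) _) => //; rewrite (crossing_sign_odd OverNW).
Qed.

Lemma lk_odd (s : slice n) (w : word n) :
  ((\sum_(j < n | j != i) (lk_from i j s w + lk_from j i s w))%:~R : 'F_2)
  = (odd_word i s w)%:R.
Proof.
elim: w s => [|l w IH] s /=; first by rewrite big1.
rewrite F2_addb -layer_odd -IH -rmorphD -big_split /=.
by congr (_%:~R); apply: eq_bigr => j _; rewrite addrACA.
Qed.

Lemma diagram_parityE (D : diagram n) :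
  diagram_parity D i = (odd_word i [::] (sval D))%:R.
Proof. exact: lk_odd. Qed.

Lemma F2_inj (a b : bool) : (a%:R : 'F_2) = b%:R -> a = b.
Proof. by case: a b => [] [] // /eqP. Qed.

End LinkingParity.

Lemma diagram_is_diagram n (D : diagram n) : is_diagram (sval D).
Proof. by case: D => w /= /asboolP. Qed.

Lemma diagram_closed n (D : diagram n) : run [::] (sval D) = Some [::].
Proof. by have [] := (is_diagramP _).1 (diagram_is_diagram D). Qed.

Section Invariance.
Variables (n : nat) (X : rule n).
Hypothesis Xlifts : forall m (f : 'I_m -> 'I_n) s u v, X s u v -> bilifts f s u v.
Hypothesis Xodd : forall i s u v, X s u v -> odd_invariant i s u v.

Lemma odd_weq i u v : weq X [::] u v -> run [::] u = Some [::] ->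
  odd_word i [::] u = odd_word i [::] v.
Proof.
elim=> [{}u {}v|//|{}u {}v uv H rv|{}u w {}v uw H1 wv H2 ru].
- case=> w1 [u' [v' [w2 [s [-> -> r1 r e]]]]]; rewrite !run_cat r1 /= run_cat.
  case ru': (run s u') => [t|] //= _.
  rewrite !(odd_word_cat _ _ r1) (odd_word_cat _ _ ru').
  rewrite ru' in e; rewrite (odd_word_cat _ _ (esym e)).
  congr (_ (+) (_ (+) _)).
  by case: r => [/Xodd H|/link_rule_odd H]; apply: H ru' (esym e).
- by rewrite H // (weq_run uv).
- by rewrite H1 // H2 // -(weq_run uw).
Qed.

Lemma equiv_weq (D E : diagram n) :
  equiv_by (rule_union X (@link_rule n)) D E -> weq X [::] (sval D) (sval E).
Proof.
elim=> [{}D {}E|{}D|{}D {}E _|{}D F {}E _ H1 _ H2].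
- case=> w1 [u [v [w2 [s [eu ev r1 r]]]]].
  have rD := diagram_closed D; have rE := diagram_closed E.
  rewrite eu ev; rewrite eu !run_cat r1 /= run_cat in rD.
  rewrite ev !run_cat r1 /= run_cat in rE.
  case ru: (run s u) rD => [t|] // _.
  apply: (weq_ctx w2 r1); apply: weq_rule => //.
  rewrite ru; apply/esym; apply: bilifts_run ru _.
    exact: (rule_bilifts Xlifts id r).
  by case: (run s v) rE.
- exact: weq_refl.
- exact: weq_sym.
- exact: weq_trans H1 H2.
Qed.

Lemma parity_equiv (D E : diagram n) :
  equiv_by (rule_union X (@link_rule n)) D E ->
  forall i, diagram_parity D i = diagram_parity E i.
Proof.
move=> /equiv_weq e i; rewrite !diagram_parityE (odd_weq i e) //.
exact: diagram_closed.
Qed.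

Lemma equiv_by_mono (R R' : rule n) (D E : diagram n) :
  (forall s u v, R s u v -> R' s u v) -> equiv_by R D E -> equiv_by R' D E.
Proof.
move=> RR'; elim=> [{}D {}E|{}D|{}D {}E _|{}D F {}E _ H1 _ H2].
- case=> w1 [u [v [w2 [s [eu ev r1 r]]]]]; apply: rst_step.
  by exists w1, u, v, w2, s; split=> //; exact: RR'.
- exact: rst_refl.
- exact: rst_sym.
- exact: rst_trans H1 H2.
Qed.

Lemma diagram_of_repr (L : vlink n) D : is_diagram_of L D ->
  equiv_by (rule_union X (@link_rule n)) D (repr L).
Proof.
move=> DL; have /eqmodP/asboolP : (\pi_(vlink n) D = \pi_(vlink n) (repr L))%qT.
  by rewrite reprK.
by apply: equiv_by_mono => s u v r; right.
Qed.

Lemma parity_link_equiv (L L' : vlink n) : link_equiv_by X L L' ->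
  forall i, parity L i = parity L' i.
Proof.
case=> D [D' [/diagram_of_repr DL /diagram_of_repr DL' DD']] i.
rewrite /parity -(parity_equiv DL) -(parity_equiv DL').
exact: parity_equiv.
Qed.

End Invariance.

(** * Classification *)

Lemma paired_map (T T' : Type) (P : rel T') (f : T -> T') s :
  paired P (map f s) = paired (fun a b => P (f a) (f b)) s.
Proof.
have [k] := ubnP (size s); elim: k s => // k IH [|a [|b s]] //= lt_s.
by rewrite IH //; lia.
Qed.

Lemma paired_and (T : Type) (P Q R : rel T) s :
  (forall a b, P a b -> Q a b -> R a b) -> paired P s -> paired Q s -> paired R s.
Proof.
move=> PQR; have [k] := ubnP (size s); elim: k s => // k IH [|a [|b s]] //= lt_s.
case/andP=> Pab Ps /andP[Qab Qs]; rewrite PQR //= IH //; lia.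
Qed.

Lemma paired_ends n (xs : seq (strand n)) :
  paired (fun a b => b == opp_strand a) (ends xs).
Proof. by elim: xs => //= x xs ->; rewrite eqxx. Qed.

Lemma run_caps_paired n (T : slice n) k : size T = k.*2 ->
  paired (fun a b => b == opp_strand a) T -> run T (caps n k) = Some [::].
Proof.
elim: k T => [|k IH] [|a [|b T]] //= [sz] /andP[/eqP -> pT].
by rewrite /step /= eqxx /=; case: T sz pT (IH T) => [|c T] sz pT; apply.
Qed.

Lemma cup_labels_cups n (xs : seq (strand n)) : cup_labels (cups xs) =i map fst xs.
Proof.
move=> i; rewrite -[RHS]mem_rev -map_rev /cups.
by elim: (rev xs) => //= x ys IH; rewrite !inE IH.
Qed.

Lemma cup_labels_plat n (xs : seq (strand n)) u :
  cup_labels (plat xs u) =i map fst xs.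
Proof.
move=> i; rewrite /plat !cup_labels_cat !mem_cat cup_labels_cups.
rewrite [cup_labels (cw n u)]cup_labels_cupless; last by elim: u.
rewrite [cup_labels (caps _ _)]cup_labels_cupless ?orbF //.
by elim: (size xs).
Qed.

Lemma relabel_plat m n (f : 'I_m -> 'I_n) (xs : seq (strand m)) u :
  relabel f (plat xs u) = plat (map (relabel_strand f) xs) u.
Proof.
rewrite /plat !relabel_cat size_map; congr (_ ++ (_ ++ _)).
- by rewrite /cups /relabel -map_rev -!map_comp.
- by rewrite /cw /relabel -map_comp.
- by rewrite /caps /relabel map_nseq.
Qed.

(* The cup [x] and its component-mates get different colours, so some cap must join
   strands of different colours. *)
Lemma rigid_unpaired n (x : strand n) ys u (xs := x :: ys) :
  closed_plat xs u -> rigid (plat xs u) -> x.1 \in map fst ys ->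
  ~ paired (fun p q => (p.1 < 2) == (q.1 < 2)) (act u (untog (iota 0 (size xs).*2))).
Proof.
move=> [oku ru] rig xin pr; pose b (c : bool) (z : strand n) : strand (n + n) :=
  (paint c z.1, z.2).
pose xs1 := b true x :: map (b false) ys.
have bK c : cancel (b c) (relabel_strand (@proj n)).
  by case=> j o; rewrite /relabel_strand /b /= paintK.
have exs : map (relabel_strand (@proj n)) xs1 = xs.
  by rewrite /= bK -map_comp (eq_map (bK false)) map_id.
have sz1 : size xs1 = size xs by rewrite /= size_map.
(* Position [l] in the slice above the minima belongs to the first minimum, and is painted
   accordingly, iff [l < 2]. *)
pose G l := nth x (ends xs) l; pose F l := b (l < 2) (G l).
have GE : ends xs = map G (iota 0 (size xs).*2).
  by rewrite -[LHS](mkseq_nth x) size_ends.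
have bends zs : map (b false) (ends zs) = ends (map (b false) zs).
  by elim: zs => //= z zs ->.
have FE : ends xs1 = map F (iota 0 (size xs).*2).
  rewrite /= -bends; congr [:: _, _ & _].
  apply: (@eq_from_nth _ (b true x)); first by rewrite !size_map size_iota size_ends.
  move=> j; rewrite size_map size_ends => lt_j.
  rewrite !(nth_map 0) ?size_iota // (nth_map x) ?size_ends // nth_iota //.
have ru1 : run [::] (plat xs1 u) = Some [::].
  rewrite run_plat; last by rewrite sz1.
  (* Each maximum joins opposite strands by [pG] and strands of one colour by [pr], so the painted
     plat closes up as well. *)
  apply: run_caps_paired; first by rewrite size_cperm size_ends.
  move: ru; rewrite run_plat // => /run_capsP[zs [szz]]; rewrite cats0 => Tz.
  have := paired_ends zs; rewrite -Tz GE FE -!map_cperm !paired_map cperm_act.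
  rewrite paired_map => pG; rewrite paired_map.
  apply: paired_and pr pG => p q /eqP e1 /eqP e2.
  by rewrite /F e1 (e2 : G q.1 = opp_strand (G p.1)).
have := rig (plat xs1 u); rewrite relabel_plat exs => /(_ erefl ru1).
case/mapP: xin => y yin xy.
have l1 : paint true x.1 \in cup_labels (plat xs1 u).
  by rewrite cup_labels_plat inE eqxx.
have l2 : paint false y.1 \in cup_labels (plat xs1 u).
  rewrite cup_labels_plat inE; apply/orP; right.
  by apply/mapP; exists (b false y) => //; exact: map_f.
by move=> /(_ _ _ l1 l2); rewrite !paintK xy => /(_ erefl)/paint_inj.
Qed.

Lemma nuniq_split (T U : eqType) (f : T -> U) xs : ~~ uniq (map f xs) ->
  exists a x b, xs = a ++ x :: b /\ f x \in map f b.
Proof.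
elim: xs => //= x xs IH; have [xin _|xn] := boolP (f x \in map f xs).
  by exists [::], x, xs.
by case/IH=> a [y [b [-> yin]]]; exists (x :: a), y, b.
Qed.

Section Classification.
Variables (n : nat) (X : rule n).
Hypotheses (Xsh : shift_closed X) (Xcc : crossing_changing X)
  (Xtc : triangle_changing X).
Hypothesis Xlifts : forall m (f : 'I_m -> 'I_n) s u v, X s u v -> bilifts f s u v.

Lemma plat_std xs u : closed_plat xs u -> is_diagram (plat xs u) ->
  exists2 v, std_plat n v & weq X [::] (plat xs u) (plat (std n) v).
Proof.
have [k] := ubnP (size xs); elim: k xs u => // k IH xs u lt_k clu dg.
have [un|nun] := boolP (uniq (map fst xs)).
  apply: (weq_std_plat Xsh clu); apply: uniq_perm => //; first exact: enum_uniq.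
  move=> i; rewrite mem_enum; have [_ occ _] := (is_diagramP _).1 dg.
  by rewrite -(cup_labels_plat _ u) occ.
have [a [x [b [xsE xin]]]] := nuniq_split nun.
have mvv := cup_move_front Xsh x a b; rewrite -xsE in mvv.
have e1 := cup_move_plat u mvv; have clv := cup_move_closed mvv clu.
have dg1 := (is_diagram_weq Xlifts e1).1 dg.
have xin' : x.1 \in map fst (a ++ b) by rewrite map_cat mem_cat xin orbT.
(* The first minimum cannot be a circle by itself: its component has another minimum, and the plat
   is rigid. *)
have [[zs [w [sz okw e2]]]|pr] := merge_or_paired Xsh Xcc Xtc clv; last first.
  have [_ _ rig] := (is_diagramP _).1 dg1.
  by case: (rigid_unpaired clv rig xin' pr).
have dg2 := (is_diagram_weq Xlifts e2).1 dg1.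
have clw : closed_plat zs w.
  by split=> //; have [] := (is_diagramP _).1 dg2.
have [|v stv e3] := IH zs w _ clw dg2.
  by case: mvv => szx _ _; move: sz lt_k; rewrite szx; lia.
by exists v => //; apply: weq_trans e1 _; apply: weq_trans e2 e3.
Qed.

Lemma diagram_std (D : diagram n) :
  exists2 v, std_plat n v & weq X [::] (sval D) (plat (std n) v).
Proof.
have [xs [u [oku e]]] := diagram_plat Xsh Xcc (diagram_closed D).
have dg := (is_diagram_weq Xlifts e).1 (diagram_is_diagram D).
have [|v stv e'] := @plat_std xs u _ dg.
  by split=> //; have [] := (is_diagramP _).1 dg.
by exists v => //; exact: weq_trans e e'.
Qed.

End Classification.

Section PlatParity.
Variables (n : nat) (i : 'I_n).

Definition odd_marks (st : seq (strand n * bool)) : bool :=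
  foldr (fun p b => ((p.1.1 == i) && p.2) (+) b) false st.

(** A real crossing changes the marks of both its strands, so the sum of the marks on [i] changes
    exactly when one of the two lies on [i] and the other does not. *)
Lemma odd_cw u st : cvalid (size st) u -> odd_marks (act u st) =
  odd_marks st (+) odd_word i (map fst st) (cw n u).
Proof.
elim: u st => [|[k q] u IH] st; first by rewrite addbF.
case/andP=> /= lt_q oku; rewrite IH ?size_at2 // step_cross size_map lt_q /=.
have -> : map fst (at2 (tog k) q st) = at2 id q (map fst st).
  by elim: q st {lt_q oku} => [|q IHq] [|x [|y t]] //=; rewrite ?IHq.
rewrite addbA; congr (_ (+) _).
elim: q st lt_q {oku} => [|q IHq] [|[x c] [|[y d] t]] // lt_q.
  rewrite /odd_layer /= /tog /= {lt_q}; case: (odd_marks t); case: k => /=;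
  by case: (x.1 == i) (y.1 == i) c d => [] [] [] [].
have := IHq ((y, d) :: t) lt_q; rewrite /= => ->.
by rewrite -!addbA.
Qed.

Lemma odd_crossless s (w : word n) :
  all (fun l => if l.1 is Cross _ then false else true) w -> odd_word i s w = false.
Proof. by elim: w s => //= -[[x||k] p] w IH s //= /IH ->. Qed.

Lemma odd_plat xs u c : closed_plat xs u -> uniq (map fst xs) ->
  act u (untog (ends xs)) = [seq (x, c x) | x <- ends xs] ->
  odd_word i [::] (plat xs u) =
  (i \in map fst xs) && (c (i, true) (+) c (i, false)).
Proof.
move=> [oku ru] un e; have rxs := run_cups xs [::]; rewrite cats0 in rxs.
have okT : cvalid (size (ends xs)) u by rewrite size_ends.
rewrite /plat (odd_word_cat _ _ rxs) (odd_word_cat _ _ (run_cw okT)).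
rewrite odd_crossless; last by rewrite all_map; apply/allP.
rewrite [X in _ (+) (_ (+) X)]odd_crossless; last by rewrite all_nseq orbT.
rewrite addbF /=; have okT' : cvalid (size (untog (ends xs))) u by rewrite size_map.
have := odd_cw okT'; rewrite map_fst_untog e.
have -> : odd_marks (untog (ends xs)) = false.
  by elim: (ends xs) => //= x s ->; rewrite andbF.
move=> /= <- {e rxs okT okT' oku ru}.
elim: xs un => //= -[j b] xs IH /andP[jn un]; rewrite IH // inE /opp_strand /=.
rewrite eq_sym; have [ji|] := eqVneq i j; last by rewrite !andFb.
rewrite ji (negPf jn) /= addbF {jn}; case: b => //=; exact: addbC.
Qed.

End PlatParity.

(** * Completeness of the parity *)

Section Completeness.
Variables (n : nat) (X : rule n).
Hypotheses (Xsh : shift_closed X) (Xcc : crossing_changing X)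
  (Xtc : triangle_changing X).
Hypothesis Xlifts : forall m (f : 'I_m -> 'I_n) s u v, X s u v -> bilifts f s u v.
Hypothesis Xodd : forall i s u v, X s u v -> odd_invariant i s u v.

Lemma std_plat_marks u : std_plat n u -> exists c,
  act u (untog (ends (std n))) = [seq (x, c x) | x <- ends (std n)].
Proof.
move=> [oku pu]; have fE : map fst (act u (untog (ends (std n)))) = ends (std n).
  by rewrite -cperm_act.
have := @graph_fun _ (act u (untog (ends (std n)))); rewrite fE.
by apply; rewrite uniq_ends // std_fst enum_uniq.
Qed.

Lemma std_plat_closed u : std_plat n u -> closed_plat (std n) u.
Proof.
case=> oku pu; split=> //; rewrite run_plat // pu.
by have := run_caps (std n) [::]; rewrite cats0.
Qed.

Theorem equiv_of_parity (D E : diagram n) :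
  (forall i, diagram_parity D i = diagram_parity E i) ->
  equiv_by (rule_union X (@link_rule n)) D E.
Proof.
move=> par; apply: (diagram_chain Xlifts).
have [u stu eu] := diagram_std Xsh Xcc Xtc Xlifts D.
have [v stv ev] := diagram_std Xsh Xcc Xtc Xlifts E.
have [c1 e1] := std_plat_marks stu; have [c2 e2] := std_plat_marks stv.
apply: (weq_trans eu); apply: (weq_trans _ (weq_sym ev)).
apply: (weq_std_plats Xsh Xcc Xtc stu stv e1 e2) => i.
have un : uniq (map fst (std n)) by rewrite std_fst enum_uniq.
have iin : i \in map fst (std n) by rewrite std_fst mem_enum.
have := odd_plat i (std_plat_closed stu) un e1; rewrite iin /= => <-.
have := odd_plat i (std_plat_closed stv) un e2; rewrite iin /= => <-.
rewrite -(odd_weq Xodd i eu) ?diagram_closed //.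
rewrite -(odd_weq Xodd i ev) ?diagram_closed //.
by apply: F2_inj; rewrite -!diagram_parityE.
Qed.

Lemma link_equiv_of_parity (L L' : vlink n) :
  (forall i, parity L i = parity L' i) -> link_equiv_by X L L'.
Proof.
move=> par; exists (repr L), (repr L'); split; try exact: reprK.
exact: equiv_of_parity.
Qed.

End Completeness.

Section Shapes.
Variable n : nat.

Lemma triangle_same_shape e k1 k2 k3 k1' k2' k3' p :
  same_shape (triangle n e k1 k2 k3 p) (triangle n e k1' k2' k3' p).
Proof.
case: e; first by exists [:: (k3, p.+1); (k2, p); (k1, p.+1)],
  [:: (k3', p.+1); (k2', p); (k1', p.+1)].
by exists [:: (k1, p); (k2, p.+1); (k3, p)], [:: (k1', p); (k2', p.+1); (k3', p)].
Qed.

Lemma vDelta_lifts m (f : 'I_m -> 'I_n) s u v : vDelta s u v -> bilifts f s u v.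
Proof.
case=> e [k1 [k2 [k3 [p [_ -> ->]]]]]; apply: same_shape_lifts.
exact: triangle_same_shape.
Qed.

Lemma vDelta_wedge_lifts m (f : 'I_m -> 'I_n) s u v :
  vDelta_wedge s u v -> bilifts f s u v.
Proof.
case=> e [k1 [k2 [k3 [p [_ _ -> ->]]]]]; apply: same_shape_lifts.
exact: triangle_same_shape.
Qed.

Lemma vSharp_lifts m (f : 'I_m -> 'I_n) s u v : vSharp s u v -> bilifts f s u v.
Proof.
case=> k [p [_ _ _ -> ->]]; apply: same_shape_lifts.
by exists [:: (k, p.+1); (k, p); (k, p.+2); (k, p.+1)],
  [:: (Virtual, p.+1); (Virtual, p); (Virtual, p.+2); (Virtual, p.+1)].
Qed.

End Shapes.

Theorem theorem1p1 (n : nat) (hn : (2 <= n)%N) (L L' : vlink n) :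
  [<-> link_equiv_by (@vDelta n) L L';
       link_equiv_by (@vDelta_wedge n) L L';
       link_equiv_by (@vSharp n) L L';
       forall i : 'I_n, parity L i = parity L' i].
Proof.
have wedge_cc := alt_crossing_changing (@vDelta_wedge_alt n) (@vDelta_wedge_sh n).
have wedge_tc := alt_triangle_changing (@vDelta_wedge_alt n) (@vDelta_wedge_sh n).
have delta_cc := alt_crossing_changing (@vDelta_alt n) (@vDelta_sh n).
have delta_tc := alt_triangle_changing (@vDelta_alt n) (@vDelta_sh n).
have wedge_lifts := @vDelta_wedge_lifts n; have delta_lifts := @vDelta_lifts n.
have sharp_lifts := @vSharp_lifts n.
have wedge_odd i := @vDelta_wedge_odd n i; have delta_odd i := @vDelta_odd n i.
have sharp_odd i := @vSharp_odd n i.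
(* Each implication between moves passes through the parities, which are invariant under the first
   move and determine the link up to the second. *)
tfae.
- move=> /(parity_link_equiv delta_lifts delta_odd).
  exact: link_equiv_of_parity (@vDelta_wedge_sh n) wedge_cc wedge_tc
    wedge_lifts wedge_odd _ _.
- move=> /(parity_link_equiv wedge_lifts wedge_odd).
  exact: link_equiv_of_parity (@vSharp_sh n) (@vSharp_crossing_changing n)
    (@vSharp_triangle_changing n) sharp_lifts sharp_odd _ _.
- exact: parity_link_equiv sharp_lifts sharp_odd _ _.
- exact: link_equiv_of_parity (@vDelta_sh n) delta_cc delta_tc
    delta_lifts delta_odd _ _.
Qed.
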